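(* There is a polynomial-time reduction from the square-root-sum problem to the permissive controller synthesis problem with randomised multi-strategies, both for static penalties and for dynamic penalties.
   Context: The square-root-sum problem: given positive rationals $x_1,\dots,x_n$ and $y$, decide whether $\sum_{i=1}^n\sqrt{x_i}\le y$. A (turn-based) stochastic game is a tuple $\mathcal{G}=\langle S_\Diamond,S_\Box,\overline{s},A,\delta\rangle$, where $S=S_\Diamond\cup S_\Box$ is a finite set of states partitioned into controller states $S_\Diamond$ and environment states $S_\Box$, $\overline{s}\in S$ is the initial state, $A$ is a finite set of actions, and $\delta:S\times A\to\mathrm{Dist}(S)$ is a partial function with rational probabilities; $A(s)=\{a\mid \delta(s,a)\text{ defined}\}$. All strategies are memoryless: $\sigma:S_\Diamond\to\mathrm{Dist}(A)$, $\pi:S_\Box\to\mathrm{Dist}(A)$, supported on enabled actions; $(\sigma,\pi)$ and $s$ induce the standard probability measure $\Pr^{\sigma,\pi}_{\mathcal G,s}$ on infinite paths from $s$. A reward structure is $r:S\times A\to\mathbb{Q}_{\ge 0}$, and $E^{\sigma,\pi}_{\mathcal G,s}(r)$ is the expectation of $\sum_{j\ge 0}r(s_j,a_j)$; it is assumed $\sup_{\sigma,\pi}E^{\sigma,\pi}_{\mathcal G,s}(r)<\infty$. A property is $\mathtt{R}^r_{\bowtie b}[\mathtt{C}]$ ($\bowtie\in\{\le,\ge\}$), satisfied under $(\sigma,\pi)$ iff $E^{\sigma,\pi}_{\mathcal G,\overline s}(r)\bowtie b$, or $\mathtt{P}_{\bowtie p}[\mathtt{F}\,g]$, satisfied iff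 the probability of reaching $g\subseteq S$ from $\overline s$ is $\bowtie p$. $\sigma$ is sound for $\phi$ if $\phi$ holds under $(\sigma,\pi)$ for every $\pi$. A multi-strategy is $\theta:S_\Diamond\to\mathrm{Dist}(2^{A})$ with $\theta(s)(\emptyset)=0$ (sets at $s$ are subsets of $A(s)$); randomised multi-strategies are arbitrary such maps. $\sigma\triangleleft\theta$ if for every $s\in S_\Diamond$ and nonempty $B\subseteq A(s)$ there is $d_{s,B}\in\mathrm{Dist}(B)$ with $\sigma(s)(a)=\sum_{B\ni a}\theta(s)(B)d_{s,B}(a)$ for all $a\in A(s)$. $\theta$ is sound for $\phi$ if every $\sigma\triangleleft\theta$ is sound for $\phi$. A penalty scheme is $(\psi,\tau)$ with $\psi:S_\Diamond\times A\to\mathbb{Q}_{\ge0}$, $\tau\in\{\mathit{sta},\mathit{dyn}\}$. Local penalty: $\mathit{pen}_{loc}(\theta,s)=\sum_{B\subseteq A(s)}\sum_{a\in A(s)\setminus B}\theta(s)(B)\psi(s,a)$. Static: $\mathit{pen}_{sta}(\theta)=\sum_{s\in S_\Diamond}\mathit{pen}_{loc}(\theta,s)$. Dynamic: with $r_\theta(s,a)=\mathit{pen}_{loc}(\theta,s)$ for $s\in S_\Diamond$ and $0$ for $s\in S_\Box$, $\mathit{pen}_{dyn}(\theta)=\sup\{E^{\sigma,\pi}_{\mathcal G,\overline s}(r_\theta)\mid\sigma\triangleleft\theta,\pi\}$. The permissive controller synthesis problem with randomised multi-strategies: given $\mathcal G$, $\phi$, $(\psi,\tau)$ and $c\in\mathbb{Q}_{\ge0}$,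 decide whether there exists a randomised multi-strategy $\theta$ sound for $\phi$ with $\mathit{pen}_\tau(\theta)\le c$. *)

(* Defs.v *)
From HB Require Import structures.
From mathcomp Require Import all_boot all_order all_algebra.
From mathcomp Require Import all_classical all_reals all_analysis.

Set Implicit Arguments.
Unset Strict Implicit.
Unset Printing Implicit Defensive.

Import Order.TTheory GRing.Theory Num.Theory.
Import numFieldNormedType.Exports.

Local Open Scope classical_set_scope.
Local Open Scope ring_scope.

(* Machines are deterministic, and their tapes are infinite in both directions. *)

Definition bits := seq bool.

(* [None] is the blank; both lists are read away from the head, and all cells *)
(* beyond their ends are blank.                                               *)
Record tape := Tape {
  tape_left : seq (option bool);
  tape_head : option bool;
  tape_right : seq (option bool) }.

Inductive direction := MoveLeft | Stay | MoveRight.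

Definition write_move (x : option bool) (d : direction) (t : tape) : tape :=
  match d with
  | MoveLeft => Tape (behead (tape_left t)) (head None (tape_left t))
                  (x :: tape_right t)
  | Stay => Tape (tape_left t) x (tape_right t)
  | MoveRight => Tape (x :: tape_left t) (head None (tape_right t))
                   (behead (tape_right t))
  end.

Record machine := Machine {
  extra_tapes : nat;
  control : finType;
  start : control;
  halting : pred control;
  transition : control -> {ffun 'I_extra_tapes.+1 -> option bool} ->
    control * {ffun 'I_extra_tapes.+1 -> option bool * direction} }.

Record configuration (M : machine) := Configuration {
  conf_state : control M;
  conf_tapes : {ffun 'I_(extra_tapes M).+1 -> tape} }.

Definition machine_step (M : machine) (c : configuration M) : configuration M :=
  if halting (conf_state c) then c else
  let: (q, act) :=
    transition (conf_state c) [ffun i => tape_head (conf_tapes c i)] in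
  Configuration q
    [ffun i => write_move (act i).1 (act i).2 (conf_tapes c i)].

Definition input_tape (w : bits) : tape :=
  Tape [::] (ohead w) (map Some (behead w)).

Definition initial_configuration (M : machine) (w : bits) : configuration M :=
  Configuration (start M)
    [ffun i => if i == ord0 then input_tape w else input_tape [::]].

Fixpoint until_blank (s : seq (option bool)) : bits :=
  if s is Some b :: s' then b :: until_blank s' else [::].

(* The output is the word that starts under the head of the last tape. *)
Definition machine_output (M : machine) (c : configuration M) : bits :=
  let t := conf_tapes c ord_max in until_blank (tape_head t :: tape_right t).

Definition polytime_computable_on (D : set bits) (f : bits -> bits) : Prop :=
  exists (M : machine) (a k : nat), forall w : bits, D w ->
    exists2 t : nat, (t <= a * size w ^ k + a)%N &
      let c := iter t (@machine_step M) (initial_configuration M w) in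
      halting (conf_state c) /\ machine_output c = f w.

(* [pcode x] is the set of words that denote the instance [x]; there are      *)
(* several, because a rational may be given by any of its fractions.          *)
Record problem := Problem {
  pinstance : Type;
  pcode : pinstance -> set bits;
  pyes : pinstance -> Prop }.

Definition polytime_reducible (P Q : problem) : Prop :=
  exists f : bits -> bits,
    polytime_computable_on [set w | exists x : pinstance P, pcode x w] f /\
    forall (x : pinstance P) (w : bits), pcode x w ->
      exists2 y : pinstance Q, pcode y (f w) & (pyes x <-> pyes y).

Definition code_cat (L L' : set bits) : set bits :=
  [set w | exists u v, [/\ L u, L' v & w = u ++ v]].
Infix "+++" := code_cat (at level 55, right associativity).

Definition bits_value (s : bits) : nat := foldr (fun (b : bool) n => b + n.*2)%N 0%N s.

(* Binary digits, least significant first and without superfluous zeros, each *)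
(* preceded by [true]; then [false].                                          *)
Definition code_nat (n : nat) : set bits :=
  [set w | exists s : bits, [/\ bits_value s = n, last true s &
             w = flatten [seq [:: true; b] | b <- s] ++ [:: false]]].

Definition code_rat (q : rat) : set bits :=
  [set w | exists a b : nat, [/\ (0 < b)%N, q = a%:R / b%:R &
             (code_nat a +++ code_nat b) w]].

Definition code_bool (b : bool) : set bits := [set [:: b]].

Definition code_option (T : Type) (C : T -> set bits) (x : option T) :
    set bits :=
  if x is Some y then code_bool true +++ C y else code_bool false.

Fixpoint code_seq (T : Type) (C : T -> set bits) (s : seq T) : set bits :=
  if s is x :: s' then code_bool true +++ C x +++ code_seq C s'
  else code_bool false.

Definition code_fun (n : nat) (T : Type) (C : T -> set bits) (f : 'I_n -> T) :
    set bits :=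
  code_seq C [seq f i | i <- enum 'I_n].

Record sqrt_sum_instance := SqrtSumInstance {
  ss_terms : seq rat;
  ss_bound : rat;
  ss_terms_gt0 : forall x, x \in ss_terms -> 0 < x;
  ss_bound_gt0 : 0 < ss_bound }.

Definition sqrt_sum_problem (R : realType) : problem := {|
  pinstance := sqrt_sum_instance;
  pcode := fun I => code_seq code_rat (ss_terms I) +++ code_rat (ss_bound I);
  pyes := fun I =>
    \sum_(x <- ss_terms I) Num.sqrt (ratr x : R) <= ratr (ss_bound I) |}.

Record dist (K : numDomainType) (T : finType) := Dist {
  dist_fun :> T -> K;
  dist_ge0 : forall x, 0 <= dist_fun x;
  dist_sum1 : \sum_x dist_fun x = 1 }.

(* The states are 0, ..., n and the actions 0, ..., m (without actions there  *)
(* are no strategies and no infinite paths).                                  *)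
Record game := Game {
  last_state : nat;
  last_action : nat;
  is_controller : pred 'I_last_state.+1;
  init_state : 'I_last_state.+1;
  delta : 'I_last_state.+1 -> 'I_last_action.+1 ->
          option (dist rat 'I_last_state.+1) }.

Definition state (G : game) := 'I_(last_state G).+1.
Definition action (G : game) := 'I_(last_action G).+1.

Definition enabled (G : game) (s : state G) : {set action G} :=
  [set a : action G | isSome (delta s a)]%SET.

(* A strategy of the controller ([b = true]) or of the environment            *)
(* ([b = false]). Its values at the states of the other player are never used. *)
Record strategy (R : realType) (G : game) (b : bool) := Strategy {
  strategy_fun :> state G -> dist R (action G);
  strategy_enabled : forall s, is_controller s = b ->
    forall a, a \notin enabled s -> strategy_fun s a = 0 }.

(* The infinite path s_0 a_0 s_1 a_1 ... is the map j |-> (s_j, a_j). *)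
Definition path_of (n m : nat) := nat -> 'I_n.+1 * 'I_m.+1.
HB.instance Definition _ n m := gen_eqMixin (path_of n m).
HB.instance Definition _ n m := gen_choiceMixin (path_of n m).
HB.instance Definition _ n m :=
  isPointed.Build (path_of n m) (fun=> (ord0, ord0)).

(* The paths that agree with [w] on the first [k] positions. *)
Definition cylinder (n m : nat) (w : path_of n m) (k : nat) :
    set (path_of n m) :=
  [set w' | forall j, (j < k)%N -> w' j = w j].

Definition cylinders (n m : nat) : set (set (path_of n m)) :=
  [set C | exists w k, C = cylinder w k].

Definition path_space (n m : nat) := g_sigma_algebraType (@cylinders n m).

Definition gpath (G : game) := path_space (last_state G) (last_action G).

Section PathMeasure.
Variables (R : realType) (G : game).
Variables (sigma : strategy R G true) (pi : strategy R G false).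

Definition choice_prob (s : state G) (a : action G) : R :=
  if is_controller s then sigma s a else pi s a.

Definition trans_prob (s : state G) (a : action G) (t : state G) : R :=
  if delta s a is Some d then ratr (d t) else 0.

(* The probability of the finite path made of the first [k] pairs of [w]. *)
Definition prefix_prob (s : state G) (w : gpath G) (k : nat) : R :=
  ((k == 0%N) || ((w 0%N).1 == s))%:R *
  (\prod_(j < k) choice_prob (w j).1 (w j).2) *
  (\prod_(j < k.-1) trans_prob (w j).1 (w j).2 (w j.+1).1).

Definition is_path_measure (s : state G) (P : probability (gpath G) R) : Prop :=
  forall w k, P (cylinder w k) = (prefix_prob s w k)%:E.

End PathMeasure.

(* Existence: split [0, 1[ into consecutive intervals whose lengths are the   *)
(* probabilities of the finite paths, and push the uniform measure forward.   *)
Section PathLaw.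
Variables (R : realType) (n m : nat).
Let X : finType := ('I_n.+1 * 'I_m.+1)%type.
Variable f : seq X -> R.
Hypothesis f_nil : f [::] = 1.
Hypothesis f_ge0 : forall p, 0 <= f p.
Hypothesis f_rcons : forall p, f p = \sum_(x : X) f (rcons p x).

Let x0 : X := (ord0, ord0).

Fixpoint locate (g : X -> R) (a : R) (s : seq X) (u : R) : X :=
  if s is x :: s' then
    if u < a + g x then x else locate g (a + g x) s' u
  else x0.

Fixpoint offset (g : X -> R) (s : seq X) (x : X) : R :=
  if s is y :: s' then
    if y == x then 0 else g y + offset g s' x
  else 0.

Lemma offset_ge0 g s x : (forall y, 0 <= g y) -> 0 <= offset g s x.
Proof.
by move=> g0; elim: s => //= y s IH; case: eqP => // _; rewrite addr_ge0.
Qed.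

Lemma offset_le g s x : (forall y, 0 <= g y) -> x \in s ->
  offset g s x + g x <= \sum_(y <- s) g y.
Proof.
move=> g0; elim: s => //= y s IH; rewrite inE big_cons eq_sym.
case: eqP => [-> _|_ /= xs].
  by rewrite add0r lerDl sumr_ge0.
by rewrite -addrA lerD2l IH.
Qed.

Lemma locate_in g a s u : a <= u < a + \sum_(y <- s) g y ->
  locate g a s u \in s.
Proof.
elim: s a => [|y s IH] a /=.
  by rewrite big_nil addr0 => /andP[/le_lt_trans h /h]; rewrite ltxx.
rewrite big_cons addrA inE => /andP[_ us]; case: ltP => [_|yu].
  by rewrite eqxx.
by rewrite IH ?orbT // yu us.
Qed.

Lemma locateP g a s u x : (forall y, 0 <= g y) -> uniq s -> x \in s ->
  a <= u < a + \sum_(y <- s) g y ->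
  (locate g a s u == x) = (a + offset g s x <= u < a + offset g s x + g x).
Proof.
move=> g0; elim: s a => //= y s IH a /andP[ys us].
rewrite inE big_cons addrA eq_sym; case: (eqVneq y x) => [<- _|yx /= xs].
  move=> /andP[au ub]; rewrite addr0 au /=.
  case: ltP => [_|yu]; first by rewrite eqxx.
  apply/negbTE; apply: contraNneq ys => <-.
  by apply: locate_in; rewrite yu ub.
move=> /andP[au ub]; rewrite !addrA; case: ltP => [uy|yu].
  rewrite (negbTE yx); apply/esym/negbTE; rewrite negb_and -ltNge.
  by rewrite (lt_le_trans uy) // lerDl offset_ge0.
by rewrite IH // yu ub.
Qed.

Fixpoint low_rev (p : seq X) : R :=
  if p is x :: p' then
    low_rev p' + offset (fun y => f (rcons (rev p') y)) (enum X) x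
  else 0.
Definition low (p : seq X) := low_rev (rev p).

Lemma low_rcons p x :
  low (rcons p x) = low p + offset (fun y => f (rcons p y)) (enum X) x.
Proof. by rewrite /low rev_rcons /= revK. Qed.

Definition next_letter (u : R) (p : seq X) : X :=
  locate (fun y => f (rcons p y)) (low p) (enum X) u.

Fixpoint draw_prefix (u : R) (k : nat) : seq X :=
  if k is k'.+1 then
    let p := draw_prefix u k' in rcons p (next_letter u p)
  else [::].

Lemma draw_prefixP u p : 0 <= u < 1 ->
  (draw_prefix u (size p) == p) = (low p <= u < low p + f p).
Proof.
move=> u01; elim/last_ind: p => [|p x IH].
  by rewrite /= eqxx /low /= add0r f_nil u01.
rewrite size_rcons /= eqseq_rcons low_rcons.
have xE : x \in enum X by rewrite mem_enum.
have sumE : \sum_(y <- enum X) f (rcons p y) = f p.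
  by rewrite f_rcons big_enum.
case: eqP IH => [-> /esym IH|_ /esym/negbT IH] /=.
  by rewrite locateP ?enum_uniq // sumE.
apply/esym/negbTE; apply: contra IH => /andP[lu ul]; apply/andP; split.
  by apply: le_trans lu; rewrite lerDl offset_ge0.
apply: lt_le_trans ul _; rewrite -addrA lerD2l -sumE.
exact: (@offset_le (fun y => f (rcons p y))).
Qed.

Definition draw_path (u : measurableTypeR R) : path_space n m :=
  fun k => if (0 <= u < 1) then next_letter u (draw_prefix u k) else x0.

Lemma draw_pathE u k : 0 <= u < 1 -> mkseq (draw_path u) k = draw_prefix u k.
Proof.
by move=> u01; elim: k => // k IH; rewrite mkseqS IH /= /draw_path u01.
Qed.

Let word_cylinder (p : seq X) : set (path_space n m) :=
  [set w | mkseq w (size p) = p].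

Lemma cylinderE (w : path_of n m) k : cylinder w k = word_cylinder (mkseq w k).
Proof.
apply/seteqP; split => w' /=; rewrite /word_cylinder /cylinder /= size_mkseq.
  move=> ww'; apply: (@eq_from_nth _ x0); rewrite ?size_mkseq // => i ik.
  by rewrite !nth_mkseq ?ww'.
by move=> /(congr1 (fun s => nth x0 s)) E j jk; have := congr1 (@^~ j) E;
   rewrite !nth_mkseq.
Qed.

Lemma draw_path_preimage p :
  `[0, 1[%classic `&` draw_path @^-1` word_cylinder p =
  `[low p, low p + f p[%classic `&` `[0, 1[%classic.
Proof.
apply/seteqP; split => u /=; rewrite !in_itv /=.
  by move=> [u01]; rewrite /word_cylinder /= draw_pathE // => /eqP;
     rewrite draw_prefixP.
move=> [up u01]; split=> //; rewrite /word_cylinder /= draw_pathE //.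
by apply/eqP; rewrite draw_prefixP.
Qed.

Lemma measurable_draw_path : measurable_fun setT draw_path.
Proof.
apply: (@measurability _ _ _ (path_space n m) _ _ (@cylinders n m) erefl).
move=> _ [_ [w [k ->]] <-]; rewrite setTI cylinderE.
set p := mkseq w k.
rewrite -(setTI (_ @^-1` _)) -(setUv `[0, 1[%classic) setIUl.
rewrite draw_path_preimage; apply: measurableU.
  by apply: measurableI; exact: measurable_itv.
have [pt0|pt0] := pselect (word_cylinder p (fun=> x0)).
  rewrite (_ : _ `&` _ = ~` `[0, 1[%classic).
    by apply: measurableC; exact: measurable_itv.
  apply/seteqP; split => u /=; first by case.
  move=> u01; split=> //; rewrite in_itv /= in u01.
  suff -> : draw_path u = (fun=> x0) by [].
  by apply/funext => j; rewrite /draw_path; case: ifP.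
rewrite (_ : _ `&` _ = set0); first exact: measurable0.
apply/seteqP; split => u //= -[u01]; rewrite in_itv /= in u01.
suff -> : draw_path u = (fun=> x0) by [].
by apply/funext => j; rewrite /draw_path; case: ifP.
Qed.

HB.instance Definition _ := isMeasurableFun.Build _ _ _ _ draw_path
  measurable_draw_path.

Let mI01 : measurable (`[0%R, 1%R[%classic : set (measurableTypeR R)).
Proof. exact: measurable_itv. Qed.

Definition unit_interval_prob : set (measurableTypeR R) -> \bar R :=
  mrestr (@lebesgue_measure R) mI01.

HB.instance Definition _ := Measure.on unit_interval_prob.

Lemma unit_interval_probT : unit_interval_prob setT = 1%E.
Proof.
rewrite /unit_interval_prob /mrestr setTI lebesgue_measure_itv /= lte_fin ltr01.
by rewrite oppr0 adde0.
Qed.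

HB.instance Definition _ := Measure_isProbability.Build _ _ _
  unit_interval_prob unit_interval_probT.

Lemma path_law_exists : exists P : probability (path_space n m) R,
  forall w k, P (cylinder w k) = (f (mkseq w k))%:E.
Proof.
exists (distribution unit_interval_prob draw_path) => w k.
rewrite cylinderE; set p := mkseq w k.
rewrite /= /distribution /pushforward /= /unit_interval_prob /mrestr.
rewrite setIC draw_path_preimage.
have low_ge0 : 0 <= low p.
  elim/last_ind: (p) => [|q x IH]; first by rewrite /low.
  by rewrite low_rcons addr_ge0 // offset_ge0.
have low_le1 : low p + f p <= 1.
  elim/last_ind: (p) => [|q x IH]; first by rewrite /low /= f_nil add0r.
  apply: le_trans IH; rewrite low_rcons -addrA lerD2l (f_rcons q) -big_enum.
  by apply: (@offset_le (fun y => f (rcons q y))); rewrite ?mem_enum.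
rewrite setIidl; last first.
  move=> u /=; rewrite !in_itv /= => /andP[lu ul].
  by rewrite (le_trans low_ge0 lu) (lt_le_trans ul low_le1).
rewrite lebesgue_measure_itv /= lte_fin ltrDl -EFinD.
case: ltP => [_|f0]; first by rewrite addrC addKr.
by congr EFin; apply/eqP; rewrite eq_le f_ge0 f0.
Qed.

End PathLaw.

Section PathMeasureExists.
Variables (R : realType) (G : game).
Variables (sigma : strategy R G true) (pi : strategy R G false).

Let x0 : state G * action G := (ord0, ord0).

Lemma choice_prob_ge0 s a : 0 <= choice_prob sigma pi s a.
Proof. by rewrite /choice_prob; case: ifP => _; exact: dist_ge0. Qed.

Lemma choice_prob_sum1 s : \sum_a choice_prob sigma pi s a = 1.
Proof.
by rewrite -[RHS](dist_sum1 (if is_controller s then sigma s else pi s));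
   apply: eq_bigr => a _; rewrite /choice_prob; case: ifP.
Qed.

Lemma choice_prob_disabled s a :
  a \notin enabled s -> choice_prob sigma pi s a = 0.
Proof.
by move=> sa; rewrite /choice_prob; case: ifPn => [h|/negbTE h];
   apply: strategy_enabled.
Qed.

Lemma trans_prob_ge0 (s : state G) a t : 0 <= trans_prob R s a t.
Proof.
by rewrite /trans_prob; case: (delta s a) => [d|//]; rewrite ler0q dist_ge0.
Qed.

Lemma trans_prob_sum1 (s : state G) a :
  a \in enabled s -> \sum_t trans_prob R s a t = 1.
Proof.
rewrite inE /trans_prob; case: (delta s a) => [d _|//].
by rewrite -rmorph_sum dist_sum1 rmorph1.
Qed.

Lemma prefix_prob_eq s (w w' : gpath G) k :
  (forall j, (j < k)%N -> w j = w' j) ->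
  prefix_prob sigma pi s w k = prefix_prob sigma pi s w' k.
Proof.
move=> ww'; rewrite /prefix_prob; congr (_ * _ * _).
- by case: k ww' => // k ww'; rewrite ww'.
- by apply: eq_bigr => j _; rewrite ww'.
apply: eq_bigr => j _; case: k ww' j => [|k] ww' [j jk] //=.
by rewrite !ww' // ltnW.
Qed.

Lemma prefix_prob_recr s (w : gpath G) k :
  prefix_prob sigma pi s w k.+2 = prefix_prob sigma pi s w k.+1 *
    (trans_prob R (w k).1 (w k).2 (w k.+1).1 *
     choice_prob sigma pi (w k.+1).1 (w k.+1).2).
Proof.
rewrite /prefix_prob /= [in LHS]big_ord_recr [X in _ * _ * X = _]big_ord_recr /=.
by rewrite -!mulrA; congr (_ * (_ * _)); rewrite mulrC -mulrA.
Qed.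

Lemma path_measure_exists s :
  exists P : probability (gpath G) R, is_path_measure sigma pi s P.
Proof.
pose f (p : seq (state G * action G)) :=
  prefix_prob sigma pi s (nth x0 p : gpath G) (size p).
have f_nil : f [::] = 1 by rewrite /f /prefix_prob /= !big_ord0 !mulr1.
have f_ge0 p : 0 <= f p.
  rewrite /f /prefix_prob !mulr_ge0 ?ler0n //; apply: prodr_ge0 => j _.
    exact: choice_prob_ge0.
  exact: trans_prob_ge0.
have f_rcons p : f p = \sum_x f (rcons p x).
  have [->|] := eqVneq p [::].
    rewrite f_nil /f /prefix_prob /=.
    under eq_bigr do rewrite big_ord_recl !big_ord0 !mulr1 /=.
    rewrite -(pair_bigA _ (fun t a => (t == s)%:R * choice_prob sigma pi t a)) /=.
    rewrite (bigD1 s) //= [X in _ + X]big1 ?addr0.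
      under eq_bigr do rewrite eqxx mul1r.
      by rewrite choice_prob_sum1.
    by move=> t /negbTE ->; apply: big1 => a _; rewrite mul0r.
  case/lastP: p => // p [u b] _.
  have E x : f (rcons (rcons p (u, b)) x) = f (rcons p (u, b)) *
      (trans_prob R u b x.1 * choice_prob sigma pi x.1 x.2).
    rewrite /f [in LHS]size_rcons !size_rcons prefix_prob_recr.
    rewrite !nth_rcons size_rcons ltnn ltnSn !eqxx ltnn; congr (_ * _).
    by apply: prefix_prob_eq => j jp; rewrite nth_rcons size_rcons jp.
  under eq_bigr do rewrite E.
  rewrite -mulr_sumr.
  rewrite -(pair_bigA _ (fun t a => trans_prob R u b t * choice_prob sigma pi t a)).
  under eq_bigr do rewrite /= -mulr_sumr choice_prob_sum1 mulr1.
  have [/trans_prob_sum1 ->|/choice_prob_disabled ub] := boolP (b \in enabled u).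
    by rewrite mulr1.
  suff -> : f (rcons p (u, b)) = 0 by rewrite mul0r.
  have pE : nth x0 (rcons p (u, b)) (size p) = (u, b).
    by rewrite nth_rcons ltnn eqxx.
  rewrite /f /prefix_prob size_rcons big_ord_recr /= pE /= ub.
  by rewrite mulr0 mulr0 mul0r.
have [P PE] := path_law_exists f_nil f_ge0 f_rcons.
exists P => w k; rewrite PE /f size_mkseq; congr EFin.
by apply: prefix_prob_eq => j jk; rewrite nth_mkseq.
Qed.

Lemma path_measure_unique s (P Q : probability (gpath G) R) :
  is_path_measure sigma pi s P -> is_path_measure sigma pi s Q ->
  forall A, measurable A -> P A = Q A.
Proof.
move=> PE QE; pose C := [set A | A = set0 \/ cylinders A] : set (set (gpath G)).
have CI : setI_closed C.
  move=> A B [->|[w [k ->]]]; first by left; rewrite set0I.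
  move=> [->|[w' [k' ->]]]; first by left; rewrite setI0.
  wlog kk' : w w' k k' / (k <= k')%N.
    by move=> H; case/orP: (leq_total k k') => /H // H'; rewrite setIC; exact: H'.
  have [ww'|ww'] := pselect (forall j, (j < k)%N -> w' j = w j); [right|left].
    exists w', k'; apply/setIidPr => v /= vw' j jk.
    by rewrite vw' ?ww' // (leq_trans jk).
  apply/seteqP; split => // v [/= vw vw']; apply: ww' => j jk.
  by rewrite -vw // vw' // (leq_trans jk).
apply: (measure_unique C (fun=> setT)) => //.
- apply/seteqP; split; apply: smallest_sub; try exact: smallest_sigma_algebra.
    by move=> A CA; apply: sub_sigma_algebra; right.
  move=> A [->|CA]; first exact: (@measurable0 _ (gpath G)).
  exact: sub_sigma_algebra.
- by move=> _; right; exists (fun=> x0), 0%N; apply/seteqP; split.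
- by rewrite bigcup_const.
- move=> A [->|[w [k ->]]]; first by rewrite !measure0.
  exact: etrans (PE w k) (esym (QE w k)).
- by move=> _; rewrite /= probability_setT ltry.
Qed.

Definition path_measure (s : state G) : probability (gpath G) R :=
  projT1 (cid (path_measure_exists s)).

Lemma path_measureP s : is_path_measure sigma pi s (path_measure s).
Proof. exact: projT2 (cid (path_measure_exists s)). Qed.

End PathMeasureExists.

Definition expected_reward (R : realType) (G : game) (sigma : strategy R G true)
    (pi : strategy R G false) (s : state G) (r : state G -> action G -> R) :
    \bar R :=
  (\int[path_measure sigma pi s]_w
     \sum_(0 <= j <oo) (r (w j).1 (w j).2)%:E)%E.

Definition reach_prob (R : realType) (G : game) (sigma : strategy R G true)
    (pi : strategy R G false) (s : state G) (g : {set state G}) : \bar R :=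
  path_measure sigma pi s [set w | exists j, (w j).1 \in g].

Inductive comparison := AtMost | AtLeast.

Definition compare (R : realType) (op : comparison) (x y : \bar R) : Prop :=
  match op with AtMost => (x <= y)%E | AtLeast => (y <= x)%E end.

Inductive property (G : game) :=
  | RewardProperty (op : comparison) (r : state G -> action G -> rat) (b : rat)
  | ReachProperty (op : comparison) (p : rat) (g : {set state G}).

(* Besides the ranges of the numbers, this is the standing assumption that    *)
(* the expected rewards are bounded.                                          *)
Definition well_formed (R : realType) (G : game) (phi : property G) : Prop :=
  match phi with
  | RewardProperty _ r b =>
      [/\ forall s a, 0 <= r s a, 0 <= b &
        forall s, (ereal_sup [set e | exists (sigma : strategy R G true)
          (pi : strategy R G false),
          e = expected_reward sigma pi s (fun t a => ratr (r t a))] < +oo)%E]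
  | ReachProperty _ p _ => 0 <= p <= 1
  end.

Definition satisfies (R : realType) (G : game) (sigma : strategy R G true)
    (pi : strategy R G false) (phi : property G) : Prop :=
  match phi with
  | RewardProperty op r b =>
      compare op
        (expected_reward sigma pi (init_state G) (fun s a => ratr (r s a)))
        (ratr b)%:E
  | ReachProperty op p g =>
      compare op (reach_prob sigma pi (init_state G) g) (ratr p)%:E
  end.

Definition strategy_sound (R : realType) (G : game) (phi : property G)
    (sigma : strategy R G true) : Prop :=
  forall pi : strategy R G false, satisfies sigma pi phi.

(* As for strategies, only the values at controller states matter. *)
Record multi_strategy (R : realType) (G : game) := MultiStrategy {
  multi_fun :> state G -> dist R {set action G};
  multi_set0 : forall s, is_controller s -> multi_fun s finset.set0 = 0;
  multi_enabled : forall s, is_controller s ->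
    forall B : {set action G}, ~~ (B \subset enabled s) -> multi_fun s B = 0 }.

Definition compliant (R : realType) (G : game) (theta : multi_strategy R G)
    (sigma : strategy R G true) : Prop :=
  forall s : state G, is_controller s ->
    exists d : {set action G} -> dist R (action G),
      (forall B : {set action G}, B != finset.set0 -> B \subset enabled s ->
         forall a, a \notin B -> d B a = 0) /\
      (forall a, a \in enabled s ->
         sigma s a = \sum_(B : {set action G} | (B \subset enabled s) && (a \in B))
                       theta s B * d B a).

Definition multi_sound (R : realType) (G : game) (phi : property G)
    (theta : multi_strategy R G) : Prop :=
  forall sigma, compliant theta sigma -> strategy_sound phi sigma.

Inductive penalty_type := StaticPenalty | DynamicPenalty.

Section Penalty.
Variables (R : realType) (G : game).
Variables (psi : state G -> action G -> rat) (theta : multi_strategy R G).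

Definition local_penalty (s : state G) : R :=
  \sum_(B : {set action G} | B \subset enabled s)
    \sum_(a in enabled s :\: B) theta s B * ratr (psi s a).

Definition static_penalty : R :=
  \sum_(s : state G | is_controller s) local_penalty s.

Definition penalty_reward (s : state G) (a : action G) : R :=
  if is_controller s then local_penalty s else 0.

Definition dynamic_penalty : \bar R :=
  ereal_sup [set e | exists (sigma : strategy R G true)
    (pi : strategy R G false), compliant theta sigma /\
    e = expected_reward sigma pi (init_state G) penalty_reward].

Definition penalty (tau : penalty_type) : \bar R :=
  match tau with
  | StaticPenalty => static_penalty%:E
  | DynamicPenalty => dynamic_penalty
  end.

End Penalty.

(* The values of [pcs_psi] at environment states never matter. *)
Record pcs_instance (R : realType) := PcsInstance {
  pcs_game : game;
  pcs_property : property pcs_game;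
  pcs_psi : state pcs_game -> action pcs_game -> rat;
  pcs_bound : rat;
  pcs_well_formed : well_formed R pcs_property;
  pcs_psi_ge0 : forall s a, 0 <= pcs_psi s a;
  pcs_bound_ge0 : 0 <= pcs_bound }.

Definition code_game (G : game) : set bits :=
  code_nat (last_state G) +++ code_nat (last_action G) +++
  code_fun code_bool (@is_controller G) +++ code_nat (init_state G) +++
  code_fun (code_fun (code_option (fun d : dist rat _ => code_fun code_rat d)))
    (@delta G).

Definition code_comparison (op : comparison) : set bits :=
  code_bool (if op is AtMost then true else false).

Definition code_property (G : game) (phi : property G) : set bits :=
  match phi with
  | RewardProperty op r b =>
      code_bool true +++ code_comparison op +++ code_fun (code_fun code_rat) r
        +++ code_rat b
  | ReachProperty op p g =>
      code_bool false +++ code_comparison op +++ code_rat p +++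
      code_fun code_bool (fun s => s \in g)
  end.

Definition pcs_problem (R : realType) (tau : penalty_type) : problem := {|
  pinstance := pcs_instance R;
  pcode := fun I =>
    code_game (pcs_game I) +++ code_property (pcs_property I) +++
    code_fun (code_fun code_rat) (@pcs_psi R I) +++ code_rat (pcs_bound I);
  pyes := fun I =>
    exists theta : multi_strategy R (pcs_game I),
      multi_sound (pcs_property I) theta /\
      (penalty (@pcs_psi R I) theta tau <= (ratr (pcs_bound I))%:E)%E |}.

Definition unambiguous (T : Type) (C : T -> set bits) : Prop :=
  forall x y u v u' v', C x u -> C y v -> u ++ u' = v ++ v' ->
    x = y /\ u' = v'.

Lemma unambiguous_bool : unambiguous code_bool.
Proof. by move=> x y u v u' v' -> -> [-> ->]. Qed.

Lemma unambiguous_cat (T U : Type) (C : T -> set bits) (D : U -> set bits) :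
  unambiguous C -> unambiguous D ->
  unambiguous (fun p : T * U => C p.1 +++ D p.2).
Proof.
move=> uC uD [x y] [x' y'] _ _ w w' /= [u [v [Cu Dv ->]]] [u' [v' [Cu' Dv' ->]]].
rewrite -!catA => /(uC _ _ _ _ _ _ Cu Cu') [-> /(uD _ _ _ _ _ _ Dv Dv')].
by case=> -> ->.
Qed.

Lemma bits_value_inj s t : last true s -> last true t ->
  bits_value s = bits_value t -> s = t.
Proof.
have pos b s' : last true (b :: s') -> (0 < bits_value (b :: s'))%N.
  elim: s' b => [|c s' IH] b /=; first by move=> ->.
  by move=> h; rewrite addn_gt0 double_gt0 (IH c) ?orbT.
elim: s t => [|b s IH] [|c t] // ls lt E.
- by have := pos c t lt; rewrite -E.
- by have := pos b s ls; rewrite E.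
have bc : b = c.
  by move: (congr1 odd E); rewrite /= !oddD !odd_double !addbF !oddb.
rewrite bc in ls E *; congr (_ :: _); apply: IH.
- by case: (s) ls.
- by case: (t) lt.
by move: E => /= /addnI /double_inj.
Qed.

Lemma unambiguous_nat : unambiguous code_nat.
Proof.
move=> x y _ _ u' v' [s [<- ls ->]] [t [<- lt ->]]; rewrite -!catA => E.
suff [-> ->] : s = t /\ u' = v' by [].
elim: s t E {ls lt} => [|b s IH] [|c t] //= [].
  by move=> ->.
by move=> -> /IH [-> ->].
Qed.

Lemma unambiguous_rat : unambiguous code_rat.
Proof.
move=> x y u v u' v' [a [b [_ -> ab]]] [a' [b' [_ -> ab']]] E.
have [] := unambiguous_cat unambiguous_nat unambiguous_nat
  (x := (a, b)) (y := (a', b')) ab ab' E.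
by case=> -> ->.
Qed.

Lemma unambiguous_option (T : Type) (C : T -> set bits) :
  unambiguous C -> unambiguous (code_option C).
Proof.
move=> uC [x|] [y|] u v u' v' /=.
- move=> [_ [w [-> Cw ->]]] [_ [z [-> Cz ->]]] [].
  by move=> /(uC _ _ _ _ _ _ Cw Cz) [-> ->].
- by move=> [_ [w [-> Cw ->]]] ->.
- by move=> -> [_ [w [-> Cw ->]]].
by move=> -> -> [->].
Qed.

Lemma unambiguous_seq (T : Type) (C : T -> set bits) :
  unambiguous C -> unambiguous (code_seq C).
Proof.
move=> uC; elim=> [|x s IH] [|y t] u v u' v' /=.
- by move=> -> -> [->].
- by move=> -> [_ [w [-> _ ->]]].
- by move=> [_ [w [-> _ ->]]] ->.
move=> [_ [_ [-> [w [z [Cw Cz ->]]] ->]]] [_ [_ [-> [w' [z' [Cw' Cz' ->]]] ->]]].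
move=> [] /=; rewrite -!catA => /(uC _ _ _ _ _ _ Cw Cw') [->].
by move=> /(IH _ _ _ _ _ Cz Cz') [-> ->].
Qed.

Lemma unambiguous_fun (n : nat) (T : Type) (C : T -> set bits) :
  unambiguous C -> unambiguous (@code_fun n T C).
Proof.
move=> uC f g u v u' v' cf cg /(unambiguous_seq uC cf cg) [E ->]; split=> //.
by apply/funext => i; move/eq_in_map: E; apply; rewrite mem_enum.
Qed.

Lemma dist_inj (K : numDomainType) (T : finType) (d e : dist K T) :
  dist_fun d = dist_fun e -> d = e.
Proof.
case: d e => [f f0 f1] [g g0 g1] /= E; rewrite E in f0 f1 *.
by congr Dist; exact: Prop_irrelevance.
Qed.

Lemma unambiguous_dist n :
  unambiguous (fun d : dist rat 'I_n => code_fun code_rat d).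
Proof.
move=> d e u v u' v' cd ce /(unambiguous_fun unambiguous_rat cd ce) [E ->].
by split=> //; exact: dist_inj.
Qed.

Lemma unambiguous_comparison : unambiguous code_comparison.
Proof.
move=> x y u v u' v' cx cy /(unambiguous_bool cx cy) [E ->]; split=> //.
by case: x y E {cx cy} => -[].
Qed.

Lemma unambiguous_game : unambiguous code_game.
Proof.
move=> [n m o i d] [n' m' o' i' d'] u0 v0 z z'.
move=> [u1 [? [/= c1 [u2 [? [c2 [u3 [? [c3 [u4 [u5 [c4 c5 ->]]] ->]]] ->]]] ->]]].
move=> [v1 [? [/= e1 [v2 [? [e2 [v3 [? [e3 [v4 [v5 [e4 e5 ->]]] ->]]] ->]]] ->]]].
rewrite -!catA => /(unambiguous_nat c1 e1) [En].
move=> /(unambiguous_nat c2 e2) [Em]; subst n' m'.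
move=> /(unambiguous_fun unambiguous_bool c3 e3) [Eo]; subst o'.
move=> /(unambiguous_nat c4 e4) [/val_inj Ei]; subst i'.
move=> /(unambiguous_fun (unambiguous_fun (unambiguous_option
          (@unambiguous_dist _))) c5 e5) [Ed ->].
by subst d'.
Qed.

Lemma unambiguous_property G : unambiguous (@code_property G).
Proof.
move=> [op r b|op p g] [op' r' b'|op' p' g'] u0 v0 z z'.
- move=> [_ [? [/= -> [u2 [? [c2 [u3 [u4 [c3 c4 ->]]] ->]]] ->]]].
  move=> [_ [? [/= -> [v2 [? [e2 [v3 [v4 [e3 e4 ->]]] ->]]] ->]]].
  rewrite -!catA => -[] /(unambiguous_comparison c2 e2) [->].
  move=> /(unambiguous_fun (unambiguous_fun unambiguous_rat) c3 e3) [->].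
  by move=> /(unambiguous_rat c4 e4) [-> ->].
- by move=> [_ [? [/= -> _ ->]]] [_ [? [/= -> _ ->]]].
- by move=> [_ [? [/= -> _ ->]]] [_ [? [/= -> _ ->]]].
move=> [_ [? [/= -> [u2 [? [c2 [u3 [u4 [c3 c4 ->]]] ->]]] ->]]].
move=> [_ [? [/= -> [v2 [? [e2 [v3 [v4 [e3 e4 ->]]] ->]]] ->]]].
rewrite -!catA => -[] /(unambiguous_comparison c2 e2) [->].
move=> /(unambiguous_rat c3 e3) [->].
move=> /(unambiguous_fun unambiguous_bool c4 e4) [gg' ->]; split=> //.
by congr ReachProperty; apply/setP => s; exact: (congr1 (@^~ s) gg').
Qed.

Lemma pcs_code_inj R tau (I J : pinstance (pcs_problem R tau)) w :
  pcode I w -> pcode J w -> I = J.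
Proof.
move: I J => [G phi psi c h1 h2 h3] [G' phi' psi' c' h1' h2' h3'] /=.
move=> [u1 [? [/= c1 [u2 [? [c2 [u3 [u4 [c3 c4 ->]]] ->]]] ->]]].
move=> [v1 [? [/= e1 [v2 [? [e2 [v3 [v4 [e3 e4 ->]]] ->]]]]]].
move=> /(unambiguous_game c1 e1) [EG]; subst G'.
move=> /(unambiguous_property c2 e2) [Ephi]; subst phi'.
move=> /(unambiguous_fun (unambiguous_fun unambiguous_rat) c3 e3) [Epsi].
rewrite -[u4]cats0 -[v4]cats0 => /(unambiguous_rat c4 e4) [Ec _].
by subst psi' c'; congr PcsInstance; exact: Prop_irrelevance.
Qed.

(* Main.v *)
(* The minimum of (p u + q v) / 2 over p, q >= 0 with p q r >= 1 is            *)
(* sqrt (u v / r), so a product constraint on two probabilities turns linear  *)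
(* penalties into square roots. For the term a / b we take u = a, v = K / b   *)
(* and r = K; any K >= a + b makes the minimizers 1 / sqrt (a b) and          *)
(* sqrt (a b) / K probabilities, and such a K is written by concatenating the *)
(* binary digits of a and b, without arithmetic. The numbers p and q are the  *)
(* probabilities with which the multi-strategy allows only action 0 at two    *)
(* consecutive controller states, action 1 being the one that loses. The      *)
(* environment chooses the term whose product is tested, by a reward          *)
(* collected after both states are passed; since a passed test leads on to    *)
(* the next term, all penalties are also collected along one run, and their   *)
(* sum is at once the static and the dynamic penalty.                         *)

Require Import Defs.
From mathcomp Require Import all_boot all_order all_algebra.
From mathcomp Require Import all_classical all_reals all_analysis.
From mathcomp Require Import measurable_realfun.
From mathcomp Require Import zify ring lra.

Set Implicit Arguments.
Unset Strict Implicit.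
Unset Printing Implicit Defensive.

Import Order.TTheory GRing.Theory Num.Theory.
Import numFieldNormedType.Exports.

Local Open Scope classical_set_scope.
Local Open Scope ring_scope.

(** * Expected rewards *)

(** The game is a chain of blocks, one for each term a_i / b_i. In a tested block the controller
    must pass two states. With weights p_i and q_i on the singleton of action 0 there, every
    compliant strategy passes with probability at least p_i q_i, and some strategy attains this,
    because the weight on the full set can be spent on either action ([sqrt_compliantP]). An
    environment that tests only term i lets the controller collect [k i] and the final reward 1
    exactly when it passes, so an expected reward of at least 1 forces p_i q_i (k_i + 1) >= 1
    ([sqrt_sound_ge]). Conversely, these inequalities give soundness by backward induction along the
    chain ([sqrt_ge_sound]).

    The penalties of block i are p_i a_i + q_i (k_i + 1) / b_i, plus 4 y times the weights on the
    singletons of action 1. By the inequality of the arithmetic and geometric means ([sqrt_cost_ge])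
    a sound multi-strategy pays at least 2 sqrt (a_i / b_i) per block, and this is attained with
    both weights at most 1. So penalty at most 2 y is possible iff the square roots sum to at most y
    ([sqrt_pcs_yes]). For dynamic penalties a run might stop early and save later costs; the
    surcharge 4 y outweighs that ([sqrt_cost_le_dynamic]).

    Expected rewards are computed from one-step equations. The expectation is the series of the
    expected rewards per step ([expected_reward_series]); any supersolution bounds it and makes it a
    finite solution ([expected_reward_fixpoint]). The chain has no cycle except at the absorbing
    state, so a supersolution is easily written down.

    Polynomial time is shown with an explicit ten-tape machine, assembled from program combinators
    that carry time bounds ([reduction_computes]). It copies input digits, shifts marks and counts;
    [output_codeP] shows that the word it writes is a code of the instance. *)

Section ExpectedReward.
Variables (R : realType) (G : game).
Variables (sigma : strategy R G true) (pi : strategy R G false).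
Variable r : state G -> action G -> R.
Hypothesis r_ge0 : forall s a, 0 <= r s a.

Local Notation X := (state G * action G)%type.
Local Notation c := (choice_prob sigma pi).
Local Notation P := (@trans_prob R G).

Let x0 : X := (ord0, ord0).

(** Indexing cylinders by finite words lets them be split along the next letter. Only positions
    below [size p] are compared, so the default [x0] does not matter. *)
Let cyl (p : seq X) : set (gpath G) := [set w | forall j, (j < size p)%N -> w j = nth x0 p j].
Let wt (s : state G) (p : seq X) : R :=
  prefix_prob sigma pi s (nth x0 p : gpath G) (size p).

Let cylE p : cyl p = cylinder (nth x0 p : gpath G) (size p).
Proof. by []. Qed.

Let measurable_cyl p : measurable (cyl p).
Proof.
by apply: sub_sigma_algebra; exists (nth x0 p : gpath G), (size p).
Qed.

Let path_measure_cyl s p : path_measure sigma pi s (cyl p) = (wt s p)%:E.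
Proof. by rewrite cylE; exact: (path_measureP sigma pi s (nth x0 p : gpath G)). Qed.

Let cyl_rcons p : cyl p = \big[setU/set0]_(y <- enum {: X}) cyl (rcons p y).
Proof.
rewrite -bigcup_seq; apply/seteqP; split => w /=.
  move=> wp; exists (w (size p)); first by rewrite /= mem_enum.
  move=> j; rewrite size_rcons ltnS nth_rcons.
  by case: (ltngtP j (size p)) => // [/wp //|-> _].
move=> [y _ wp] j jp; move: (wp j); rewrite size_rcons nth_rcons jp.
by apply; rewrite ltnW.
Qed.

Let measure_cylI s p (A : set (gpath G)) : measurable A ->
  path_measure sigma pi s (cyl p `&` A) =
  (\sum_y path_measure sigma pi s (cyl (rcons p y) `&` A))%E.
Proof.
move=> mA; rewrite -big_enum /=.
rewrite [RHS]fsbig_seq ?enum_uniq //.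
rewrite -measure_fin_bigcup //.
- congr (path_measure _ _ _ _); rewrite {1}cyl_rcons -bigcup_seq setI_bigcupl.
  by apply: eq_bigcupl; split.
- apply/trivIsetP => y z _ _ yz; apply/seteqP; split => // w /= [[wy _] [wz _]].
  move: yz; move: (wy (size p)) (wz (size p)).
  by rewrite !size_rcons !nth_rcons !ltnn !eqxx => -> // -> //; rewrite eqxx.
- by move=> y _; exact: measurableI.
Qed.

Let measurable_letter j x : measurable [set w : gpath G | w j = x].
Proof.
suff H p : (size p <= j)%N -> measurable (cyl p `&` [set w | w j = x]).
  have := H [::] isT; rewrite (_ : cyl [::] = setT) ?setTI //.
  by apply/seteqP; split.
(* Induction on the number of letters between the end of [p] and position [j]. *)
have [m mE] := ubnP (j - size p); elim: m p mE => // m IH p mE pj.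
rewrite cyl_rcons -bigcup_seq setI_bigcupl.
apply: fin_bigcup_measurable => [|y _]; first exact: finite_seq.
case: (ltngtP (size p) j) pj => // [pj|pj] _.
  by apply: IH; rewrite size_rcons //; lia.
have [->|yx] := eqVneq y x.
  rewrite setIidl // => w /= wp.
  by rewrite wp ?size_rcons ?pj // nth_rcons -pj ltnn eqxx.
rewrite (_ : _ `&` _ = set0) //; apply/seteqP; split => // w /= [wp wx].
move: yx; move: (wp j); rewrite wx size_rcons nth_rcons pj ltnn eqxx.
by move=> -> //; rewrite eqxx.
Qed.

Let stepP (x y : X) : R := P x.1 x.2 y.1 * c y.1 y.2.

Let wt_rcons s p x y : wt s (rcons (rcons p x) y) = wt s (rcons p x) * stepP x y.
Proof.
rewrite /wt [in LHS]size_rcons !size_rcons prefix_prob_recr.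
rewrite !nth_rcons size_rcons ltnn ltnSn !eqxx ltnn; congr (_ * _).
by apply: prefix_prob_eq => j jp; rewrite nth_rcons size_rcons jp.
Qed.

Let wt1 s y : wt s [:: y] = (y.1 == s)%:R * c y.1 y.2.
Proof. by rewrite /wt /prefix_prob /= big_ord_recl !big_ord0 !mulr1. Qed.

(** The expected reward collected at step [j] from [s], by conditioning on the first move; it
    therefore unfolds like the value equation. *)
Fixpoint step_reward (j : nat) (s : state G) : R :=
  \sum_a c s a * (if j is j'.+1 then \sum_t P s a t * step_reward j' t else r s a).

Lemma step_reward_ge0 j s : 0 <= step_reward j s.
Proof.
elim: j s => [|j IH] s /=; apply: sumr_ge0 => a _;
  rewrite mulr_ge0 ?choice_prob_ge0 //.
by apply: sumr_ge0 => t _; rewrite mulr_ge0 ?trans_prob_ge0.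
Qed.

Let integral_letter s j :
  (\int[path_measure sigma pi s]_w (r (w j).1 (w j).2)%:E)%E =
  (\sum_(x : X) (r x.1 x.2)%:E * path_measure sigma pi s [set w | w j = x])%E.
Proof.
transitivity (\int[path_measure sigma pi s]_w
   (\sum_(x <- enum {: X}) (r x.1 x.2)%:E * (\1_[set w : gpath G | w j = x] w)%:E))%E.
  apply: eq_integral => w _; rewrite big_enum /= (bigD1 (w j)) //=.
  rewrite big1 ?adde0; first by rewrite indicE mem_set // mule1.
  move=> x xw; rewrite indicE memNset ?mule0 // => /= wx.
  by rewrite wx eqxx in xw.
rewrite ge0_integral_sum //.
- rewrite big_enum /=; apply: eq_bigr => x _.
  rewrite ge0_integralZl ?lee_fin //.
    by rewrite integral_indic // setIT.
  by apply/measurable_EFinP; exact: measurable_indic.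
- move=> x; apply: emeasurable_funM => //.
  by apply/measurable_EFinP; exact: measurable_indic.
- by move=> x w _; rewrite mule_ge0 ?lee_fin.
Qed.

(** The Markov property: after a prefix ending in [x], the reward collected [j.+1] steps later
    depends on [x] alone. The induction on [j] splits the cylinder at its next letter. *)
Let measure_letter s j p x :
  (\sum_(y : X) (r y.1 y.2)%:E *
     path_measure sigma pi s (cyl (rcons p x) `&` [set w | w (size p + j.+1)%N = y]))%E =
  (wt s (rcons p x) * \sum_t P x.1 x.2 t * step_reward j t)%:E.
Proof.
elim: j p x => [|j IH] p x.
  under eq_bigr => y _.
    rewrite (_ : _ `&` _ = cyl (rcons (rcons p x) y)); last first.
      apply/seteqP; split => w /=.
        move=> [wp wy] i; rewrite !size_rcons ltnS => ip.
        rewrite nth_rcons size_rcons; case: ltngtP ip => // [ip _|-> _].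
          by apply: wp; rewrite size_rcons.
        by rewrite -wy addn1.
      move=> wp; split=> [i ip|].
        move: (wp i); rewrite nth_rcons size_rcons ip => -> //.
        by rewrite ltnS ltnW // -(size_rcons p x).
      by rewrite wp ?size_rcons ?addn1 // nth_rcons size_rcons ltnn eqxx.
    rewrite [X in (_ * X)%E](path_measure_cyl s) wt_rcons -EFinM.
    over.
  rewrite sumEFin; congr EFin; rewrite mulr_sumr.
  transitivity (\sum_t \sum_a r t a * (wt s (rcons p x) * stepP x (t, a))).
    by rewrite pair_bigA; apply: eq_bigr => -[].
  apply: eq_bigr => t _; rewrite mulr_sumr mulr_sumr; apply: eq_bigr => a _.
  by rewrite /stepP /=; ring.
under eq_bigr => y _.
  rewrite measure_cylI // ge0_sume_distrr; last by move=> *; exact: measure_ge0.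
  over.
rewrite exchange_big /=.
transitivity (\sum_(z : X) (wt s (rcons (rcons p x) z) *
    \sum_t P z.1 z.2 t * step_reward j t)%:E)%E.
  apply: eq_bigr => z _; rewrite -IH size_rcons.
  by apply: eq_bigr => y _; rewrite addSnnS.
rewrite sumEFin; congr EFin; rewrite mulr_sumr.
transitivity (\sum_u \sum_a wt s (rcons p x) * stepP x (u, a) *
    \sum_t P u a t * step_reward j t).
  by rewrite pair_bigA; apply: eq_bigr => -[u a] _; rewrite wt_rcons.
apply: eq_bigr => u _; rewrite /= !mulr_sumr; apply: eq_bigr => a _.
by rewrite /stepP /=; ring.
Qed.

Lemma expected_reward_series s :
  expected_reward sigma pi s r = (\sum_(0 <= j <oo) (step_reward j s)%:E)%E.
Proof.
have mr j : measurable_fun setT (fun w : gpath G => (r (w j).1 (w j).2)%:E).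
  apply/measurable_EFinP => _ B mB; rewrite setTI.
  rewrite (_ : _ @^-1` B = \bigcup_(x in [set x : X | B (r x.1 x.2)])
    [set w | w j = x]).
    apply: fin_bigcup_measurable => [|x _]; first exact: finite_finset.
    exact: measurable_letter.
  apply/seteqP; split => w /=; first by move=> Bw; exists (w j).
  by move=> [x /= xB wx]; rewrite wx.
rewrite /expected_reward integral_nneseries //; last first.
  by move=> *; rewrite lee_fin.
apply: eq_eseriesr => j _; rewrite integral_letter.
transitivity (\sum_(x : X) \sum_(y : X) (r x.1 x.2)%:E *
   path_measure sigma pi s (cyl [:: y] `&` [set w | w j = x]))%E.
  apply: eq_bigr => x _.
  rewrite -[in LHS](setTI [set w | _]) (_ : setT = cyl [::]); last first.
    by apply/seteqP; split.
  rewrite measure_cylI // ge0_sume_distrr //.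
case: j => [|j].
  transitivity (\sum_(x : X) (r x.1 x.2 * wt s [:: x])%:E)%E.
    apply: eq_bigr => x _; rewrite (bigD1 x) //= big1 ?adde0.
      rewrite setIidl ?[X in (_ * X)%E](path_measure_cyl s) -?EFinM //.
      by move=> w /= /(_ 0%N isT).
    move=> y yx; rewrite (_ : _ `&` _ = set0) ?measure0 ?mule0 //.
    apply/seteqP; split => // w /= [/(_ 0%N isT) /= -> xy].
    by rewrite xy eqxx in yx.
  rewrite sumEFin; congr EFin => /=.
  transitivity (\sum_t \sum_a r t a * wt s [:: (t, a)]).
    by rewrite pair_bigA; apply: eq_bigr => -[].
  rewrite (bigD1 s) //= [X in _ + X]big1 ?addr0.
    by apply: eq_bigr => a _; rewrite wt1 /= eqxx mul1r mulrC.
  by move=> t ts; apply: big1 => a _; rewrite wt1 /= (negbTE ts) mul0r mulr0.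
rewrite exchange_big /=.
transitivity (\sum_(y : X) (wt s [:: y] * \sum_t P y.1 y.2 t * step_reward j t)%:E)%E.
  by apply: eq_bigr => y _; exact: (measure_letter s j [::] y).
rewrite sumEFin; congr EFin => /=.
transitivity (\sum_t \sum_a wt s [:: (t, a)] * \sum_u P t a u * step_reward j u).
  by rewrite pair_bigA; apply: eq_bigr => -[].
rewrite (bigD1 s) //= [X in _ + X]big1 ?addr0.
  by apply: eq_bigr => a _; rewrite wt1 /= eqxx mul1r.
by move=> t ts; apply: big1 => a _; rewrite wt1 /= (negbTE ts) !mul0r.
Qed.

(** A nonnegative supersolution of the one-step equations. It dominates all partial sums of the step
    rewards, hence the expectation. *)
Variable V : state G -> R.
Hypothesis V_ge0 : forall s, 0 <= V s.
Hypothesis V_super : forall s,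
  \sum_a c s a * (r s a + \sum_t P s a t * V t) <= V s.

Let V_partial k s : \sum_(0 <= j < k) step_reward j s <= V s.
Proof.
elim: k s => [|k IH] s; first by rewrite big_geq.
rewrite big_nat_recl // /=; apply: le_trans (V_super s).
rewrite exchange_big -big_split /=; apply: ler_sum => a _.
rewrite -mulr_sumr -mulrDr ler_wpM2l ?choice_prob_ge0 // lerD2l.
rewrite exchange_big; apply: ler_sum => t _.
by rewrite -mulr_sumr ler_wpM2l ?trans_prob_ge0.
Qed.

Lemma expected_reward_le s : (expected_reward sigma pi s r <= (V s)%:E)%E.
Proof.
rewrite expected_reward_series; apply: lime_le.
  by apply: is_cvg_nneseries => j _ _; rewrite lee_fin step_reward_ge0.
by apply: nearW => k; rewrite sumEFin lee_fin.
Qed.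

(** Splitting off the first term of the series and exchanging the rest with the finite sums over
    actions and successors gives the equation. The bound by [V] makes the expectations finite, so
    that it can be stated in [R]. *)
Lemma expected_reward_fixpoint : exists v : state G -> R,
  [/\ forall s, expected_reward sigma pi s r = (v s)%:E,
      forall s, 0 <= v s <= V s &
      forall s, v s = \sum_a c s a * (r s a + \sum_t P s a t * v t)].
Proof.
have E_ge0 s : (0 <= expected_reward sigma pi s r)%E.
  rewrite expected_reward_series; apply: nneseries_ge0 => j _ _.
  by rewrite lee_fin step_reward_ge0.
have finE s : expected_reward sigma pi s r = (fine (expected_reward sigma pi s r))%:E.
  rewrite fineK // ge0_fin_numE //; apply: le_lt_trans (expected_reward_le s) _.
  exact: ltry.
exists (fun s => fine (expected_reward sigma pi s r)); split=> // s.
  by rewrite -!lee_fin -finE E_ge0 expected_reward_le.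
apply/EFin_inj; rewrite -finE expected_reward_series nneseries_recl //; last first.
  by move=> k _; rewrite lee_fin step_reward_ge0.
rewrite -(nneseries_addn 1) /=; last by move=> k; rewrite lee_fin step_reward_ge0.
under eq_eseriesr => j _.
  rewrite addn1 /= -sumEFin; under eq_bigr do rewrite EFinM -sumEFin.
  over.
rewrite nneseries_sum; last first.
  move=> a j _; rewrite mule_ge0 ?lee_fin ?choice_prob_ge0 //.
  by apply: sume_ge0 => t _; rewrite lee_fin mulr_ge0 ?trans_prob_ge0 ?step_reward_ge0.
under [X in _ = X%:E]eq_bigr do rewrite mulrDr.
rewrite big_split /= EFinD; congr (_ + _)%E; rewrite -sumEFin.
apply: eq_bigr => a _; rewrite nneseriesZl; last first.
  move=> j _; apply: sume_ge0 => t _.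
  by rewrite lee_fin mulr_ge0 ?trans_prob_ge0 ?step_reward_ge0.
rewrite EFinM; congr (_ * _)%E.
rewrite nneseries_sum; last first.
  by move=> t j _; rewrite lee_fin mulr_ge0 ?trans_prob_ge0 ?step_reward_ge0.
rewrite -sumEFin; apply: eq_bigr => t _; rewrite EFinM -finE expected_reward_series.
under eq_eseriesr do rewrite EFinM.
by rewrite nneseriesZl // => j _; rewrite lee_fin step_reward_ge0.
Qed.

End ExpectedReward.

(** * The game *)

Section Dirac.
Variables (K : numDomainType) (T : finType) (t : T).

Let dirac_ge0 x : 0 <= (x == t)%:R :> K. Proof. exact: ler0n. Qed.

Let dirac_sum1 : \sum_x (x == t)%:R = 1 :> K.
Proof. by rewrite (bigD1 t) //= eqxx big1 ?addr0 // => x /negbTE ->. Qed.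

Definition dirac_dist : dist K T := Dist dirac_ge0 dirac_sum1.

End Dirac.

Definition act0 : 'I_2 := ord0.
Definition act1 : 'I_2 := ord_max.

Lemma act_cases (a : 'I_2) : a = act0 \/ a = act1.
Proof. by case: a => -[|[|//]] p; [left|right]; apply: val_inj. Qed.

Lemma sum_act (V : nmodType) (F : 'I_2 -> V) : \sum_a F a = F act0 + F act1.
Proof. by rewrite big_ord_recl big_ord1; congr (_ + F _); apply: val_inj. Qed.

Lemma sum_set_act (V : nmodType) (F : {set 'I_2} -> V) :
  \sum_B F B = F finset.set0 + F [set act0]%SET + F [set act1]%SET + F finset.setT.
Proof.
have act01 : (act1 == act0) = false by [].
have act10 : (act0 == act1) = false by [].
rewrite (bigD1 finset.set0) //= (bigD1 [set act0]%SET) /=; last first.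
  by apply/eqP => /setP /(_ act0); rewrite !inE eqxx.
rewrite (bigD1 [set act1]%SET) /=; last first.
  by apply/andP; split; apply/eqP => /setP /(_ act1); rewrite !inE eqxx.
rewrite (bigD1 finset.setT) /=; last first.
  apply/andP; split; [apply/andP; split|]; apply/eqP => /setP E.
  - by have := E act0; rewrite !inE.
  - by have := E act1; rewrite !inE.
  - by have := E act0; rewrite !inE.
rewrite big1 ?addr0 ?addrA // => B /andP[/andP[/andP[B0 Ba] Bb] BT].
have [] := (boolP (act0 \in B), boolP (act1 \in B)).
case=> h0; case=> h1; exfalso; [move: BT|move: Ba|move: Bb|move: B0];
  apply/negP; rewrite negbK; apply/eqP/setP => a;
  by have [->|->] := act_cases a; rewrite !inE ?h0 ?h1 ?(negbTE h0) ?(negbTE h1).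
Qed.

Lemma modn_mul3D (i j : nat) : ((3 * i + j) %% 3 = j %% 3)%N.
Proof. by rewrite mulnC modnMDl. Qed.

Section SqrtGame.
Variable n : nat.

(* State 0 is absorbing; for [i < n], the environment state [3 i + 1] tests   *)
(* the [i]-th term at the controller states [3 i + 2] and [3 i + 3] (action   *)
(* 0) or skips it (action 1); action 1 of a controller state leads to 0; the  *)
(* state [3 n + 1] follows the last term.                                     *)
Definition sqrt_ctrl (s : nat) : bool := (0 < s)%N && (s %% 3 != 1)%N.

Lemma sqrt_ctrl1 i : sqrt_ctrl (3 * i + 1) = false.
Proof. by rewrite /sqrt_ctrl modn_mul3D andbF. Qed.

Lemma sqrt_ctrl2 i : sqrt_ctrl (3 * i + 2).
Proof. by rewrite /sqrt_ctrl modn_mul3D; lia. Qed.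

Lemma sqrt_ctrl3 i : sqrt_ctrl (3 * i + 3).
Proof. by rewrite /sqrt_ctrl modn_mul3D; lia. Qed.

Definition sqrt_next (s a : nat) : nat :=
  if (s == 0)%N || (s == 3 * n + 1)%N then 0%N
  else if a == 0%N then s.+1
  else if (s %% 3 == 1)%N then (s + 3)%N else 0%N.

Definition sqrt_game : game :=
  @Game (3 * n + 1)%N 1%N (fun s => sqrt_ctrl s) (inord 1)
    (fun s a => Some (dirac_dist rat (inord (sqrt_next s a)))).

Local Notation G := sqrt_game.

Lemma sqrt_next_lt (s : state G) (a : action G) :
  (sqrt_next s a < (3 * n + 1).+1)%N.
Proof.
have : (s < (3 * n + 1).+1)%N by exact: ltn_ord.
rewrite /sqrt_next /=; case: ifPn => // s0.
by case: ifPn => [|a0]; [lia|case: ifPn => //; lia].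
Qed.

Lemma sqrt_enabled (s : state G) : enabled s = finset.setT.
Proof. by apply/setP => a; rewrite !inE. Qed.

Section Values.
Variables (R : realType) (sigma : strategy R G true) (pi : strategy R G false).
Variable r : state G -> action G -> R.
Hypothesis r_ge0 : forall s a, 0 <= r s a.
Hypothesis r0 : forall a, r ord0 a = 0.
Local Notation c := (choice_prob sigma pi).

Lemma sqrt_trans_sum (s : state G) (a : action G) (f : nat -> R) :
  \sum_t trans_prob R s a t * f (val t) = f (sqrt_next s a).
Proof.
rewrite (bigD1 (inord (sqrt_next s a))) //= big1 ?addr0.
  by rewrite /trans_prob /= eqxx rmorph1 mul1r inordK // sqrt_next_lt.
by move=> t /negbTE ts; rewrite /trans_prob /= ts rmorph0 mul0r.
Qed.

Variable M : R.
Hypothesis rM : forall s a, r s a <= M.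

(** State numbers increase until 0 is reached, so from [s > 0] at most [3 * n + 2 - s] rewards are
    collected, each at most [M]. *)
Let V (s : nat) : R := if s == 0%N then 0 else M * (3 * n + 2 - s)%:R.

(** The values are indexed by natural numbers, through [inord], so that successors can be computed
    arithmetically. *)
Lemma sqrt_value : exists v : nat -> R,
  [/\ forall s : state G, expected_reward sigma pi s r = (v s)%:E,
      forall s : state G, 0 <= v s <= M * (3 * n + 2)%:R,
      v 0%N = 0 &
      forall s : state G, v s = c s act0 * (r s act0 + v (sqrt_next s 0)) +
                                c s act1 * (r s act1 + v (sqrt_next s 1))].
Proof.
have M0 : 0 <= M by apply: le_trans (rM ord0 ord0).
have V0 (s : state G) : 0 <= V s by rewrite /V; case: ifP => // _; rewrite mulr_ge0.
have Vs (s : state G) :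
    \sum_a c s a * (r s a + \sum_t trans_prob R s a t * V t) <= V s.
  rewrite -[leRHS]mul1r -(choice_prob_sum1 sigma pi s) mulr_suml.
  apply: ler_sum => a _; rewrite ler_wpM2l ?choice_prob_ge0 //.
  rewrite (sqrt_trans_sum s a V) {2}/V; case: ifPn => [s0|s0].
    rewrite /sqrt_next s0 /= /V /= addr0.
    by rewrite (_ : s = ord0) ?r0 //; apply/val_inj/eqP.
  have sn : (s <= 3 * n + 1)%N by exact: ltn_ord s.
  rewrite (_ : 3 * n + 2 - s = (3 * n + 1 - s).+1)%N; last by lia.
  rewrite mulrSr mulrDr mulr1 addrC lerD //.
  rewrite /V; case: ifPn => [_|]; first by rewrite mulr_ge0.
  move=> next0; rewrite ler_wpM2l // ler_nat.
  move: next0; rewrite /sqrt_next; case: ifP => // _; case: ifP => [_|_]; [|case: ifP => // _]; lia.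
have [v [vE v0V vs]] := expected_reward_fixpoint r_ge0 V0 Vs.
have inordV (s : state G) : inord (val s) = s by apply: inord_val.
exists (fun j => v (inord j)); split.
- by move=> s; rewrite inordV.
- move=> s; rewrite inordV; have /andP[-> /=] := v0V s; move=> /le_trans; apply.
  rewrite /V; case: ifP => _; first by rewrite mulr_ge0.
  by rewrite ler_wpM2l // ler_nat leq_subr.
- apply/eqP; rewrite eq_le; have /andP[-> vV] := v0V (inord 0); rewrite andbT.
  by apply: le_trans vV _; rewrite /V inordK.
move=> s; rewrite inordV {1}vs.
transitivity (\sum_a c s a * (r s a + v (inord (sqrt_next s a)))).
  apply: eq_bigr => a _; congr (_ * (_ + _)).
  rewrite -(sqrt_trans_sum s a (fun j => v (inord j))).
  by apply: eq_bigr => t _; rewrite inordV.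
exact: sum_act.
Qed.

End Values.

(** * Compliance and local penalties with two actions *)

Section MultiStrategies.
Variables (R : realType).

Lemma sqrt_all_enabled (b : bool) (f : state G -> dist R (action G)) (s : state G) :
  is_controller s = b -> forall a, a \notin enabled s -> f s a = 0.
Proof. by move=> _ a; rewrite sqrt_enabled inE. Qed.

Definition sqrt_strategy (b : bool) (f : state G -> dist R (action G)) :
  strategy R G b := Strategy (@sqrt_all_enabled b f).

Lemma sqrt_subset_enabled (f : state G -> dist R {set action G}) (s : state G) :
  is_controller s ->
  forall B : {set action G}, ~~ (B \subset enabled s) -> f s B = 0.
Proof. by move=> _ B; rewrite sqrt_enabled finset.subsetT. Qed.

Definition sqrt_multi_strategy (f : state G -> dist R {set action G})
    (f0 : forall s, is_controller s -> f s finset.set0 = 0) : multi_strategy R G :=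
  MultiStrategy f0 (@sqrt_subset_enabled f).

Lemma sqrt_strategy_sum (b : bool) (tau : strategy R G b) (s : state G) :
  tau s act0 + tau s act1 = 1.
Proof. by rewrite -sum_act dist_sum1. Qed.

(** Only singletons force anything: the weight of the full set can be divided between the two
    actions at will. *)
Lemma sqrt_compliantP (theta : multi_strategy R G) (sigma : strategy R G true) :
  compliant theta sigma <->
  forall s : state G, is_controller s -> forall a, theta s [set a]%SET <= sigma s a.
Proof.
have P1 (s : state G) : is_controller s ->
    theta s [set act0]%SET + theta s [set act1]%SET + theta s finset.setT = 1.
  by move=> cs; rewrite -(dist_sum1 (theta s)) sum_set_act multi_set0 // add0r.
split=> [comp s cs a|ge].
  have [d [d0 ->]] := comp s cs; last by rewrite sqrt_enabled inE.
  have da : d [set a]%SET a = 1.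
    rewrite -(dist_sum1 (d [set a]%SET)) (bigD1 a) //= big1 ?addr0 // => b ba.
    by rewrite d0 ?sqrt_enabled ?finset.subsetT ?inE //; apply/set0Pn; exists a; rewrite inE.
  rewrite (bigD1 [set a]%SET) /=; last by rewrite sqrt_enabled finset.subsetT inE eqxx.
  rewrite da mulr1 lerDl; apply: sumr_ge0 => B _.
  by rewrite mulr_ge0 ?dist_ge0.
move=> s cs; pose T := theta s finset.setT.
(* [e] divides the weight [T] of the full set so that it fills the gaps between [sigma] and the
   singletons. If [T] is 0 there are no gaps, and any distribution serves. *)
pose e a := if T == 0 then (a == act0)%:R else (sigma s a - theta s [set a]%SET) / T.
have T0 : 0 <= T by apply: dist_ge0.
have e0 a : 0 <= e a.
  by rewrite /e; case: eqP => // _; rewrite divr_ge0 // subr_ge0 ge.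
have e1 : \sum_a e a = 1.
  rewrite sum_act /e; have [_|T1] := eqVneq T 0; first by rewrite eqxx addr0.
  rewrite -mulrDl -[RHS](divff T1); congr (_ / _).
  by have := sqrt_strategy_sum sigma s; have := P1 s cs; rewrite -/T; lra.
have eT a : T * e a = sigma s a - theta s [set a]%SET.
  rewrite /e; have [T1|T1] := eqVneq T 0; last by rewrite mulrC divfK.
  have := sqrt_strategy_sum sigma s; have := P1 s cs; rewrite -/T T1 mul0r.
  have := ge s cs act0; have := ge s cs act1.
  by have [->|->] := act_cases a; lra.
pose d (B : {set action G}) : dist R (action G) :=
  if B == finset.setT then Dist e0 e1 else dirac_dist R (if act0 \in B then act0 else act1).
exists d; split=> [B B0 _ a aB|a _].
  rewrite /d; have [BT|BT] := eqVneq; first by rewrite BT inE in aB.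
  rewrite /=; case: eqP => // aE; move: aB; rewrite aE; case: ifPn => [->//|b0].
  have /set0Pn [b] := B0.
  by have [->|->] := act_cases b; [rewrite (negbTE b0)|move=> ->].
under eq_bigl do rewrite sqrt_enabled finset.subsetT /=.
rewrite big_mkcond sum_set_act !inE /= add0r /d eqxx /=.
have NT b : ([set b]%SET == finset.setT :> {set action G}) = false.
  apply/eqP => /setP E; have := E act0; have := E act1; rewrite !inE.
  by have [->|->] := act_cases b.
rewrite !NT -/T eT.
by have [->|->] := act_cases a; rewrite !inE /=; lra.
Qed.

(** Among the nonempty sets only the singletons forbid an action, namely the opposite one. *)
Lemma sqrt_local_penalty (psi : state G -> action G -> rat)
    (theta : multi_strategy R G) (s : state G) : is_controller s ->
  local_penalty psi theta s = theta s [set act0]%SET * ratr (psi s act1) +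
                              theta s [set act1]%SET * ratr (psi s act0).
Proof.
move=> cs; rewrite /local_penalty.
under eq_bigl do rewrite sqrt_enabled finset.subsetT.
rewrite sum_set_act multi_set0 // [X in X + _ + _ + _]big1 ?add0r; last first.
  by move=> a _; rewrite mul0r.
rewrite [X in _ + X]big1 ?addr0; last by move=> a; rewrite !inE.
by congr (_ + _); rewrite big_mkcond sum_act !inE /= ?add0r ?addr0.
Qed.

End MultiStrategies.

(** * Value equations of one block *)

Section Blocks.
Variables (R : realType) (sigma : strategy R G true) (pi : strategy R G false).

Definition sqrt_state (j : nat) : state G := inord j.

Lemma sqrt_stateK j : (j <= 3 * n + 1)%N -> sqrt_state j = j :> nat.
Proof. by move=> jn; apply: inordK. Qed.

Variables (r : state G -> action G -> R) (M rho : R).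
Hypothesis r_ge0 : forall s a, 0 <= r s a.
Hypothesis rM : forall s a, r s a <= M.
Hypothesis r0 : forall a, r ord0 a = 0.
Hypothesis r_test : forall i a, (i < n)%N -> r (sqrt_state (3 * i + 1)) a = 0.
Hypothesis r_end : forall a, r (sqrt_state (3 * n + 1)) a = rho.

(** Stated for general rewards because it serves twice: for the rewards of the property, with [rho]
    equal to 1, and for the penalties, with [rho] equal to 0. Losing leads to state 0, whose value
    is 0, so nothing follows action 1 of the controller. *)
Lemma sqrt_value_blocks : exists v : nat -> R,
  [/\ expected_reward sigma pi (init_state G) r = (v 1%N)%:E,
      forall j, (j <= 3 * n + 1)%N -> 0 <= v j,
      v (3 * n + 1)%N = rho &
      forall i, (i < n)%N ->
        let e := sqrt_state (3 * i + 1) in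
        let s := sqrt_state (3 * i + 2) in
        let t := sqrt_state (3 * i + 3) in
        [/\ v (3 * i + 1)%N =
              pi e act0 * v (3 * i + 2)%N + pi e act1 * v (3 * i.+1 + 1)%N,
            v (3 * i + 2)%N =
              sigma s act0 * (r s act0 + v (3 * i + 3)%N) + sigma s act1 * r s act1 &
            v (3 * i + 3)%N =
              sigma t act0 * (r t act0 + v (3 * i.+1 + 1)%N) + sigma t act1 * r t act1]].
Proof.
have [v [vE v0 vz vs]] := sqrt_value sigma pi r_ge0 r0 rM.
have vsj j : (j <= 3 * n + 1)%N -> v j = let s := sqrt_state j in
    choice_prob sigma pi s act0 * (r s act0 + v (sqrt_next j 0)) +
    choice_prob sigma pi s act1 * (r s act1 + v (sqrt_next j 1)).
  by move=> jn; have := vs (sqrt_state j); rewrite sqrt_stateK.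
exists v; split.
- by rewrite vE; congr (v _)%:E; apply: sqrt_stateK; lia.
- by move=> j jn; have /andP[] := v0 (sqrt_state j); rewrite sqrt_stateK.
- rewrite vsj //= !r_end /sqrt_next eqxx orbT vz addr0 -mulrDl.
  rewrite (_ : _ + _ = 1) ?mul1r //.
  by rewrite -(choice_prob_sum1 sigma pi (sqrt_state (3 * n + 1))) -sum_act.
move=> i i_n e s t.
have iE j : (j < 4)%N -> (3 * i + j <= 3 * n + 1)%N by lia.
have cP j : (j < 4)%N -> is_controller (sqrt_state (3 * i + j)) = sqrt_ctrl (3 * i + j).
  by move=> j4; rewrite /= sqrt_stateK // iE.
have nextE j (a : nat) : (0 < j < 4)%N -> sqrt_next (3 * i + j) a =
    (if a == 0%N then (3 * i + j).+1
    else if (3 * i + j) %% 3 == 1 then 3 * i + j + 3 else 0)%N.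
  by move=> j4; rewrite /sqrt_next ifN // negb_or; apply/andP; lia.
split; rewrite vsj ?iE //= /choice_prob cP // !nextE //=.
- rewrite sqrt_ctrl1 modn_mul3D /= !r_test // !add0r.
  by congr (_ * v _ + _ * v _); lia.
- by rewrite sqrt_ctrl2 modn_mul3D /= vz addr0; congr (_ * (_ + v _) + _); lia.
- by rewrite sqrt_ctrl3 modn_mul3D /= vz addr0; congr (_ * (_ + v _) + _); lia.
Qed.

End Blocks.
End SqrtGame.

(** The square of a sum is the square of the difference plus four times the product, and the product
    of the two summands is (a / b) (p q K). *)
Lemma sqrt_cost_ge (R : rcfType) (a b K p q : R) :
  0 < a -> 0 < b -> 0 < K -> 0 <= p -> 0 <= q -> 1 <= p * q * K ->
  2 * Num.sqrt (a / b) <= p * a + q * (K / b).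
Proof.
move=> a0 b0 K0 p0 q0 pqK.
have s0 : 0 <= p * a + q * (K / b) by rewrite addr_ge0 // mulr_ge0 // ?divr_ge0 // ltW.
rewrite -(@ger0_norm _ 2) // -sqrtr_sqr -sqrtrM ?sqr_ge0 //.
rewrite -[leRHS](ger0_norm s0) -sqrtr_sqr ler_wsqrtr //.
have -> : (p * a + q * (K / b)) ^+ 2 =
    (p * a - q * (K / b)) ^+ 2 + 2 ^+ 2 * (a / b) * (p * q * K) by field; lra.
rewrite -[leLHS]add0r lerD ?sqr_ge0 // ler_peMr // !mulr_ge0 ?invr_ge0 //; exact: ltW.
Qed.

Lemma nat_down_ind (P : nat -> Prop) n : P n ->
  (forall j, (j < n)%N -> P j.+1 -> P j) -> forall j, (j <= n)%N -> P j.
Proof.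
move=> Pn PS j jn; rewrite -(subKn jn); elim: (n - j)%N (leq_subr j n) => [|d IH] dn.
  by rewrite subn0.
apply: PS; first by lia.
by rewrite -subSn // subSS; apply: IH; apply: ltnW.
Qed.

Section Bernoulli.
Variables (R : realDomainType) (p : R).
Hypothesis p01 : 0 <= p <= 1.

Let bernoulli_ge0 x : 0 <= if x == act0 then p else 1 - p.
Proof. by have /andP[p0 p1] := p01; case: ifP; rewrite ?subr_ge0. Qed.

Let bernoulli_sum1 : \sum_x (if x == act0 then p else 1 - p) = 1.
Proof. by rewrite sum_act /= subrKC. Qed.

Definition bernoulli_dist : dist R 'I_2 := Dist bernoulli_ge0 bernoulli_sum1.

Let multi_bernoulli_ge0 (B : {set 'I_2}) :
  0 <= if B == [set act0]%SET then p else if B == finset.setT then 1 - p else 0.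
Proof. by have /andP[p0 p1] := p01; do 2?case: ifP => //; rewrite subr_ge0. Qed.

Let set_act0T : (finset.setT == [set act0]%SET) = false.
Proof. by apply/eqP => /setP /(_ act1); rewrite !inE. Qed.

Let multi_bernoulli_sum1 :
  \sum_(B : {set 'I_2})
    (if B == [set act0]%SET then p else if B == finset.setT then 1 - p else 0) = 1.
Proof.
rewrite sum_set_act eqxx set_act0T eqxx.
rewrite ifN; last by apply/eqP => /setP /(_ act0); rewrite !inE.
rewrite ifN; last by apply/eqP => /setP /(_ act0); rewrite !inE.
rewrite ifN; last by apply/eqP => /setP /(_ act0); rewrite !inE.
rewrite ifN; last by apply/eqP => /setP /(_ act0); rewrite !inE.
by rewrite add0r addr0 subrKC.
Qed.

Definition multi_bernoulli_dist : dist R {set 'I_2} :=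
  Dist multi_bernoulli_ge0 multi_bernoulli_sum1.

End Bernoulli.

Lemma dist_le1 (K : numDomainType) (T : finType) (d : dist K T) x : d x <= 1.
Proof.
rewrite -(dist_sum1 d) (bigD1 x) //= lerDl sumr_ge0 // => t _; exact: dist_ge0.
Qed.

Lemma sum_sqrt_ctrl (V : nmodType) (n : nat) (F : nat -> V) :
  \sum_(0 <= s < (3 * n + 1).+1 | sqrt_ctrl s) F s =
  \sum_(0 <= i < n) (F (3 * i + 2)%N + F (3 * i + 3)%N).
Proof.
elim: n => [|n IH]; first by rewrite /index_iota /= !big_cons !big_nil.
rewrite big_nat_recr //= -IH (_ : (3 * n.+1 + 1).+1 = (3 * n + 1).+4)%N; last by lia.
rewrite !big_mkcond 3?big_nat_recr //= -!addrA; congr (_ + _); first by rewrite -big_mkcond.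
rewrite (_ : (3 * n + 1).+1 = 3 * n + 2)%N; last by lia.
rewrite (_ : (3 * n + 2).+1 = 3 * n + 3)%N; last by lia.
rewrite (_ : (3 * n + 3).+1 = 3 * n.+1 + 1)%N; last by lia.
by rewrite sqrt_ctrl1 sqrt_ctrl2 sqrt_ctrl3 addr0.
Qed.

(** * The constructed instance and its answer *)

Section Instance.
Variables (n : nat) (a b k : nat -> nat) (y : rat).
Hypothesis a_gt0 : forall i, (i < n)%N -> (0 < a i)%N.
Hypothesis b_gt0 : forall i, (i < n)%N -> (0 < b i)%N.
(** This makes the optimal second weight sqrt (a_i b_i) / (k_i + 1) at most 1. *)
Hypothesis ab_le : forall i, (i < n)%N -> (a i * b i <= (k i).+1 ^ 2)%N.
Hypothesis y_gt0 : 0 < y.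

Local Notation G := (sqrt_game n).
Local Notation st := (sqrt_state n).

(** The block of state 3 i + 3 is [(s %/ 3).-1]. The reward [k i] together with the final 1 yields
    the factor [(k i).+1]; the final 1 alone meets the bound when all tests are skipped. *)
Definition sqrt_reward (s x : nat) : rat :=
  if (s == 3 * n + 1)%N then 1
  else if sqrt_ctrl s && (s %% 3 == 0)%N && (x == 0)%N then (k (s %/ 3).-1)%:R
  else 0.

(* Action 0 has a cost above the bound [2 y]: a multi-strategy that allows     *)
(* only action 1 would otherwise lower the dynamic penalty by making the      *)
(* later states unreachable.                                                  *)
Definition sqrt_psi (s x : nat) : rat :=
  if ~~ sqrt_ctrl s then 0
  else if (x == 0)%N then 4 * y
  else if (s %% 3 == 2)%N then (a (s %/ 3))%:R
  else (k (s %/ 3).-1).+1%:R / (b (s %/ 3).-1)%:R.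

Definition sqrt_property : property G :=
  @RewardProperty G AtLeast (fun s x => sqrt_reward s x) 1.

Lemma sqrt_reward_ge0 s x : 0 <= sqrt_reward s x.
Proof. by rewrite /sqrt_reward; do 2?case: ifP. Qed.

Lemma sqrt_psi_ge0 s x : 0 <= sqrt_psi s x.
Proof.
by rewrite /sqrt_psi; do 3?case: ifP => // _; rewrite ?mulr_ge0 // ?invr_ge0 // ltW.
Qed.

Section RealValues.
Variable R : realType.

Let rew (s : state G) (x : action G) : R := ratr (sqrt_reward s x).

Let rew_ge0 s x : 0 <= rew s x. Proof. by rewrite ler0q sqrt_reward_ge0. Qed.

Let rew_bound : {M : R | forall s x, rew s x <= M}.
Proof.
exists (\sum_(s : state G) \sum_(x : action G) rew s x) => s x.
rewrite (bigD1 s) //= (bigD1 x) //= -addrA lerDl addr_ge0 ?sumr_ge0 // => t _.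
by rewrite sumr_ge0.
Qed.

Let rew0 x : rew ord0 x = 0.
Proof. by rewrite /rew /sqrt_reward addn1 rmorph0. Qed.

Lemma sqrt_well_formed : well_formed R sqrt_property.
Proof.
split=> // [s x|s]; first exact: sqrt_reward_ge0.
have [M rM] := rew_bound.
apply: (@le_lt_trans _ _ (M * (3 * n + 2)%:R)%:E); last exact: ltry.
apply: ge_ereal_sup => _ [sigma [pi ->]].
have [v [-> v0 _ _]] := sqrt_value sigma pi rew_ge0 rew0 rM.
by rewrite lee_fin; have /andP[] := v0 s.
Qed.

Definition sqrt_pcs : pcs_instance R :=
  @PcsInstance R G sqrt_property (fun s x => sqrt_psi s x) (2 * y)
    sqrt_well_formed (fun s x => sqrt_psi_ge0 s x) (mulr_ge0 (ler0n _ 2) (ltW y_gt0)).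

Lemma sqrt_reward_test i x : (i < n)%N -> rew (st (3 * i + 1)) x = 0.
Proof.
move=> i_n; rewrite /rew sqrt_stateK; last by lia.
rewrite /sqrt_reward sqrt_ctrl1 ifN ?rmorph0 //; lia.
Qed.

Lemma sqrt_reward_end x : rew (st (3 * n + 1)) x = 1.
Proof. by rewrite /rew sqrt_stateK // /sqrt_reward eqxx rmorph1. Qed.

Lemma sqrt_reward_fst i x : (i < n)%N -> rew (st (3 * i + 2)) x = 0.
Proof.
move=> i_n; rewrite /rew sqrt_stateK; last by lia.
by rewrite /sqrt_reward modn_mul3D andbF ifN ?rmorph0 //; lia.
Qed.

Lemma sqrt_reward_snd i x : (i < n)%N ->
  rew (st (3 * i + 3)) x = if x == act0 then (k i)%:R else 0.
Proof.
move=> i_n; rewrite /rew sqrt_stateK; last by lia.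
rewrite /sqrt_reward modn_mul3D sqrt_ctrl3 ifN; last by lia.
rewrite (_ : (3 * i + 3) %/ 3 = i.+1)%N; last by lia.
by have [->|->] := act_cases x; rewrite /= ?ratr_nat ?rmorph0.
Qed.

Section Theta.
Variable theta : multi_strategy R G.

Lemma sqrt_controller_fst i : (i < n)%N -> is_controller (st (3 * i + 2)).
Proof. by move=> i_n; rewrite /= sqrt_stateK ?sqrt_ctrl2; lia. Qed.

Lemma sqrt_controller_snd i : (i < n)%N -> is_controller (st (3 * i + 3)).
Proof. by move=> i_n; rewrite /= sqrt_stateK ?sqrt_ctrl3; lia. Qed.

Let p i := theta (st (3 * i + 2)) [set act0]%SET.
Let q i := theta (st (3 * i + 3)) [set act0]%SET.
Let cost i := p i * (a i)%:R + q i * ((k i).+1%:R / (b i)%:R).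

Lemma sqrt_local_penalty_fst i : (i < n)%N ->
  local_penalty (fun s x => sqrt_psi s x) theta (st (3 * i + 2)) =
  p i * (a i)%:R + theta (st (3 * i + 2)) [set act1]%SET * (4 * ratr y).
Proof.
move=> i_n; rewrite sqrt_local_penalty ?sqrt_controller_fst // sqrt_stateK; last by lia.
rewrite /sqrt_psi sqrt_ctrl2 modn_mul3D /= (_ : (3 * i + 2) %/ 3 = i)%N; last by lia.
by rewrite ratr_nat rmorphM /= ratr_nat.
Qed.

Lemma sqrt_local_penalty_snd i : (i < n)%N ->
  local_penalty (fun s x => sqrt_psi s x) theta (st (3 * i + 3)) =
  q i * ((k i).+1%:R / (b i)%:R) +
  theta (st (3 * i + 3)) [set act1]%SET * (4 * ratr y).
Proof.
move=> i_n; rewrite sqrt_local_penalty ?sqrt_controller_snd // sqrt_stateK; last by lia.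
rewrite /sqrt_psi sqrt_ctrl3 modn_mul3D /= (_ : (3 * i + 3) %/ 3 = i.+1)%N; last by lia.
by rewrite fmorph_div /= !ratr_nat rmorphM /= ratr_nat.
Qed.

Lemma sqrt_static_penalty :
  static_penalty (fun s x => sqrt_psi s x) theta =
  \sum_(0 <= i < n) (local_penalty (fun s x => sqrt_psi s x) theta (st (3 * i + 2)) +
                     local_penalty (fun s x => sqrt_psi s x) theta (st (3 * i + 3))).
Proof.
rewrite /static_penalty; set F := local_penalty _ _.
transitivity (\sum_(s < (3 * n + 1).+1 | sqrt_ctrl s) F (st s)).
  by apply: eq_bigr => s _; rewrite /sqrt_state inord_val.
rewrite -(big_mkord (fun s => sqrt_ctrl s) (fun s => F (st s))).
exact: (sum_sqrt_ctrl n (fun s => F (st s))).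
Qed.

(** The worst case for block [i]: the compliant strategy gives the whole weight of the full set to
    the losing action 1, and the environment tests only block [i]. The value of this play is the
    product itself. *)
Lemma sqrt_sound_ge : multi_sound sqrt_property theta ->
  forall i, (i < n)%N -> 1 <= p i * q i * (k i).+1%:R.
Proof.
move=> sound i i_n.
have p01 (s : state G) : 0 <= theta s [set act0]%SET <= 1.
  by rewrite dist_ge0 dist_le1.
pose sigma : strategy R G true := sqrt_strategy true
  (fun s => bernoulli_dist (p01 s)).
pose pi : strategy R G false := sqrt_strategy false
  (fun s => dirac_dist R (if s == 3 * i + 1 :> nat then act0 else act1)%N).
have comp : compliant theta sigma.
  apply/sqrt_compliantP => s cs x; have [->|->] := act_cases x => //=.
  have := dist_sum1 (theta s); rewrite sum_set_act multi_set0 //.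
  by have := dist_ge0 (theta s) finset.setT; lra.
have [M rM] := rew_bound.
have [v [vE v0 vend vblock]] := sqrt_value_blocks sigma pi rew_ge0 rM rew0
  sqrt_reward_test sqrt_reward_end.
have piE j : (j < n)%N -> pi (st (3 * j + 1)) =
    dirac_dist R (if j == i then act0 else act1).
  move=> jn; congr dirac_dist; rewrite sqrt_stateK; last by lia.
  by congr (if _ then _ else _); lia.
(* Later blocks are skipped, which leaves the final reward 1; earlier blocks hand the value back
   unchanged. *)
have v_after j : (j <= n)%N -> (i < j)%N -> v (3 * j + 1)%N = 1.
  move: j; apply: nat_down_ind => [_|j jn IH ij]; first exact: vend.
  have [-> _ _] := vblock j jn; rewrite piE // ifN; last by lia.
  by rewrite /= mul0r mul1r add0r IH //; lia.
have v_before j : (j <= i)%N -> v (3 * j + 1)%N = v 1%N.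
  elim: j => // j IH ji; rewrite -IH; last by lia.
  have [|-> _ _] := vblock j; first by lia.
  rewrite piE; last by lia.
  by rewrite ifN /= ?mul0r ?mul1r ?add0r //; lia.
have := sound sigma comp pi; rewrite /satisfies /= vE lee_fin rmorph1.
rewrite -(v_before i (leqnn i)); have [-> -> ->] := vblock i i_n.
rewrite piE // eqxx /= mul1r mul0r addr0 v_after //.
rewrite !sqrt_reward_fst // !sqrt_reward_snd //= mulr0 addr0 mulr0 addr0 add0r.
by rewrite mulrA -mulrSr.
Qed.

(** Backward induction: if the value behind a block is at least 1, then skipping keeps it and
    testing yields at least p q (k + 1), so every mixture of the two is at least 1. *)
Lemma sqrt_ge_sound :
  (forall i, (i < n)%N -> 1 <= p i * q i * (k i).+1%:R) ->
  multi_sound sqrt_property theta.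
Proof.
move=> pq sigma /sqrt_compliantP comp pi.
have [M rM] := rew_bound.
have [v [vE v0 vend vblock]] := sqrt_value_blocks sigma pi rew_ge0 rM rew0
  sqrt_reward_test sqrt_reward_end.
rewrite /satisfies /= vE lee_fin rmorph1.
suff H j : (j <= n)%N -> 1 <= v (3 * j + 1)%N by exact: (H 0%N).
move: j; apply: nat_down_ind => [|j jn IH]; first by rewrite vend.
have [-> -> ->] := vblock j jn.
rewrite !sqrt_reward_fst // !sqrt_reward_snd //= !mulr0 !addr0 add0r.
set w := sigma _ _ * _.
suff w1 : 1 <= w.
  rewrite -(sqrt_strategy_sum pi (st (3 * j + 1))).
  by rewrite lerD // ler_peMr // dist_ge0.
apply: le_trans (pq j jn) _; rewrite /w -mulrA.
have := comp _ (sqrt_controller_fst jn) act0.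
have := comp _ (sqrt_controller_snd jn) act0.
move=> cq cp; rewrite ler_pM ?mulr_ge0 ?dist_ge0 // ler_pM ?dist_ge0 //.
by rewrite mulrSr lerD2l.
Qed.

Let pen (s : state G) (x : action G) : R :=
  penalty_reward (fun s x => sqrt_psi s x) theta s x.

Let local_penalty_ge0 s : 0 <= local_penalty (fun s x => sqrt_psi s x) theta s :> R.
Proof.
apply: sumr_ge0 => B _; apply: sumr_ge0 => x _.
by rewrite mulr_ge0 ?dist_ge0 // ler0q sqrt_psi_ge0.
Qed.

Let pen_ge0 s x : 0 <= pen s x.
Proof. by rewrite /pen /penalty_reward; case: ifP. Qed.

Let pen_bound : {M : R | forall s x, pen s x <= M}.
Proof.
exists (\sum_(s : state G) \sum_(x : action G) pen s x) => s x.
rewrite (bigD1 s) //= (bigD1 x) //= -addrA lerDl addr_ge0 ?sumr_ge0 // => t _.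
by rewrite sumr_ge0.
Qed.

Let pen0 x : pen ord0 x = 0. Proof. by []. Qed.

Let pen_test i x : (i < n)%N -> pen (st (3 * i + 1)) x = 0.
Proof.
move=> i_n; rewrite /pen /penalty_reward /= sqrt_stateK; last by lia.
by rewrite sqrt_ctrl1.
Qed.

Let pen_end x : pen (st (3 * n + 1)) x = 0.
Proof. by rewrite /pen /penalty_reward /= sqrt_stateK // sqrt_ctrl1. Qed.

(** The strategy gives the weight of the full set to action 0 and the environment tests every block,
    so a run is cut short only by weight on the singleton of action 1. That weight has already been
    charged 4 y, hence the value at each block is at least the minimum of 4 y and the remaining
    cost. As the penalty is at most 2 y, the minimum at the first block is the cost. *)
Lemma sqrt_cost_le_dynamic :
  (dynamic_penalty (fun s x => sqrt_psi s x) theta <= (2 * ratr y)%:E)%E ->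
  \sum_(0 <= i < n) cost i <= 2 * ratr y.
Proof.
move=> dyn.
have p01 (s : state G) : 0 <= 1 - theta s [set act1]%SET <= 1.
  by have := dist_ge0 (theta s) [set act1]%SET; have := dist_le1 (theta s) [set act1]%SET; lra.
pose sigma : strategy R G true := sqrt_strategy true
  (fun s => bernoulli_dist (p01 s)).
pose pi : strategy R G false := sqrt_strategy false
  (fun s => dirac_dist R act0).
have comp : compliant theta sigma.
  apply/sqrt_compliantP => s cs x; have [->|->] := act_cases x => /=.
    have := dist_sum1 (theta s); rewrite sum_set_act multi_set0 //.
    by have := dist_ge0 (theta s) finset.setT; lra.
  by rewrite subKr.
have [M rM] := pen_bound.
have [v [vE v0 vend vblock]] := sqrt_value_blocks sigma pi pen_ge0 rM pen0
  pen_test pen_end.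
have v1 : v 1%N <= 2 * ratr y.
  rewrite -lee_fin -vE; apply: le_trans dyn; apply: ereal_sup_ubound.
  by exists sigma, pi.
have y0 : 0 < ratr y :> R by rewrite ltr0q.
suff H j : (j <= n)%N ->
    Num.min (4 * ratr y) (\sum_(j <= i < n) cost i) <= v (3 * j + 1)%N.
  have := H 0%N isT; rewrite muln0 add0n ge_min => /orP[|/le_trans -> //].
  by move: v1; lra.
move: j; apply: nat_down_ind => [|j jn IH].
  by rewrite big_geq // vend ge_min lexx orbT.
(* At a state of cost [c] with weight [t] on the singleton of action 1, the value is c + 4 t y + (1
   - t) w. Both 4 y and [w] are at least the minimum for [S], and so is their mean with weights [t]
   and 1 - t. *)
have step (c t S w : R) : 0 <= c -> 0 <= t <= 1 -> Num.min (4 * ratr y) S <= w ->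
    Num.min (4 * ratr y) (c + S) <= (1 - t) * (c + t * (4 * ratr y) + w) +
      t * (c + t * (4 * ratr y)).
  move=> c0 /andP[t0 t1] mw.
  have : (1 - t) * Num.min (4 * ratr y) S <= (1 - t) * w by rewrite ler_wpM2l //; lra.
  have : t * Num.min (4 * ratr y) S <= t * (4 * ratr y).
    by rewrite ler_wpM2l // ge_min lexx.
  have : Num.min (4 * ratr y) (c + S) <= c + Num.min (4 * ratr y) S.
    by case: (leP (4 * ratr y) S) => _; rewrite ge_min ?lexx ?orbT // lerDr c0.
  by lra.
have t01 (s : state G) : 0 <= theta s [set act1]%SET <= 1.
  by rewrite dist_ge0 dist_le1.
have [-> -> ->] := vblock j jn; rewrite /= mul1r mul0r addr0.
rewrite big_ltn // /cost -addrA /pen /penalty_reward.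
rewrite sqrt_controller_fst // sqrt_controller_snd //.
rewrite sqrt_local_penalty_fst // sqrt_local_penalty_snd //.
rewrite !subKr; apply: (step _ _ _ _ _ (t01 _)).
  by rewrite mulr_ge0 ?dist_ge0.
by apply: (step _ _ _ _ _ (t01 _)) IH; rewrite mulr_ge0 ?dist_ge0 ?divr_ge0.
Qed.

(** Without weight on the singleton of action 1 there is no surcharge, and a run passes each
    controller state at most once, so it never pays more than all costs together. *)
Lemma sqrt_dynamic_le :
  (forall i, (i < n)%N -> theta (st (3 * i + 2)) [set act1]%SET = 0) ->
  (forall i, (i < n)%N -> theta (st (3 * i + 3)) [set act1]%SET = 0) ->
  (dynamic_penalty (fun s x => sqrt_psi s x) theta <=
     (\sum_(0 <= i < n) cost i)%:E)%E.
Proof.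
move=> p1 q1; apply: ge_ereal_sup => _ [sigma [pi [_ ->]]].
have [M rM] := pen_bound.
have [v [-> v0 vend vblock]] := sqrt_value_blocks sigma pi pen_ge0 rM pen0
  pen_test pen_end.
rewrite lee_fin.
suff H j : (j <= n)%N -> v (3 * j + 1)%N <= \sum_(j <= i < n) cost i.
  exact: (H 0%N).
move: j; apply: nat_down_ind => [|j jn IH]; first by rewrite vend big_geq.
have step (c2 : bool) (tau : strategy R G c2) s (c w : R) : 0 <= w ->
    tau s act0 * (c + w) + tau s act1 * c <= c + w.
  move=> w0; have := sqrt_strategy_sum tau s; have := dist_ge0 (tau s) act1.
  by move=> t0 t1; rewrite mulrDr addrAC -mulrDl t1 mul1r lerD2l ler_piMl //; lra.
have [vE vF vS] := vblock j jn.
have c0 : 0 <= cost j.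
  by rewrite addr_ge0 // mulr_ge0 ?dist_ge0 // divr_ge0.
have vn : v (3 * j.+1 + 1)%N <= \sum_(j.+1 <= i < n) cost i by [].
have vn0 : 0 <= v (3 * j.+1 + 1)%N by apply: v0; lia.
rewrite big_ltn //.
have vS' : v (3 * j + 3)%N <= q j * ((k j).+1%:R / (b j)%:R) + v (3 * j.+1 + 1)%N.
  rewrite vS /pen /penalty_reward sqrt_controller_snd // sqrt_local_penalty_snd //.
  by rewrite q1 // mul0r addr0; exact: step.
have vF' : v (3 * j + 2)%N <= cost j + v (3 * j.+1 + 1)%N.
  rewrite /cost -addrA; apply: (le_trans _ (lerD (lexx _) vS')).
  rewrite vF /pen /penalty_reward sqrt_controller_fst // sqrt_local_penalty_fst //.
  by rewrite p1 // mul0r addr0; apply: step; apply: v0; lia.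
rewrite vE; apply: (@le_trans _ _ (cost j + v (3 * j.+1 + 1)%N)); last by rewrite lerD2l.
rewrite -[leRHS]mul1r -(sqrt_strategy_sum pi (st (3 * j + 1))) mulrDl.
by rewrite lerD // ler_wpM2l ?dist_ge0 // lerDr.
Qed.

End Theta.

Lemma sqrt_pcs_yes (tau : penalty_type) :
  pyes (p := pcs_problem R tau) sqrt_pcs <->
  \sum_(0 <= i < n) Num.sqrt ((a i)%:R / (b i)%:R) <= ratr y :> R.
Proof.
have y2 : ratr (2 * y) = 2 * ratr y :> R by rewrite rmorphM /= ratr_nat.
have sum2 : \sum_(0 <= i < n) 2 * Num.sqrt ((a i)%:R / (b i)%:R) =
    2 * \sum_(0 <= i < n) Num.sqrt ((a i)%:R / (b i)%:R) :> R by rewrite mulr_sumr.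
have -> : (\sum_(0 <= i < n) Num.sqrt ((a i)%:R / (b i)%:R) <= ratr y :> R) =
    (\sum_(0 <= i < n) 2 * Num.sqrt ((a i)%:R / (b i)%:R) <= 2 * ratr y :> R).
  by rewrite sum2 ler_pM2l.
split=> [[theta [sound]]|le_y].
  rewrite y2 => pen_le.
  have pq := sqrt_sound_ge sound.
  apply: (@le_trans _ _ (\sum_(0 <= i < n)
      (theta (st (3 * i + 2)) [set act0]%SET * (a i)%:R +
       theta (st (3 * i + 3)) [set act0]%SET * ((k i).+1%:R / (b i)%:R)))).
    apply: ler_sum_nat => i /= i_n.
    by apply: sqrt_cost_ge; rewrite ?ltr0n ?a_gt0 ?b_gt0 ?dist_ge0 // pq.
  case: tau pen_le => /=; last exact: sqrt_cost_le_dynamic.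
  rewrite lee_fin; apply: le_trans; rewrite sqrt_static_penalty.
  have y0 : 0 < ratr y :> R by rewrite ltr0q.
  apply: ler_sum_nat => i /= i_n.
  rewrite sqrt_local_penalty_fst // sqrt_local_penalty_snd // addrACA lerDl.
  have y4 : 0 <= 4 * ratr y :> R by rewrite mulr_ge0 // ltW.
  by rewrite addr_ge0 // mulr_ge0 ?dist_ge0.
(* The minimisers: 1 / sqrt (a b) at the first state of a block and sqrt (a b) / (k + 1) at the
   second. Their product times k + 1 is 1, and each of the two costs equals sqrt (a / b). *)
pose pr (s : nat) : R :=
  if (s %% 3 == 2)%N then (Num.sqrt (a (s %/ 3) * b (s %/ 3))%:R)^-1
  else Num.sqrt (a (s %/ 3).-1 * b (s %/ 3).-1)%:R / (k (s %/ 3).-1).+1%:R.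
have prF i : (i < n)%N -> pr (3 * i + 2)%N = (Num.sqrt (a i * b i)%:R)^-1.
  move=> i_n; rewrite /pr modn_mul3D /= (_ : (3 * i + 2) %/ 3 = i)%N //; lia.
have prS i : (i < n)%N -> pr (3 * i + 3)%N = Num.sqrt (a i * b i)%:R / (k i).+1%:R.
  move=> i_n; rewrite /pr modn_mul3D /= (_ : (3 * i + 3) %/ 3 = i.+1)%N //; lia.
have ab0 i : (i < n)%N -> (0 < a i * b i)%N by move=> i_n; rewrite muln_gt0 a_gt0 ?b_gt0.
have sab0 i : (i < n)%N -> 0 < Num.sqrt (a i * b i)%:R :> R.
  by move=> i_n; rewrite sqrtr_gt0 ltr0n ab0.
have pr01 (s : state G) : is_controller s -> 0 <= pr s <= 1.
  rewrite /= /sqrt_ctrl => /andP[s0 s3]; have := ltn_ord s; move: s0 s3.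
  move: (nat_of_ord s) => /= m s0 s3 mn.
  rewrite /pr; case: ifP => m3.
    have i_n : (m %/ 3 < n)%N by lia.
    rewrite invr_ge0 sqrtr_ge0 invf_le1 ?sab0 //.
    by rewrite -[leLHS]sqrtr1; apply: ler_wsqrtr; rewrite ler1n ab0.
  have i_n : ((m %/ 3).-1 < n)%N by lia.
  rewrite divr_ge0 ?sqrtr_ge0 //= ler_pdivrMr ?ltr0n // mul1r.
  rewrite -[leRHS]ger0_norm // -sqrtr_sqr ler_wsqrtr // -natrX ler_nat.
  exact: ab_le.
have min01 (s : state G) : 0 <= (if is_controller s then pr s else 0) <= 1.
  by case: ifP => [/pr01//|_]; rewrite lexx ler01.
pose theta0 (s : state G) := multi_bernoulli_dist (min01 s).
have set0E : (finset.set0 == [set act0]%SET :> {set 'I_2}) = false.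
  by apply/eqP => /setP /(_ act0); rewrite !inE.
have set0T : (finset.set0 == finset.setT :> {set 'I_2}) = false.
  by apply/eqP => /setP /(_ act0); rewrite !inE.
have set1E : ([set act1]%SET == [set act0]%SET) = false.
  by apply/eqP => /setP /(_ act0); rewrite !inE.
have set1T : ([set act1]%SET == finset.setT) = false.
  by apply/eqP => /setP /(_ act0); rewrite !inE.
have theta_set0 s : is_controller s -> theta0 s finset.set0 = 0.
  by rewrite /theta0 /= set0E set0T.
pose theta := sqrt_multi_strategy theta_set0.
have th1 s : theta s [set act1]%SET = 0 by rewrite /= set1E set1T.
have thF i : (i < n)%N ->
    theta (st (3 * i + 2)) [set act0]%SET = (Num.sqrt (a i * b i)%:R)^-1.
  move=> i_n; rewrite -prF // /= eqxx sqrt_stateK ?sqrt_ctrl2 //; lia.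
have thS i : (i < n)%N ->
    theta (st (3 * i + 3)) [set act0]%SET = Num.sqrt (a i * b i)%:R / (k i).+1%:R.
  move=> i_n; rewrite -prS // /= eqxx sqrt_stateK ?sqrt_ctrl3 //; lia.
exists theta; split.
  apply: sqrt_ge_sound => i i_n; rewrite thF // thS // mulrA mulVf ?gt_eqF ?sab0 //.
  by rewrite mul1r mulVf // pnatr_eq0.
have costE i : (0 <= i < n)%N -> theta (st (3 * i + 2)) [set act0]%SET * (a i)%:R +
    theta (st (3 * i + 3)) [set act0]%SET * ((k i).+1%:R / (b i)%:R) =
    2 * Num.sqrt ((a i)%:R / (b i)%:R).
  move=> /andP[_ i_n]; rewrite thF // thS //.
  have a0 : 0 < (a i)%:R :> R by rewrite ltr0n a_gt0.
  have b0 : 0 < (b i)%:R :> R by rewrite ltr0n b_gt0.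
  rewrite natrM sqrtrM ?(ltW a0) // sqrtrM ?(ltW a0) // sqrtrV ?(ltW b0) //.
  rewrite -[X in _ * X + _](sqr_sqrtr (ltW a0)) -[X in _ * (_ / X)](sqr_sqrtr (ltW b0)).
  have sa : Num.sqrt (a i)%:R != 0 :> R by rewrite gt_eqF // sqrtr_gt0.
  have sb : Num.sqrt (b i)%:R != 0 :> R by rewrite gt_eqF // sqrtr_gt0.
  have : (k i).+1%:R != 0 :> R by rewrite pnatr_eq0.
  by move: (k i).+1%:R => K K0; field; rewrite sa sb K0.
rewrite y2; case: tau => /=.
  rewrite lee_fin sqrt_static_penalty; apply: le_trans le_y.
  rewrite le_eqVlt; apply/orP; left; apply/eqP.
  apply: eq_big_nat => i i_n; rewrite -costE //; have /andP[_ ?] := i_n.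
  by rewrite sqrt_local_penalty_fst // sqrt_local_penalty_snd // !th1 !mul0r !addr0.
apply: (@le_trans _ _ (\sum_(0 <= i < n) 2 * Num.sqrt ((a i)%:R / (b i)%:R))%:E).
  rewrite -(eq_big_nat _ _ costE).
  by apply: sqrt_dynamic_le => i i_n; rewrite th1.
by rewrite lee_fin.
Qed.

End RealValues.
End Instance.

(** * Programs for multitape machines *)

Local Open Scope nat_scope.

(* Tapes as functions, so that trailing blanks do not matter. *)
Definition ftape : Type := (nat -> option bool) * (nat -> option bool).

Definition ftape_of (t : tape) : ftape :=
  (nth None (tape_left t), nth None (tape_head t :: tape_right t)).

Definition fwrite_move (x : option bool) (d : direction) (t : ftape) : ftape :=
  match d with
  | MoveLeft => (fun m => t.1 m.+1,
      fun m => match m with 0 => t.1 0 | 1 => x | m'.+1 => t.2 m' end)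
  | Stay => (t.1, fun m => if m is 0 then x else t.2 m)
  | MoveRight => (fun m => if m is m'.+1 then t.1 m' else x, fun m => t.2 m.+1)
  end.

Arguments fwrite_move : simpl never.

Lemma ftape_of_write_move x d t :
  ftape_of (write_move x d t) = fwrite_move x d (ftape_of t).
Proof.
case: t => l h r; case: d; rewrite /ftape_of /fwrite_move /=; congr pair;
  apply/funext => -[|[|m]] //=; by [case: l|case: r|case: r; case: m].
Qed.

Definition rtape (u : bits) (w : seq (option bool)) : ftape :=
  (nth None (map Some u), nth None w).

Lemma rtape_rcons_blank u w : rtape u (rcons w None) = rtape u w.
Proof.
congr pair; apply/funext => m; rewrite nth_rcons.
by case: ltngtP => // [wm|->]; rewrite nth_default //; lia.
Qed.

Lemma fwrite_move_stay t : fwrite_move (t.2 0) Stay t = t.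
Proof. by case: t => l r; congr pair; apply/funext => -[]. Qed.

Lemma fwrite_move_right u b y w :
  fwrite_move (Some b) MoveRight (rtape u (y :: w)) = rtape (b :: u) w.
Proof. by congr pair; apply/funext => -[]. Qed.

Lemma fwrite_move_left u x y z w :
  fwrite_move z MoveLeft (rtape (x :: u) (y :: w)) = rtape u [:: Some x, z & w].
Proof. by congr pair; apply/funext => -[|[]]. Qed.

Lemma fwrite_move_left0 y z w :
  fwrite_move z MoveLeft (rtape [::] (y :: w)) = rtape [::] [:: None, z & w].
Proof. by congr pair; apply/funext => -[|[]]. Qed.

Lemma fwrite_move_right0 w :
  fwrite_move None MoveRight (rtape [::] (None :: w)) = rtape [::] w.
Proof. by congr pair; apply/funext => -[|m] //=; rewrite nth_nil. Qed.

Lemma rtape_nil u : rtape u [::] = rtape u [:: None].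
Proof. exact: esym (rtape_rcons_blank u [::]). Qed.

Lemma rtape_blank u x : rtape u [:: x; None] = rtape u [:: x].
Proof. exact: (rtape_rcons_blank u [:: x]). Qed.

Section Programs.
Variable K : nat.

Definition heads := {ffun 'I_K.+1 -> option bool}.
Definition actions := {ffun 'I_K.+1 -> option bool * direction}.
Definition ftapes := 'I_K.+1 -> ftape.

(* A machine without halting states: a program ends by leaving its states. *)
Record prog := Prog {
  pstate : finType;
  pstart : pstate;
  pstep : pstate -> heads -> option pstate * actions }.

Definition pnext (P : prog) (c : option (pstate P) * ftapes) :
    option (pstate P) * ftapes :=
  if c.1 is Some q then
    let qa := pstep q [ffun i => (c.2 i).2 0] in
    (qa.1, fun i => fwrite_move (qa.2 i).1 (qa.2 i).2 (c.2 i))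
  else c.

(** A program that has ended stays ended, so [t] is an upper bound on the running time rather than
    the exact time. *)
Variant runs (P : prog) (T T' : ftapes) (t : nat) : Prop :=
  Runs of iter t (@pnext P) (Some (pstart P), T) = (None, T').

Lemma iter_pnext_None P T t : iter t (@pnext P) (None, T) = (None, T).
Proof. by elim: t => //= t ->. Qed.

Lemma runs_le P T T' t t' : t <= t' -> runs P T T' t -> runs P T T' t'.
Proof.
move=> tt' [E]; split.
by rewrite -(subnK tt') iterD E; exact: iter_pnext_None.
Qed.

(** The simulation behind all combinators: an embedded copy of [P] makes the moves of [P], and
    passes to [x] when [P] ends. That moment [t'] may come before [t]. *)
Lemma sub_run (P S : prog) (e : pstate P -> pstate S) (x : option (pstate S)) :
  (forall q h, pstep (e q) h =
    (if (pstep q h).1 is Some q' then Some (e q') else x, (pstep q h).2)) ->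
  forall t q T T', iter t (@pnext P) (Some q, T) = (None, T') ->
  exists2 t', t' <= t & iter t' (@pnext S) (Some (e q), T) = (x, T').
Proof.
move=> eP; elim=> [//|t IH] q T T'; rewrite iterSr /pnext /=.
set h := [ffun i => _]; have := eP q h.
case: (pstep q h) => -[q'|] act /= E; last first.
  rewrite iter_pnext_None => -[<-]; exists 1 => //.
  by rewrite /= /pnext /= -/h E.
move=> /IH [t' tt' H]; exists t'.+1 => //.
by rewrite iterSr -H; congr (iter _ _ _); rewrite /pnext /= -/h E.
Qed.

Definition machine_of (P : prog) : machine := {|
  extra_tapes := K;
  control := option (pstate P);
  start := Some (pstart P);
  halting := fun q => q == None;
  transition := fun q h =>
    if q is Some q' then pstep q' h else (None, [ffun i => (h i, Stay)]) |}.

Definition conf_ftapes (P : prog) (c : configuration (machine_of P)) :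
    option (pstate P) * ftapes :=
  (conf_state c, fun i => ftape_of (conf_tapes c i)).

Lemma conf_ftapes_step P (c : configuration (machine_of P)) :
  conf_ftapes (machine_step c) = pnext (conf_ftapes c).
Proof.
case: c => -[q|] T //; rewrite /machine_step /conf_ftapes /pnext /=.
have -> : [ffun i => tape_head (T i)] = [ffun i => (ftape_of (T i)).2 0].
  by apply/ffunP => i; rewrite !ffunE.
case: (pstep q _) => q' act /=; congr pair; apply/funext => i.
by rewrite ffunE ftape_of_write_move.
Qed.

Lemma conf_ftapes_iter P (c : configuration (machine_of P)) t :
  conf_ftapes (iter t (@machine_step _) c) = iter t (@pnext P) (conf_ftapes c).
Proof. by elim: t => //= t IH; rewrite conf_ftapes_step IH. Qed.

Definition pact (g : heads -> actions) : prog :=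
  @Prog unit tt (fun _ h => (None, g h)).

(** The last step of [P] already enters [Q], so running times simply add up. In [pif] and [pwhile]
    the state [None] spends one idle step on the test. *)
Definition pseq (P Q : prog) : prog :=
  @Prog (pstate P + pstate Q)%type (inl (pstart P)) (fun q h =>
    match q with
    | inl q => (Some (if (pstep q h).1 is Some q' then inl q' else inr (pstart Q)),
                (pstep q h).2)
    | inr q => (omap inr (pstep q h).1, (pstep q h).2)
    end).

Definition idle (h : heads) : actions := [ffun i => (h i, Stay)].

Definition pif (b : heads -> bool) (P Q : prog) : prog :=
  @Prog (option (pstate P + pstate Q)) None (fun q h =>
    match q with
    | None => (Some (Some (if b h then inl (pstart P) else inr (pstart Q))), idle h)
    | Some (inl q) => (omap (fun q' => Some (inl q')) (pstep q h).1, (pstep q h).2)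
    | Some (inr q) => (omap (fun q' => Some (inr q')) (pstep q h).1, (pstep q h).2)
    end).

Definition pwhile (b : heads -> bool) (P : prog) : prog :=
  @Prog (option (pstate P)) None (fun q h =>
    match q with
    | None => (if b h then Some (Some (pstart P)) else None, idle h)
    | Some q => (Some (pstep q h).1, (pstep q h).2)
    end).

Definition theads (T : ftapes) : heads := [ffun i => (T i).2 0].

Lemma pnext_idle P (q : pstate P) q' T : pstep q (theads T) = (q', idle (theads T)) ->
  pnext (Some q, T) = (q', T).
Proof.
move=> E; rewrite /pnext /= E /=; congr pair; apply/funext => i.
by rewrite !ffunE fwrite_move_stay.
Qed.

Lemma runs_act g T :
  runs (pact g) T (fun i => fwrite_move (g (theads T) i).1 (g (theads T) i).2 (T i)) 1.
Proof. by split. Qed.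

Lemma runs_seq P Q T1 T2 T3 t1 t2 :
  runs P T1 T2 t1 -> runs Q T2 T3 t2 -> runs (pseq P Q) T1 T3 (t1 + t2).
Proof.
move=> [p] [q].
have [|t1' le1 p'] := @sub_run P (pseq P Q) inl (Some (inr (pstart Q))) _ _ _ _ _ p.
  by move=> s h /=; case: (pstep s h).1.
have [|t2' le2 q'] := @sub_run Q (pseq P Q) inr None _ _ _ _ _ q.
  by move=> s h /=; case: (pstep s h).1.
apply: (@runs_le _ _ _ (t2' + t1')); first by rewrite addnC leq_add.
by split; rewrite iterD p' q'.
Qed.

Lemma runs_if (b : heads -> bool) P Q T1 T2 t : runs (if b (theads T1) then P else Q) T1 T2 t ->
  runs (pif b P Q) T1 T2 t.+1.
Proof.
move=> p; split; rewrite iterSr (@pnext_idle (pif b P Q) None _ T1 erefl).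
case: ifP p => _ [p].
  have [|t' le' p'] := @sub_run P (pif b P Q) (fun q => Some (inl q)) None _ _ _ _ _ p.
    by move=> s h /=; case: (pstep s h).1.
  by rewrite -(subnK le') iterD p' iter_pnext_None.
have [|t' le' p'] := @sub_run Q (pif b P Q) (fun q => Some (inr q)) None _ _ _ _ _ p.
  by move=> s h /=; case: (pstep s h).1.
by rewrite -(subnK le') iterD p' iter_pnext_None.
Qed.

Lemma runs_while_stop (b : heads -> bool) P T : ~~ b (theads T) -> runs (pwhile b P) T T 1.
Proof.
move=> /negbTE bT; split; rewrite /= (@pnext_idle (pwhile b P) None None) //=.
by rewrite bT.
Qed.

Lemma runs_while_step (b : heads -> bool) P T1 T2 T3 t1 t2 : b (theads T1) -> runs P T1 T2 t1 ->
  runs (pwhile b P) T2 T3 t2 -> runs (pwhile b P) T1 T3 (t1 + t2).+1.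
Proof.
move=> bT [p] [q]; have [|t' le' p'] := @sub_run P (pwhile b P) Some (Some None) _ _ _ _ _ p.
  by move=> s h /=; case: (pstep s h).1.
apply: (@runs_le _ _ _ (t2 + t'.+1)).
  by rewrite addnS ltnS addnC leq_add2r.
split; rewrite iterD iterSr (@pnext_idle (pwhile b P) None (Some (Some (pstart P)))) /=.
  by rewrite p' q.
by rewrite bT.
Qed.

Definition upd (T : ftapes) (j : nat) (t : ftape) : ftapes :=
  fun i => if i == j :> nat then t else T i.

Definition on_tape (j : nat) (g : option bool -> option bool * direction) : prog :=
  pact (fun h => [ffun i : 'I_K.+1 => if i == j :> nat then g (h i) else (h i, Stay)]).

Lemma runs_on_tape j g T : j <= K ->
  let t := T (inord j) in
  runs (on_tape j g) T (upd T j (fwrite_move (g (t.2 0)).1 (g (t.2 0)).2 t)) 1.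
Proof.
move=> jK t; have [E] := runs_act (fun h => [ffun i : 'I_K.+1 =>
  if i == j :> nat then g (h i) else (h i, Stay)]) T.
split; rewrite E; congr pair; apply/funext => i.
rewrite /upd !ffunE /t; case: eqP => [<-|_].
  by rewrite inord_val.
by rewrite fwrite_move_stay.
Qed.

Lemma upd_upd T j t t' : upd (upd T j t) j t' = upd T j t'.
Proof. by apply/funext => i; rewrite /upd; case: eqP. Qed.

Lemma updK T j t : j <= K -> upd T j t (inord j) = t.
Proof. by move=> jK; rewrite /upd inordK // eqxx. Qed.

Lemma runs_on_tape_upd j g T t t' : j <= K ->
  fwrite_move (g (t.2 0)).1 (g (t.2 0)).2 t = t' ->
  runs (on_tape j g) (upd T j t) (upd T j t') 1.
Proof.
move=> jK tt'; have := @runs_on_tape j g (upd T j t) jK.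
by rewrite /= updK // tt' upd_upd.
Qed.

Definition put (j : nat) (b : bool) : prog := on_tape j (fun _ => (Some b, MoveRight)).
Definition move_right (j : nat) : prog := on_tape j (fun x => (x, MoveRight)).
Definition move_left (j : nat) : prog := on_tape j (fun x => (x, MoveLeft)).
Definition delete (j : nat) : prog := on_tape j (fun _ => (None, MoveLeft)).

Definition copy (i j : nat) : prog :=
  pact (fun h => [ffun k : 'I_K.+1 => if k == j :> nat then (h (inord i), MoveRight)
    else (h k, if k == i :> nat then MoveRight else Stay)]).

Definition reads (j : nat) (x : option bool) (h : heads) : bool := h (inord j) == x.
Definition nonblank (j : nat) (h : heads) : bool := isSome (h (inord j)).

(* The word [u ++ v], with the head behind [u]. *)
Definition at_pos (u v : bits) : bits * bits := (rev u, v).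

Definition tapes_of (l : seq (bits * bits)) : ftapes :=
  fun i => let t := nth ([::], [::]) l i in rtape t.1 (map Some t.2).

Local Notation get l j := (nth ([::], [::]) l j).
Local Notation set l j t := (set_nth ([::], [::]) l j t).

Lemma tapes_ofE l j : j <= K ->
  tapes_of l (inord j) = rtape (get l j).1 (map Some (get l j).2).
Proof. by move=> jK; rewrite /tapes_of inordK. Qed.

Lemma upd_tapes_of l j u v :
  upd (tapes_of l) j (rtape u (map Some v)) = tapes_of (set l j (u, v)).
Proof.
by apply/funext => i; rewrite /upd /tapes_of nth_set_nth /=; case: eqP.
Qed.

Lemma upd_id T j : j <= K -> upd T j (T (inord j)) = T.
Proof.
by move=> jK; apply/funext => i; rewrite /upd; case: eqP => // <-; rewrite inord_val.
Qed.

Lemma reads_tapes_of l j x : j <= K ->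
  reads j x (theads (tapes_of l)) = (ohead (get l j).2 == x).
Proof.
by move=> jK; rewrite /reads ffunE tapes_ofE //=; case: (get l j).2.
Qed.

Lemma nonblank_tapes_of l j : j <= K ->
  nonblank j (theads (tapes_of l)) = ((get l j).2 != [::]).
Proof.
by move=> jK; rewrite /nonblank ffunE tapes_ofE //=; case: (get l j).2.
Qed.

Lemma runs_put l j b w v : j <= K -> get l j = at_pos w v ->
  runs (put j b) (tapes_of l)
    (tapes_of (set l j (at_pos (rcons w b) (behead v)))) 1.
Proof.
move=> jK lj; have := @runs_on_tape j (fun _ => (Some b, MoveRight)) (tapes_of l) jK.
rewrite tapes_ofE // lj /=; case: v {lj} => [|x v] /=.
  by rewrite rtape_nil fwrite_move_right (upd_tapes_of _ _ _ [::]) /at_pos rev_rcons.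
by rewrite fwrite_move_right upd_tapes_of /at_pos rev_rcons.
Qed.

Lemma runs_move_right l j b w v : j <= K -> get l j = at_pos w (b :: v) ->
  runs (move_right j) (tapes_of l) (tapes_of (set l j (at_pos (rcons w b) v))) 1.
Proof.
move=> jK lj; have := @runs_on_tape j (fun x => (x, MoveRight)) (tapes_of l) jK.
by rewrite tapes_ofE // lj /= fwrite_move_right upd_tapes_of /at_pos rev_rcons.
Qed.

Lemma runs_copy l i j b w v w' : i <= K -> j <= K -> i != j ->
  get l i = at_pos w (b :: v) -> get l j = at_pos w' [::] ->
  runs (copy i j) (tapes_of l)
    (tapes_of (set (set l i (at_pos (rcons w b) v)) j (at_pos (rcons w' b) [::]))) 1.
Proof.
move=> iK jK ij li lj; have [E] := runs_act (fun h => [ffun k : 'I_K.+1 => if k == j :> nat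
  then (h (inord i), MoveRight) else (h k, if k == i :> nat then MoveRight else Stay)])
  (tapes_of l).
split; rewrite E; congr pair.
apply/funext => k; rewrite !ffunE -!upd_tapes_of /upd tapes_ofE // li /=.
case: eqP => [kj|_].
  by rewrite /tapes_of kj lj /= rtape_nil fwrite_move_right rev_rcons.
case: eqP => [ki|_]; last exact: fwrite_move_stay.
by rewrite /tapes_of ki li /= fwrite_move_right rev_rcons.
Qed.

Definition pskip : prog := pact idle.

Lemma runs_skip T : runs pskip T T 1.
Proof. by split; rewrite /= (@pnext_idle pskip tt None). Qed.

Definition append (j : nat) (w : bits) : prog :=
  foldr (fun b P => pseq (put j b) P) pskip w.

Lemma runs_append l j w w' : j <= K -> get l j = at_pos w' [::] ->
  runs (append j w) (tapes_of l) (tapes_of (set l j (at_pos (w' ++ w) [::])))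
    (size w).+1.
Proof.
move=> jK; elim: w w' l => [|b w IH] w' l lj.
  rewrite cats0 /at_pos -upd_tapes_of -[X in runs _ X](upd_id _ jK).
  by rewrite tapes_ofE // lj; exact: runs_skip.
rewrite -[_.+1]add1n; apply: runs_seq; first exact: runs_put lj.
rewrite -cat_rcons.
set l1 := set _ _ _; have -> : set l j (at_pos (rcons w' b ++ w) [::]) =
  set l1 j (at_pos (rcons w' b ++ w) [::]) by rewrite /l1 set_set_nth eqxx.
by apply: IH; rewrite /l1 nth_set_nth /= eqxx.
Qed.

(** The head may start on the blank behind the word, where the loop would stop at once; hence the
    first move. The loop ends on the blank in front of the word, and the last move steps back onto
    its first letter. *)
Definition rewind (j : nat) : prog :=
  pseq (move_left j) (pseq (pwhile (nonblank j) (move_left j)) (move_right j)).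

Lemma runs_left_loop T j u x w : j <= K ->
  runs (pwhile (nonblank j) (move_left j)) (upd T j (rtape u (Some x :: w)))
    (upd T j (rtape [::] (None :: map Some (rev u) ++ Some x :: w))) (2 * size u + 3).
Proof.
move=> jK; elim: u x w => [|y u IH] x w.
  apply: (@runs_while_step _ _ _ _ _ 1 1).
  - by rewrite /nonblank ffunE updK.
  - by apply: runs_on_tape_upd jK _; exact: fwrite_move_left0.
  apply: runs_while_stop.
  by rewrite /nonblank ffunE updK.
rewrite (_ : 2 * _ + 3 = (1 + (2 * size u + 3)).+1); last by rewrite /=; lia.
apply: runs_while_step.
- by rewrite /nonblank ffunE updK.
- by apply: runs_on_tape_upd jK _; exact: fwrite_move_left.
have := IH y (Some x :: w).
by rewrite rev_cons map_rcons cat_rcons.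
Qed.

Lemma runs_rewind l j w v : j <= K -> get l j = at_pos w v ->
  runs (rewind j) (tapes_of l) (tapes_of (set l j (at_pos [::] (w ++ v))))
    (2 * size w + 5).
Proof.
move=> jK lj; rewrite (_ : 2 * _ + 5 = 1 + ((2 * size w + 3) + 1)); last by lia.
have H1 := @runs_on_tape j (fun x => (x, MoveLeft)) (tapes_of l) jK.
apply: runs_seq H1 _; rewrite tapes_ofE // lj /=.
(* [v'] makes the cell under the head explicit even when it is blank. *)
pose v' : seq (option bool) := if v is [::] then [:: None] else map Some v.
have -> : rtape (rev w) (map Some v) = rtape (rev w) v'.
  by rewrite /v'; case: (v) => //; exact: rtape_nil.
have v'E : rtape [::] (map Some w ++ v') = rtape [::] (map Some (w ++ v)).
  by rewrite map_cat /v'; case: (v) => // ; rewrite /= cats1 cats0 rtape_rcons_blank.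
have [z [w' vE]] : exists z w', v' = z :: w'.
  by rewrite /v'; case: (v) => [|c v0]; [exists None, [::]|exists (Some c), (map Some v0)].
have -> : nth None (map Some v) 0 = z by move: vE; rewrite /v'; case: (v) => [[]|c v0 []].
rewrite vE; apply: (@runs_seq _ _ _
    (upd (tapes_of l) j (rtape [::] (None :: map Some w ++ v')))).
  move: (revK w); case: (rev w) => [|x u] <-.
    rewrite fwrite_move_left0 vE; apply: (@runs_le _ _ _ 1) => //.
    by apply: runs_while_stop; rewrite /nonblank ffunE updK.
  rewrite fwrite_move_left vE size_rev rev_cons map_rcons cat_rcons.
  by apply: runs_le (runs_left_loop _ _ _ _ jK) => /=; lia.
rewrite -upd_tapes_of; apply: runs_on_tape_upd jK _.
by rewrite /= fwrite_move_right0 v'E.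
Qed.

Definition erase (j : nat) : prog :=
  pseq (move_left j) (pseq (pwhile (nonblank j) (delete j)) (move_right j)).

Lemma runs_erase l j w : j <= K -> get l j = at_pos w [::] ->
  runs (erase j) (tapes_of l) (tapes_of (set l j (at_pos [::] [::]))) (2 * size w + 5).
Proof.
move=> jK lj; rewrite (_ : 2 * _ + 5 = 1 + ((2 * size w + 3) + 1)); last by lia.
have H1 := @runs_on_tape j (fun x => (x, MoveLeft)) (tapes_of l) jK.
apply: runs_seq H1 _; rewrite tapes_ofE // lj /=.
apply: (@runs_seq _ _ _ (upd (tapes_of l) j (rtape [::] [:: None]))); last first.
  rewrite -upd_tapes_of; apply: runs_on_tape_upd jK _.
  by rewrite /= fwrite_move_right0.
rewrite -(size_rev w) rtape_nil; case: (rev w) => [|x u] /=.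
  rewrite fwrite_move_left0 rtape_blank.
  apply: (@runs_le _ _ _ 1) => //.
  by apply: runs_while_stop; rewrite /nonblank ffunE updK.
rewrite fwrite_move_left rtape_blank.
elim: u x => [|y u IH] x.
  apply: (@runs_le _ _ _ (1 + 1).+1) => //; apply: runs_while_step.
  - by rewrite /nonblank ffunE updK.
  - by apply: runs_on_tape_upd jK _; exact: fwrite_move_left0.
  rewrite rtape_blank.
  by apply: runs_while_stop; rewrite /nonblank ffunE updK.
apply: runs_le; last first.
  apply: runs_while_step; last exact: (IH y).
  - by rewrite /nonblank ffunE updK.
  apply: runs_on_tape_upd jK _; rewrite /= fwrite_move_left.
  exact: rtape_blank.
by rewrite /=; lia.
Qed.

End Programs.

Arguments put {K}.
Arguments move_right {K}.
Arguments copy {K}.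
Arguments append {K} : simpl never.
Arguments rewind {K}.
Arguments erase {K}.

(** * Binary words and the routines that handle them *)

Definition digits_code (d : bits) : bits := flatten [seq [:: true; b] | b <- d].
Definition nat_code (d : bits) : bits := digits_code d ++ [:: false].

Fixpoint inc (d : bits) : bits :=
  match d with
  | true :: d' => false :: inc d'
  | false :: d' => true :: d'
  | [::] => [:: true]
  end.

(** The carry runs through the leading ones and stops at the first zero or behind the word; the loop
    of [increment] treats the digits in this form. *)
Lemma inc_split d : exists m d', [/\ d = nseq m true ++ d', ohead d' != Some true &
  inc d = nseq m false ++ true :: behead d'].
Proof.
elim: d => [|[] d [m [d' [dE d't incE]]]]; first by exists 0, [::].
  by exists m.+1, d'; rewrite /= -dE -incE.
by exists 0, (false :: d).
Qed.

Lemma size_inc d : size (inc d) <= (size d).+1.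
Proof. by elim: d => [//|[] d IH] /=. Qed.

Lemma bits_value_inc d : bits_value (inc d) = (bits_value d).+1.
Proof. by elim: d => [//|[] d IH] //=; rewrite IH; lia. Qed.

Lemma last_inc d : last true d -> last true (inc d).
Proof.
by elim: d => [//|[] [|c d] IH] //= h; move: (IH h); rewrite /=; case: c {IH h}.
Qed.

(* The rationals [0 / 1] and [1 / 1]. *)
Definition zero_code : bits := [:: false; true; true; false].
Definition one_code : bits := [:: true; true; false; true; true; false].

(** For a word [c] with a single [true] this is the code of a Dirac distribution. *)
Definition row_code (c : bits) : bits :=
  flatten [seq true :: (if b then one_code else zero_code) | b <- c] ++ [:: false].

Section Routines.
Variable K : nat.

Local Notation get l j := (nth ([::], [::]) l j).
Local Notation set l j t := (set_nth ([::], [::]) l j t).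
Local Notation tapes := (@tapes_of K).
Local Notation "P ;; Q" := (pseq P Q) (at level 60, right associativity).

Lemma eq_tapes_of l l' : (forall i, get l i = get l' i) -> tapes l = tapes l'.
Proof. by move=> E; apply/funext => i; rewrite /tapes_of E. Qed.

(** Lists of updates may differ in order and in overwritten entries and still describe the same
    tapes, so they are compared at each index, by cases on which indices coincide. *)
Ltac tapes_eq :=
  repeat match goal with H : is_true (negb (@eq_op _ ?a ?b)) |- _ =>
    let n := fresh in have n : ~ (@eq nat a b) := elimN eqP H; clear H
  end;
  apply: eq_tapes_of => ?;
  repeat match goal with
  | |- context [nth _ (set_nth _ _ _ _) _] => rewrite nth_set_nth /=
  | |- context [@eq_op _ ?a ?b] =>
    let e := fresh in
    case: (PeanoNat.Nat.eq_dec a b) => e;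
    [rewrite !e ?eqxx | rewrite (introF eqP e)] => /=
  end; try congruence.

Definition go_end (j : nat) : prog K := pwhile (nonblank j) (move_right j).

Lemma runs_go_end l j w v : j <= K -> get l j = at_pos w v ->
  runs (go_end j) (tapes l) (tapes (set l j (at_pos (w ++ v) [::]))) (2 * size v + 1).
Proof.
move=> jK; elim: v w l => [|b v IH] w l lj.
  rewrite cats0 (_ : tapes (set _ _ _) = tapes l); last by tapes_eq.
  by apply: runs_while_stop; rewrite nonblank_tapes_of ?lj.
rewrite (_ : 2 * _ + 1 = (1 + (2 * size v + 1)).+1); last by rewrite /=; lia.
apply: runs_while_step; first by rewrite nonblank_tapes_of ?lj.
  exact: runs_move_right lj.
rewrite -cat_rcons.
set l' := set l j _; rewrite (_ : tapes (set l j _) =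
  tapes (set l' j (at_pos (rcons w b ++ v) [::]))); last by rewrite /l'; tapes_eq.
by apply: IH; rewrite // /l' nth_set_nth /= eqxx.
Qed.

Lemma get_set (l : seq (bits * bits)) j t : get (set l j t) j = t.
Proof. by rewrite nth_set_nth /= eqxx. Qed.

Lemma get_set_neq (l : seq (bits * bits)) i j t : i != j -> get (set l j t) i = get l i.
Proof. by move=> /negbTE ij; rewrite nth_set_nth /= ij. Qed.

Definition emit_digits (j o : nat) : prog K :=
  rewind j ;; pwhile (nonblank j) (put o true ;; copy j o).

Lemma runs_emit_digits l j o d e : j <= K -> o <= K -> j != o ->
  get l j = at_pos d [::] -> get l o = at_pos e [::] ->
  runs (emit_digits j o) (tapes l) (tapes (set l o (at_pos (e ++ digits_code d) [::])))
    (5 * size d + 6).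
Proof.
move=> jK oK jo lj lo.
rewrite (_ : 5 * _ + 6 = (2 * size d + 5) + (3 * size d + 1)); last by lia.
apply: (runs_seq (runs_rewind jK lj)); rewrite cats0.
set l1 := set l j _.
have l1j : get l1 j = at_pos [::] d by rewrite get_set.
have l1o : get l1 o = at_pos e [::] by rewrite get_set_neq // eq_sym.
rewrite (_ : tapes (set l o _) = tapes (set (set l1 j (at_pos ([::] ++ d) [::])) o
  (at_pos (e ++ digits_code d) [::]))); last by rewrite /l1; tapes_eq.
suff loop w l2 : get l2 j = at_pos w d -> get l2 o = at_pos e [::] ->
    runs (pwhile (nonblank j) (put o true ;; copy j o)) (tapes l2)
      (tapes (set (set l2 j (at_pos (w ++ d) [::])) o
        (at_pos (e ++ digits_code d) [::]))) (3 * size d + 1).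
  exact: loop.
move=> {l1j l1o lj lo}; move: {l1}l2 => l1.
elim: d w e l1 => [|b d IH] w e l1 l1j l1o.
  rewrite !cats0 (_ : tapes (set _ _ _) = tapes l1); last by tapes_eq.
  by apply: runs_while_stop; rewrite nonblank_tapes_of ?l1j.
rewrite (_ : 3 * _ + 1 = ((1 + 1) + (3 * size d + 1)).+1); last by rewrite /=; lia.
apply: runs_while_step; first by rewrite nonblank_tapes_of ?l1j.
  apply: runs_seq; first exact: runs_put l1o.
  apply: runs_copy => //; first by rewrite get_set_neq // l1j.
  by rewrite get_set.
rewrite -cat_rcons (_ : e ++ digits_code (b :: d) =
  rcons (rcons e true) b ++ digits_code d); last by rewrite !cat_rcons.
set l2 := set _ _ _; rewrite (_ : tapes (set _ o _) =
  tapes (set (set l2 j (at_pos (rcons w b ++ d) [::])) o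
    (at_pos (rcons (rcons e true) b ++ digits_code d) [::]))); last first.
  by rewrite /l2; tapes_eq.
by apply: IH; rewrite /l2 ?get_set // get_set_neq // get_set.
Qed.

Definition emit_nat (j o : nat) : prog K := emit_digits j o ;; append o [:: false].

Lemma runs_emit_nat l j o d e : j <= K -> o <= K -> j != o ->
  get l j = at_pos d [::] -> get l o = at_pos e [::] ->
  runs (emit_nat j o) (tapes l) (tapes (set l o (at_pos (e ++ nat_code d) [::])))
    (5 * size d + 8).
Proof.
move=> jK oK jo lj lo.
rewrite (_ : 5 * _ + 8 = (5 * size d + 6) + 2); last by lia.
apply: (runs_seq (runs_emit_digits jK oK jo lj lo)).
set l1 := set l o _; rewrite (_ : tapes (set l o _) = tapes (set l1 o
  (at_pos ((e ++ digits_code d) ++ [:: false]) [::]))); last first.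
  by rewrite /l1 /nat_code catA; tapes_eq.
by apply: runs_append; rewrite // get_set.
Qed.

Definition read_nat (i j : nat) : prog K :=
  pwhile (reads i (Some true)) (move_right i ;; copy i j) ;; move_right i.

Lemma runs_read_nat l i j w d v e : i <= K -> j <= K -> i != j ->
  get l i = at_pos w (nat_code d ++ v) -> get l j = at_pos e [::] ->
  runs (read_nat i j) (tapes l)
    (tapes (set (set l i (at_pos (w ++ nat_code d) v)) j (at_pos (e ++ d) [::])))
    (3 * size d + 2).
Proof.
move=> iK jK ij li lj; have ji : j != i by rewrite eq_sym.
rewrite (_ : 3 * _ + 2 = (3 * size d + 1) + 1); last by lia.
apply: (@runs_seq _ _ _ _
  (tapes (set (set l i (at_pos (w ++ digits_code d) (false :: v))) j (at_pos (e ++ d) [::])))).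
  elim: d w e l li lj => [|b d IH] w e l li lj.
    rewrite !cats0 (_ : tapes (set _ _ _) = tapes l); last by tapes_eq.
    by apply: runs_while_stop; rewrite reads_tapes_of ?li.
  rewrite (_ : 3 * _ + 1 = ((1 + 1) + (3 * size d + 1)).+1); last by rewrite /=; lia.
  apply: runs_while_step; first by rewrite reads_tapes_of ?li.
    apply: runs_seq; first exact: runs_move_right li.
    apply: runs_copy => //; first by rewrite get_set.
    by rewrite get_set_neq // lj.
  set l2 := set _ _ _; rewrite (_ : tapes (set _ j _) =
    tapes (set (set l2 i (at_pos (rcons (rcons w true) b ++ digits_code d) (false :: v)))
      j (at_pos (rcons e b ++ d) [::]))); last first.
    by rewrite /l2 !cat_rcons /=; tapes_eq.
  by apply: IH; rewrite /l2 ?get_set // get_set_neq // get_set.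
set l1 := set (set l _ _) _ _.
rewrite (_ : tapes (set _ _ _) = tapes (set l1 i (at_pos (rcons (w ++ digits_code d) false) v))).
  by apply: runs_move_right; rewrite // /l1 get_set_neq // get_set.
by rewrite /l1 /nat_code catA cats1; tapes_eq.
Qed.

Lemma runs_skip_bits l j x m w v : j <= K -> get l j = at_pos w (nseq m x ++ v) ->
  ohead v != Some x ->
  runs (pwhile (reads j (Some x)) (move_right j)) (tapes l)
    (tapes (set l j (at_pos (w ++ nseq m x) v))) (2 * m + 1).
Proof.
move=> jK lj vx; elim: m w l lj => [|m IH] w l lj.
  rewrite cats0 (_ : tapes (set _ _ _) = tapes l); last by tapes_eq.
  by apply: runs_while_stop; rewrite reads_tapes_of ?lj.
rewrite (_ : 2 * _ + 1 = (1 + (2 * m + 1)).+1); last by lia.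
apply: runs_while_step; first by rewrite reads_tapes_of ?lj.
  exact: runs_move_right lj.
set l' := set l j _; rewrite (_ : tapes (set l j _) =
  tapes (set l' j (at_pos (rcons w x ++ nseq m x) v))).
  by apply: IH; rewrite get_set.
by rewrite cat_rcons /l'; tapes_eq.
Qed.

Definition increment (j : nat) : prog K :=
  rewind j ;; pwhile (reads j (Some true)) (put j false) ;; put j true ;; go_end j.

Lemma runs_increment l j d : j <= K -> get l j = at_pos d [::] ->
  runs (increment j) (tapes l) (tapes (set l j (at_pos (inc d) [::]))) (6 * size d + 8).
Proof.
move=> jK lj; have [m [d' [dE d'1 incE]]] := inc_split d.
have size_d : size d = m + size d' by rewrite dE size_cat size_nseq.
apply: runs_le; last first.
  apply: (runs_seq (runs_rewind jK lj)); rewrite cats0 dE.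
  set l1 := set l j _; have l1j : get l1 j = at_pos [::] (nseq m true ++ d').
    by rewrite get_set.
  apply: (@runs_seq _ _ _ _ (tapes (set l1 j (at_pos (nseq m false) d'))) _ (2 * m + 1)).
    suff loop w l2 : get l2 j = at_pos w (nseq m true ++ d') ->
        runs (pwhile (reads j (Some true)) (put j false)) (tapes l2)
          (tapes (set l2 j (at_pos (w ++ nseq m false) d'))) (2 * m + 1).
      exact: (loop [::]).
    move: {l1 l1j}l2 => l1; elim: m w l1 {dE incE size_d} => [|m IH] w l1 l1j.
      rewrite cats0 (_ : tapes (set _ _ _) = tapes l1); last by tapes_eq.
      by apply: runs_while_stop; rewrite reads_tapes_of ?l1j.
    rewrite (_ : 2 * _ + 1 = (1 + (2 * m + 1)).+1); last by lia.
    apply: runs_while_step; first by rewrite reads_tapes_of ?l1j.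
      exact: runs_put l1j.
    set l' := set l1 j _; rewrite (_ : tapes (set l1 j _) =
      tapes (set l' j (at_pos (rcons w false ++ nseq m false) d'))).
      by apply: IH; rewrite get_set.
    by rewrite cat_rcons /l'; tapes_eq.
  set l2 := set l1 j _; have l2j : get l2 j = at_pos (nseq m false) d' by rewrite get_set.
  apply: (runs_seq (runs_put true jK l2j)).
  set l3 := set l2 j _; rewrite (_ : tapes (set l j _) =
    tapes (set l3 j (at_pos (rcons (nseq m false) true ++ behead d') [::]))).
    by apply: runs_go_end; rewrite ?get_set.
  by rewrite /l3 /l2 /l1 cat_rcons -incE -dE; tapes_eq.
by rewrite size_behead size_d; lia.
Qed.

(** Overwriting the single [true] and the letter behind it moves the mark one place to the right and
    keeps the length, as long as a letter follows. *)
Definition shift_mark (j : nat) : prog K :=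
  rewind j ;; pwhile (reads j (Some false)) (move_right j) ;;
  put j false ;; put j true ;; go_end j.

Lemma runs_shift_mark l j m r : j <= K -> get l j = at_pos (nseq m false ++ true :: r) [::] ->
  runs (shift_mark j) (tapes l)
    (tapes (set l j (at_pos (nseq m.+1 false ++ true :: behead r) [::])))
    (4 * m + 4 * size r + 11).
Proof.
move=> jK lj; apply: runs_le; last first.
  apply: (runs_seq (runs_rewind jK lj)); rewrite cats0.
  set l1 := set l j _; have l1j : get l1 j = at_pos [::] (nseq m false ++ true :: r).
    by rewrite get_set.
  apply: (runs_seq (runs_skip_bits jK l1j isT)); rewrite cat0s.
  set l2 := set l1 j _; have l2j : get l2 j = at_pos (nseq m false) (true :: r).
    by rewrite get_set.
  apply: (runs_seq (runs_put false jK l2j)).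
  set l3 := set l2 j _; have l3j : get l3 j = at_pos (rcons (nseq m false) false) r.
    by rewrite get_set.
  apply: (runs_seq (runs_put true jK l3j)).
  set l4 := set l3 j _; rewrite (_ : tapes (set l j _) = tapes (set l4 j
    (at_pos (rcons (rcons (nseq m false) false) true ++ behead r) [::]))).
    by apply: runs_go_end; rewrite ?get_set.
  by rewrite /l4 /l3 /l2 /l1 -[m.+1]addn1 nseqD -catA !cat_rcons; tapes_eq.
by rewrite size_behead !size_cat size_nseq /=; lia.
Qed.

Definition emit_row (j o : nat) : prog K :=
  rewind j ;;
  pwhile (nonblank j)
    (pif (reads j (Some true)) (append o (true :: one_code)) (append o (true :: zero_code)) ;;
     move_right j) ;;
  append o [:: false].

Lemma runs_emit_row l j o c e : j <= K -> o <= K -> j != o ->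
  get l j = at_pos c [::] -> get l o = at_pos e [::] ->
  runs (emit_row j o) (tapes l) (tapes (set l o (at_pos (e ++ row_code c) [::])))
    (13 * size c + 8).
Proof.
move=> jK oK jo lj lo.
rewrite (_ : 13 * _ + 8 = (2 * size c + 5) + ((11 * size c + 1) + 2)); last by lia.
apply: (runs_seq (runs_rewind jK lj)); rewrite cats0.
set l1 := set l j _.
have l1j : get l1 j = at_pos [::] c by rewrite get_set.
have l1o : get l1 o = at_pos e [::] by rewrite get_set_neq // eq_sym.
pose f b := true :: (if b then one_code else zero_code).
apply: (@runs_seq _ _ _ _ (tapes (set (set l1 j (at_pos ([::] ++ c) [::])) o
    (at_pos (e ++ flatten [seq f b | b <- c]) [::])))); last first.
  set l2 := set _ _ _; rewrite (_ : tapes (set l o _) = tapes (set l2 o (at_pos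
    ((e ++ flatten [seq f b | b <- c]) ++ [:: false]) [::]))).
    by apply: runs_append; rewrite ?get_set.
  by rewrite /l2 /l1 -catA; tapes_eq.
suff loop w l2 : get l2 j = at_pos w c -> get l2 o = at_pos e [::] ->
    runs (pwhile (nonblank j) (pif (reads j (Some true)) (append o (f true))
      (append o (f false)) ;; move_right j)) (tapes l2)
      (tapes (set (set l2 j (at_pos (w ++ c) [::])) o
        (at_pos (e ++ flatten [seq f b | b <- c]) [::]))) (11 * size c + 1).
  exact: loop.
move=> {l1j l1o lj lo}; move: {l1}l2 => l1.
elim: c w e l1 => [|b c IH] w e l1 l1j l1o.
  rewrite !cats0 (_ : tapes (set _ _ _) = tapes l1); last by tapes_eq.
  by apply: runs_while_stop; rewrite nonblank_tapes_of ?l1j.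
apply: (@runs_le _ _ _ _ (((size (f b)).+2 + 1) + (11 * size c + 1)).+1).
  by clear l1j; case: b => /=; lia.
set l2 := set l1 o (at_pos (e ++ f b) [::]).
set l3 := set l2 j (at_pos (rcons w b) c).
apply: (@runs_while_step _ _ _ _ (tapes l3)).
- by rewrite nonblank_tapes_of ?l1j.
- apply: (@runs_seq _ _ _ _ (tapes l2)).
    apply: runs_if; rewrite reads_tapes_of // l1j /=.
    by rewrite /l2 /f; clear l3 l2 l1j; case: b => /=; exact: runs_append l1o.
  by apply: runs_move_right; rewrite // /l2 get_set_neq.
rewrite (_ : tapes (set _ o _) =
  tapes (set (set l3 j (at_pos (rcons w b ++ c) [::])) o
    (at_pos ((e ++ f b) ++ flatten [seq f b | b <- c]) [::]))).
  apply: IH; rewrite /l3 ?get_set //.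
  by rewrite get_set_neq ?(eq_sym o) // /l2 get_set.
by rewrite /l3 /l2 cat_rcons -catA /=; tapes_eq.
Qed.

End Routines.

Arguments emit_digits {K}.
Arguments emit_nat {K}.
Arguments read_nat {K}.
Arguments increment {K}.
Arguments shift_mark {K}.
Arguments emit_row {K}.

(** * The machine that computes the reduction *)

Definition term_code (d : bits * bits) : bits := true :: nat_code d.1 ++ nat_code d.2.
Definition terms_code (ds : seq (bits * bits)) : bits := flatten [seq term_code d | d <- ds].

Definition input_code (ds : seq (bits * bits)) (ya yb : bits) : bits :=
  terms_code ds ++ false :: nat_code ya ++ nat_code yb.

(** The characteristic word of state [s] among [s + r + 1] states. *)
Definition mark (s r : nat) : bits := nseq s false ++ true :: nseq r false.

Arguments mark : simpl never.
Arguments row_code : simpl never.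

(** The leading bits announce the state as a list item, action 0 as a list item, and [Some]; the
    middle ones announce action 1 and [Some]. *)
Definition rows_code (c c' : bits) : bits :=
  [:: true; true; true] ++ row_code c ++ [:: true; true] ++ row_code c' ++ [:: false].

Definition pair_code (u v : bits) : bits :=
  [:: true; true] ++ u ++ [:: true] ++ v ++ [:: false].

Arguments rows_code : simpl never.
Arguments pair_code : simpl never.

(** Three list items: the testing state belongs to the environment, the other two to the
    controller. *)
Definition ctrl_block : bits := [:: true; false; true; true; true; true].

Definition delta_block (n i : nat) : bits :=
  let m s := mark s (3 * n + 1 - s) in
  rows_code (m (3 * i + 2)) (m (3 * i + 4)) ++
  rows_code (m (3 * i + 3)) (m 0) ++ rows_code (m (3 * i + 4)) (m 0).

(** The last pair starts with k / 1, where k has the digits [false :: d.1 ++ d.2]. *)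
Definition reward_block (d : bits * bits) : bits :=
  pair_code zero_code zero_code ++ pair_code zero_code zero_code ++
  pair_code ([:: true; false] ++ digits_code d.1 ++ digits_code d.2 ++
             [:: false; true; true; false]) zero_code.

(** [M] is 4 y, obtained by two zero digits in front of the numerator. The last fraction is (k + 1)
    / b: compared with k only the first digit changes. *)
Definition psi_block (ya yb : bits) (d : bits * bits) : bits :=
  let M := [:: true; false; true; false] ++ nat_code ya ++ nat_code yb in
  pair_code zero_code zero_code ++
  pair_code M (nat_code d.1 ++ [:: true; true; false]) ++
  pair_code M ([:: true; true] ++ digits_code d.1 ++ nat_code d.2 ++ nat_code d.2).

(** In order: last state, last action, owners of the states, initial state 1, transitions, the
    reward property with bound 1, penalties, and the bound 2 y. *)
Definition output_code (ds : seq (bits * bits)) (ya yb : bits) : bits :=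
  let n := size ds in
  let z := rows_code (mark 0 (3 * n + 1)) (mark 0 (3 * n + 1)) in
  nat_code (iter (3 * n + 1) inc [::]) ++ [:: true; true; false] ++
  [:: true; false] ++ flatten (nseq n ctrl_block) ++ [:: true; false; false] ++
  [:: true; true; false] ++
  z ++ flatten [seq delta_block n i | i <- iota 0 n] ++ z ++ [:: false] ++
  [:: true; false] ++
  pair_code zero_code zero_code ++ flatten [seq reward_block d | d <- ds] ++
  pair_code one_code one_code ++ [:: false] ++ one_code ++
  pair_code zero_code zero_code ++ flatten [seq psi_block ya yb d | d <- ds] ++
  pair_code zero_code zero_code ++ [:: false] ++
  [:: true; false] ++ nat_code ya ++ nat_code yb.

(* Tapes: 0 holds the input, 1 and 2 the term being read (before that, 1      *)
(* holds the number of states), 3 and 4 the bound; 5 and 6 mark states, 7     *)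
(* marks state 0, 8 holds the number of terms in unary, 9 is the output.      *)
Local Notation tapes := (@tapes_of 9).
Local Notation "P ;; Q" := (pseq P Q) (at level 60, right associativity).
Local Notation while j P := (pwhile (reads j (Some true)) P).

Definition emit_rows (j j' : nat) : prog 9 :=
  append 9 [:: true; true; true] ;; emit_row j 9 ;; append 9 [:: true; true] ;;
  emit_row j' 9 ;; append 9 [:: false].

Definition read_term : prog 9 := move_right 0 ;; read_nat 0 1 ;; read_nat 0 2.

(** Each term adds three states: the words on tapes 5 to 7 are padded by three letters, the binary
    count on tape 1 grows by three, and the unary count of terms by one. The digits of the term are
    only read past. *)
Definition count_body : prog 9 :=
  move_right 0 ;; read_nat 0 2 ;; read_nat 0 2 ;; erase 2 ;;
  append 5 [:: false; false; false] ;; append 6 [:: false; false; false] ;;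
  append 7 [:: false; false; false] ;;
  increment 1 ;; increment 1 ;; increment 1 ;; append 8 [:: true].

Definition ctrl_body : prog 9 := append 9 ctrl_block ;; move_right 8.

(** Tape 6 advances at once to state 3 i + 4, where skipping leads. Tape 5 passes through 3 i + 2, 3
    i + 3 and 3 i + 4, the successors under action 0; tape 7 supplies state 0 for losing. *)
Definition delta_body : prog 9 :=
  shift_mark 5 ;; shift_mark 6 ;; shift_mark 6 ;; shift_mark 6 ;; emit_rows 5 6 ;;
  shift_mark 5 ;; emit_rows 5 7 ;; shift_mark 5 ;; emit_rows 5 7 ;; move_right 8.

Definition reward_body : prog 9 :=
  read_term ;;
  append 9 (pair_code zero_code zero_code ++ pair_code zero_code zero_code ++
            [:: true; true; true; false]) ;;
  emit_digits 1 9 ;; emit_digits 2 9 ;;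
  append 9 ([:: false; true; true; false; true] ++ zero_code ++ [:: false]) ;;
  erase 1 ;; erase 2.

Definition psi_body : prog 9 :=
  read_term ;;
  append 9 (pair_code zero_code zero_code ++
            [:: true; true; true; false; true; false]) ;;
  emit_nat 3 9 ;; emit_nat 4 9 ;; append 9 [:: true] ;; emit_nat 1 9 ;;
  append 9 ([:: true; true; false; false] ++ [:: true; true; true; false; true; false]) ;;
  emit_nat 3 9 ;; emit_nat 4 9 ;; append 9 [:: true; true; true] ;;
  emit_digits 1 9 ;; emit_nat 2 9 ;; emit_nat 2 9 ;; append 9 [:: false] ;;
  erase 1 ;; erase 2.

(** The initial words are the marks of states 1, 1 and 0 among the two states that exist without
    terms; the count on tape 1 starts at the last state, 1. *)
Definition count_phase : prog 9 :=
  append 5 [:: false; true] ;; append 6 [:: false; true] ;;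
  append 7 [:: true; false] ;; increment 1 ;; while 0 count_body ;;
  move_right 0 ;; read_nat 0 3 ;; read_nat 0 4.

Definition ctrl_phase : prog 9 :=
  emit_nat 1 9 ;; erase 1 ;; append 9 [:: true; true; false; true; false] ;;
  rewind 8 ;; while 8 ctrl_body ;;
  append 9 [:: true; false; false; true; true; false].

Definition delta_phase : prog 9 :=
  emit_rows 7 7 ;; rewind 8 ;; while 8 delta_body ;; emit_rows 7 7 ;;
  append 9 [:: false].

Definition reward_phase : prog 9 :=
  append 9 ([:: true; false] ++ pair_code zero_code zero_code) ;; rewind 0 ;;
  while 0 reward_body ;; append 9 (pair_code one_code one_code ++ false :: one_code).

Definition psi_phase : prog 9 :=
  append 9 (pair_code zero_code zero_code) ;; rewind 0 ;; while 0 psi_body ;;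
  append 9 (pair_code zero_code zero_code ++ [:: false; true; false]) ;;
  emit_nat 3 9 ;; emit_nat 4 9.

Definition reduction : prog 9 :=
  (count_phase ;; ctrl_phase ;; delta_phase ;; reward_phase ;; psi_phase) ;; rewind 9.

(** * Correctness and running time of the phases *)

Lemma runs_to K (P : prog K) T T1 T2 t1 t2 :
  runs P T T1 t1 -> T1 = T2 -> t1 <= t2 -> runs P T T2 t2.
Proof. by move=> p <- /runs_le; apply. Qed.

(* All words but those of tapes 0 and 8 have the head at their ends. *)
Local Notation cfg i x1 x2 y1 y2 a b z c o :=
  (tapes [:: i; at_pos x1 [::]; at_pos x2 [::]; at_pos y1 [::]; at_pos y2 [::];
             at_pos a [::]; at_pos b [::]; at_pos z [::]; c; at_pos o [::]]).

Local Ltac exec1 := first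
  [ apply: runs_append; by []
  | apply: runs_move_right; by []
  | apply: runs_read_nat; by []
  | apply: runs_increment; by []
  | apply: runs_shift_mark; by []
  | apply: runs_erase; by []
  | apply: runs_rewind; by []
  | apply: runs_emit_digits; by []
  | apply: runs_emit_nat; by []
  | apply: runs_emit_row; by [] ].

Local Ltac exec := apply: runs_seq; [exec1 | rewrite /=].

Lemma runs_emit_rows D j j' i x1 x2 y1 y2 a b z c o :
  5 <= j <= 7 -> 5 <= j' <= 7 ->
  size (nth [::] [:: a; b; z] (j - 5)) <= D -> size (nth [::] [:: a; b; z] (j' - 5)) <= D ->
  runs (emit_rows j j') (cfg i x1 x2 y1 y2 a b z c o)
    (cfg i x1 x2 y1 y2 a b z c (o ++ rows_code
       (nth [::] [:: a; b; z] (j - 5)) (nth [::] [:: a; b; z] (j' - 5))))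
    (26 * D + 30).
Proof.
have j_cases m : 5 <= m <= 7 -> m = 5 \/ m = 6 \/ m = 7 by lia.
move=> /j_cases [->|[->|->]] /j_cases [->|[->|->]] /= s1 s2;
  (apply: runs_to; [do 4 exec; exec1 |
     rewrite /= /rows_code -!catA //= | rewrite /=; lia]).
Qed.

Local Ltac normalise := do 3 rewrite /= -?catA ?cat_rcons ?cats0; rewrite //=.

Lemma runs_count_body (d : bits * bits) w v cnt a b z c D :
  size d.1 <= D -> size d.2 <= D -> size cnt <= D ->
  runs count_body
    (cfg (at_pos w (term_code d ++ v)) cnt [::] [::] [::] a b z (at_pos c [::]) [::])
    (cfg (at_pos (w ++ term_code d) v) (inc (inc (inc cnt))) [::] [::] [::]
       (a ++ nseq 3 false) (b ++ nseq 3 false) (z ++ nseq 3 false)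
       (at_pos (c ++ [:: true]) [::]) [::])
    (40 * D + 80).
Proof.
move=> s1 s2 sc; rewrite /term_code /= -catA; apply: runs_to.
- by do 10 exec; exec1.
- by normalise.
have := size_inc cnt; have := size_inc (inc cnt).
rewrite /= ?size_cat /=. move=> h1 h2; lia.
Qed.

Lemma mark_cat s r m : mark s r ++ nseq m false = mark s (r + m).
Proof. by rewrite /mark -catA /= -nseqD. Qed.

Lemma size_mark s r : size (mark s r) = (s + r).+1.
Proof. by rewrite size_cat /= !size_nseq addnS. Qed.

Lemma size_iter_inc m : size (iter m inc [::]) <= m.
Proof. by elim: m => //= m IH; apply: leq_trans (size_inc _) _. Qed.

Lemma runs_count_loop (ds : seq (bits * bits)) w v m D :
  {in ds, forall d : bits * bits, size d.1 <= D /\ size d.2 <= D} -> 3 * (m + size ds) + 1 <= D ->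
  runs (while 0 count_body)
    (cfg (at_pos w (terms_code ds ++ false :: v)) (iter (3 * m + 1) inc [::])
       [::] [::] [::] (mark 1 (3 * m)) (mark 1 (3 * m)) (mark 0 (3 * m + 1))
       (at_pos (nseq m true) [::]) [::])
    (cfg (at_pos (w ++ terms_code ds) (false :: v)) (iter (3 * (m + size ds) + 1) inc [::])
       [::] [::] [::] (mark 1 (3 * (m + size ds))) (mark 1 (3 * (m + size ds)))
       (mark 0 (3 * (m + size ds) + 1)) (at_pos (nseq (m + size ds) true) [::]) [::])
    (size ds * (40 * D + 81) + 1).
Proof.
elim: ds w m => [|d ds IH] w m sD mD.
  rewrite cats0 addn0; apply: runs_while_stop.
  by rewrite reads_tapes_of.
have [s1 s2] := sD d (mem_head _ _).
have sD' : {in ds, forall d : bits * bits, size d.1 <= D /\ size d.2 <= D}.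
  by move=> x xs; apply: sD; rewrite inE xs orbT.
apply: (@runs_le _ _ _ _ ((40 * D + 80) + (size ds * (40 * D + 81) + 1)).+1).
  by rewrite /=; lia.
apply: runs_while_step; first by rewrite reads_tapes_of.
  rewrite /terms_code /= -catA; apply: runs_count_body s1 s2 _.
  by apply: leq_trans (size_iter_inc _) _; move: mD => /=; lia.
rewrite !mark_cat -!iterS (_ : nseq m true ++ _ = nseq m.+1 true); last first.
  by rewrite -addn1 nseqD.
have := IH (w ++ term_code d) m.+1 sD' _.
rewrite -catA (_ : 3 * m.+1 = 3 * m + 3); last by lia.
rewrite addSnnS (_ : 3 * m + 1 + 3 = 3 * m + 3 + 1); last by lia.
rewrite (_ : (3 * m + 1).+3 = 3 * m + 3 + 1); last by lia.
by move=> H; apply: H; exact: mD.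
Qed.

Lemma rcons_nseq (T : Type) m (x : T) : rcons (nseq m x) x = nseq m.+1 x.
Proof. by elim: m => //= m ->. Qed.

Lemma runs_count_phase (ds : seq (bits * bits)) (ya yb : bits) D :
  {in ds, forall d : bits * bits, size d.1 <= D /\ size d.2 <= D} ->
  size ya <= D -> size yb <= D -> 3 * size ds + 1 <= D ->
  runs count_phase
    (cfg (at_pos [::] (input_code ds ya yb)) [::] [::] [::] [::] [::] [::] [::]
      (at_pos [::] [::]) [::])
    (cfg (at_pos (input_code ds ya yb) [::]) (iter (3 * size ds + 1) inc [::]) [::]
      ya yb (mark 1 (3 * size ds)) (mark 1 (3 * size ds)) (mark 0 (3 * size ds + 1))
      (at_pos (nseq (size ds) true) [::]) [::])
    (size ds * (40 * D + 81) + 6 * D + 40).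
Proof.
move=> sD sa sb nD; apply: runs_to.
- do 4 exec.
  have nD' : 3 * (0 + size ds) + 1 <= D by [].
  apply: (runs_seq (runs_count_loop [::] (nat_code ya ++ nat_code yb) sD nD')).
  rewrite add0n cat0s; do 2 exec; rewrite -[nat_code yb]cats0; exec1.
- by rewrite /input_code; normalise.
by rewrite /=; lia.
Qed.

Lemma runs_ctrl_loop i x1 x2 y1 y2 a b z m m' o :
  runs (while 8 ctrl_body)
    (cfg i x1 x2 y1 y2 a b z (at_pos (nseq m true) (nseq m' true)) o)
    (cfg i x1 x2 y1 y2 a b z (at_pos (nseq (m + m') true) [::])
      (o ++ flatten (nseq m' ctrl_block))) (9 * m' + 1).
Proof.
elim: m' m o => [|m' IH] m o.
  by rewrite addn0 cats0; apply: runs_while_stop; rewrite reads_tapes_of.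
rewrite (_ : 9 * _ + 1 = (8 + (9 * m' + 1)).+1); last by lia.
apply: (runs_while_step _ _ (T2 := cfg i x1 x2 y1 y2 a b z
    (at_pos (nseq m.+1 true) (nseq m' true)) (o ++ ctrl_block))).
- by rewrite reads_tapes_of.
- apply: runs_to; [by exec; exec1| |by []].
  by rewrite /= rcons_nseq.
rewrite addnS -addSn (_ : flatten _ = ctrl_block ++ flatten (nseq m' ctrl_block)) //.
by rewrite catA.
Qed.

Lemma runs_ctrl_phase i x1 y1 y2 a b z n D :
  size x1 <= D -> n <= D ->
  runs ctrl_phase
    (cfg i x1 [::] y1 y2 a b z (at_pos (nseq n true) [::]) [::])
    (cfg i [::] [::] y1 y2 a b z (at_pos (nseq n true) [::])
      (nat_code x1 ++ [:: true; true; false; true; false] ++ flatten (nseq n ctrl_block) ++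
       [:: true; false; false; true; true; false])) (20 * D + 50).
Proof.
move=> s1 nD; apply: runs_to.
- do 4 exec; rewrite cats0.
  by apply: (runs_seq (runs_ctrl_loop _ _ _ _ _ _ _ _ 0 n _)); exec1.
- by normalise.
by rewrite /= size_nseq; lia.
Qed.

Lemma runs_shift_to_mark l j s r : j <= 9 ->
  nth ([::], [::]) l j = at_pos (mark s r.+1) [::] ->
  runs (shift_mark j) (tapes l)
    (tapes (set_nth ([::], [::]) l j (at_pos (mark s.+1 r) [::]))) (4 * s + 4 * r + 15).
Proof.
move=> j9 lj; apply: runs_to (runs_shift_mark j9 lj) _ _ => //.
by rewrite size_nseq; lia.
Qed.

Lemma runs_delta_body i x1 x2 y1 y2 n j k o D : n = j + k.+1 -> 3 * n + 2 <= D ->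
  runs delta_body
    (cfg i x1 x2 y1 y2 (mark (3 * j + 1) (3 * k).+3) (mark (3 * j + 1) (3 * k).+3)
      (mark 0 (3 * n + 1)) (at_pos (nseq j true) (nseq k.+1 true)) o)
    (cfg i x1 x2 y1 y2 (mark (3 * j.+1 + 1) (3 * k)) (mark (3 * j.+1 + 1) (3 * k))
      (mark 0 (3 * n + 1)) (at_pos (nseq j.+1 true) (nseq k true))
      (o ++ delta_block n j)) (110 * D + 300).
Proof.
move=> nE nD; have sm s r : s + r = 3 * n + 1 -> size (mark s r) <= D.
  by rewrite size_mark => ->; lia.
apply: runs_to.
- do 4 (apply: runs_seq; [by apply: runs_shift_to_mark|rewrite /=]).
  apply: runs_seq; [by apply: (@runs_emit_rows D) => //; apply: sm => /=; lia|].
  apply: runs_seq; [by apply: runs_shift_to_mark|rewrite /=].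
  apply: runs_seq; [by apply: (@runs_emit_rows D) => //; apply: sm => /=; lia|].
  apply: runs_seq; [by apply: runs_shift_to_mark|rewrite /=].
  apply: runs_seq; [by apply: (@runs_emit_rows D) => //; apply: sm => /=; lia|].
  exec1.
- rewrite /=.
  have m2 : mark (3 * j + 1).+1 (3 * k).+2 =
      mark (3 * j + 2) (3 * n + 1 - (3 * j + 2)) by congr mark; lia.
  have m3 : mark (3 * j + 1).+2 (3 * k).+1 =
      mark (3 * j + 3) (3 * n + 1 - (3 * j + 3)) by congr mark; lia.
  have m4 : mark (3 * j + 1).+3 (3 * k) =
      mark (3 * j + 4) (3 * n + 1 - (3 * j + 4)) by congr mark; lia.
  have m5 : mark (3 * j.+1 + 1) (3 * k) =
      mark (3 * j + 4) (3 * n + 1 - (3 * j + 4)) by congr mark; lia.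
  by rewrite /delta_block m2 m3 m4 m5 subn0 rcons_nseq !catA.
by rewrite /=; lia.
Qed.

Lemma runs_delta_loop i x1 x2 y1 y2 n j k o D : n = j + k -> 3 * n + 2 <= D ->
  exists a b, runs (while 8 delta_body)
    (cfg i x1 x2 y1 y2 (mark (3 * j + 1) (3 * k)) (mark (3 * j + 1) (3 * k))
      (mark 0 (3 * n + 1)) (at_pos (nseq j true) (nseq k true)) o)
    (cfg i x1 x2 y1 y2 a b
      (mark 0 (3 * n + 1)) (at_pos (nseq n true) [::])
      (o ++ flatten [seq delta_block n i | i <- iota j k])) (k * (110 * D + 301) + 1).
Proof.
move=> nE nD; elim: k j o nE => [|k IH] j o nE.
  exists (mark (3 * j + 1) (3 * 0)), (mark (3 * j + 1) (3 * 0)).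
  rewrite cats0 nE addn0; apply: runs_while_stop.
  by rewrite reads_tapes_of.
have [a [b H]] := IH j.+1 (o ++ delta_block n j) (etrans nE (esym (addSnnS j k))).
exists a, b; apply: (@runs_le _ _ _ _ ((110 * D + 300) + (k * (110 * D + 301) + 1)).+1).
  by lia.
rewrite (_ : flatten _ = delta_block n j ++
  flatten [seq delta_block n i | i <- iota j.+1 k]) // catA.
apply: (runs_while_step _ _ H); first by rewrite reads_tapes_of.
rewrite (_ : 3 * k.+1 = (3 * k).+3); last by lia.
exact: runs_delta_body.
Qed.

Lemma runs_delta_phase i x1 x2 y1 y2 n o D : 3 * n + 2 <= D ->
  let z := rows_code (mark 0 (3 * n + 1)) (mark 0 (3 * n + 1)) in
  exists a b, runs delta_phase
    (cfg i x1 x2 y1 y2 (mark 1 (3 * n)) (mark 1 (3 * n))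
      (mark 0 (3 * n + 1)) (at_pos (nseq n true) [::]) o)
    (cfg i x1 x2 y1 y2 a b
      (mark 0 (3 * n + 1)) (at_pos (nseq n true) [::])
      (o ++ z ++ flatten [seq delta_block n i | i <- iota 0 n] ++ z ++ [:: false]))
    (n * (110 * D + 301) + 60 * D + 100).
Proof.
move=> nD z0; have [z zE] : exists z, rows_code (mark 0 (3 * n + 1)) (mark 0 (3 * n + 1)) = z.
  by eexists.
rewrite {}/z0 zE.
have sm s r : s + r = 3 * n + 1 -> size (mark s r) <= D.
  by rewrite size_mark => ->; lia.
have [a [b H]] := runs_delta_loop i x1 x2 y1 y2 (o ++ z) (esym (add0n n)) nD.
exists a, b.
apply: runs_to.
- apply: runs_seq; [by apply: (@runs_emit_rows D) => //; apply: sm|].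
  exec; rewrite cats0 zE; apply: (runs_seq H).
  apply: runs_seq; [by apply: (@runs_emit_rows D) => //; apply: sm|].
  exec1.
- by rewrite /= -zE -!catA.
by rewrite /= size_nseq; lia.
Qed.

Lemma runs_read_term (d : bits * bits) w v y1 y2 a b z c o :
  runs read_term
    (cfg (at_pos w (term_code d ++ v)) [::] [::] y1 y2 a b z c o)
    (cfg (at_pos (w ++ term_code d) v) d.1 d.2 y1 y2 a b z c o)
    (3 * size d.1 + 3 * size d.2 + 5).
Proof.
rewrite /term_code /= -catA; apply: runs_to.
- by do 2 exec; exec1.
- by normalise.
by rewrite /=; lia.
Qed.

Lemma runs_reward_body (d : bits * bits) w v y1 y2 a b z c o D :
  size d.1 <= D -> size d.2 <= D ->
  runs reward_body
    (cfg (at_pos w (term_code d ++ v)) [::] [::] y1 y2 a b z c o)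
    (cfg (at_pos (w ++ term_code d) v) [::] [::] y1 y2 a b z c (o ++ reward_block d))
    (30 * D + 100).
Proof.
move=> s1 s2; apply: runs_to.
- apply: (runs_seq (runs_read_term d w v y1 y2 a b z c o)).
  by do 5 exec; exec1.
- by rewrite /reward_block /pair_code; normalise.
by rewrite /=; lia.
Qed.

Lemma runs_psi_body (d : bits * bits) w v (ya yb : bits) a b z c o D :
  size d.1 <= D -> size d.2 <= D -> size ya <= D -> size yb <= D ->
  runs psi_body
    (cfg (at_pos w (term_code d ++ v)) [::] [::] ya yb a b z c o)
    (cfg (at_pos (w ++ term_code d) v) [::] [::] ya yb a b z c
      (o ++ psi_block ya yb d))
    (60 * D + 300).
Proof.
move=> s1 s2 sa sb; apply: runs_to.
- apply: (runs_seq (runs_read_term d w v ya yb a b z c o)).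
  by do 14 exec; exec1.
- by rewrite /psi_block /pair_code; normalise.
by rewrite /pair_code /=; lia.
Qed.

(** Shared by the loops that write rewards and penalties; [f d] is what the body writes for the term
    [d]. *)
Lemma runs_term_loop (body : prog 9) (f : bits * bits -> bits) (ds : seq (bits * bits))
    w v (ya yb : bits) a b z c o B :
  {in ds, forall d, forall w v o, runs body
    (cfg (at_pos w (term_code d ++ v)) [::] [::] ya yb a b z c o)
    (cfg (at_pos (w ++ term_code d) v) [::] [::] ya yb a b z c (o ++ f d)) B} ->
  runs (while 0 body)
    (cfg (at_pos w (terms_code ds ++ false :: v)) [::] [::] ya yb a b z c o)
    (cfg (at_pos (w ++ terms_code ds) (false :: v)) [::] [::] ya yb a b z c
      (o ++ flatten [seq f d | d <- ds])) (size ds * B.+1 + 1).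
Proof.
elim: ds w o => [|d ds IH] w o bodyE.
  by rewrite !cats0; apply: runs_while_stop; rewrite reads_tapes_of.
rewrite (_ : size _ * _ + 1 = (B + (size ds * B.+1 + 1)).+1); last by rewrite /=; lia.
have termsE : terms_code (d :: ds) = term_code d ++ terms_code ds by [].
rewrite termsE -catA; apply: runs_while_step; first by rewrite reads_tapes_of.
  by apply: bodyE; rewrite mem_head.
rewrite (_ : flatten _ = f d ++ flatten [seq f d | d <- ds]) // !catA.
by apply: IH => x xs; apply: bodyE; rewrite inE xs orbT.
Qed.

Section Phases.
Variables (ds : seq (bits * bits)) (ya yb : bits) (D : nat).
Hypothesis sD : {in ds, forall d : bits * bits, size d.1 <= D /\ size d.2 <= D}.
Hypothesis ya_le : size ya <= D.
Hypothesis yb_le : size yb <= D.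
Hypothesis input_le : size (input_code ds ya yb) <= D.

Let in_cat w v : w ++ v = input_code ds ya yb -> size w <= D.
Proof. by move=> wv; apply: leq_trans input_le; rewrite -wv size_cat leq_addr. Qed.

Lemma runs_reward_phase w v a b z c o : w ++ v = input_code ds ya yb ->
  runs reward_phase
    (cfg (at_pos w v) [::] [::] ya yb a b z c o)
    (cfg (at_pos (terms_code ds) (false :: nat_code ya ++ nat_code yb)) [::] [::]
      ya yb a b z c
      (o ++ ([:: true; false] ++ pair_code zero_code zero_code) ++
       flatten [seq reward_block d | d <- ds] ++
       pair_code one_code one_code ++ false :: one_code))
    (size ds * (30 * D + 101) + 2 * D + 100).
Proof.
move=> wv; have wD := in_cat wv; apply: runs_to.
- do 2 exec; rewrite wv /input_code.
  apply: (runs_seq (@runs_term_loop reward_body reward_block ds [::]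
    (nat_code ya ++ nat_code yb) ya yb a b z c _ (30 * D + 100) _)).
    by move=> d /sD [s1 s2] w' v' o'; exact: runs_reward_body.
  exec1.
- by rewrite /= -!catA.
by rewrite /pair_code /=; lia.
Qed.

Lemma runs_psi_phase w v a b z c o : w ++ v = input_code ds ya yb ->
  runs psi_phase
    (cfg (at_pos w v) [::] [::] ya yb a b z c o)
    (cfg (at_pos (terms_code ds) (false :: nat_code ya ++ nat_code yb)) [::] [::]
      ya yb a b z c
      (o ++ pair_code zero_code zero_code ++
       flatten [seq psi_block ya yb d | d <- ds] ++
       (pair_code zero_code zero_code ++ [:: false; true; false]) ++
       nat_code ya ++ nat_code yb))
    (size ds * (60 * D + 301) + 20 * D + 100).
Proof.
move=> wv; have wD := in_cat wv; apply: runs_to.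
- do 2 exec; rewrite wv /input_code.
  apply: (runs_seq (@runs_term_loop psi_body (psi_block ya yb) ds [::]
    (nat_code ya ++ nat_code yb) ya yb a b z c _ (60 * D + 300) _)).
    by move=> d /sD [s1 s2] w' v' o'; exact: runs_psi_body.
  by do 2 exec; exec1.
- by rewrite /= -!catA.
by rewrite /pair_code /=; lia.
Qed.

Lemma runs_phases : 3 * size ds + 2 <= D -> exists i a b z c,
  runs (count_phase ;; ctrl_phase ;; delta_phase ;; reward_phase ;; psi_phase)
    (cfg (at_pos [::] (input_code ds ya yb)) [::] [::] [::] [::] [::] [::] [::]
      (at_pos [::] [::]) [::])
    (cfg i [::] [::] ya yb a b z c (output_code ds ya yb))
    (size ds * (240 * D + 784) + 108 * D + 390).
Proof.
move=> nD; set n := size ds.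
pose cnt := iter (3 * n + 1) inc [::].
pose o1 := nat_code cnt ++ [:: true; true; false; true; false] ++
  flatten (nseq n ctrl_block) ++ [:: true; false; false; true; true; false].
have [a [b Hdelta]] := runs_delta_phase (at_pos (input_code ds ya yb) [::]) [::] [::]
  ya yb o1 nD.
exists (at_pos (terms_code ds) (false :: nat_code ya ++ nat_code yb)), a, b,
  (mark 0 (3 * n + 1)), (at_pos (nseq n true) [::]).
apply: runs_to.
- apply: (runs_seq (runs_count_phase sD ya_le yb_le _)); first by lia.
  apply: (runs_seq (runs_ctrl_phase (n := n) (D := D) _ _ _ _ _ _ _ _)).
  + by apply: leq_trans (size_iter_inc _) _; lia.
  + by lia.
  apply: (runs_seq Hdelta).
  apply: (runs_seq (runs_reward_phase _ _ _ _ _ (cats0 _))).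
  exact: (runs_psi_phase _ _ _ _ _ erefl).
- rewrite /output_code /o1 -/n -/cnt.
  move: (rows_code _ _) (pair_code zero_code _) (pair_code one_code _) => u1 u2 u3.
  by rewrite -!catA.
by rewrite -/n; lia.
Qed.

End Phases.

(** A step adds at most one nonblank cell to the left of a head. Since the output tape has its head
    at the end, the running time bounds the length of the output, and with it the cost of the final
    rewind. *)
Lemma runs_size_left K (P : prog K) l l' j t : j <= K ->
  runs P (tapes_of l) (tapes_of l') t ->
  size (nth ([::], [::]) l' j).1 <= size (nth ([::], [::]) l j).1 + t.
Proof.
move=> jK [E]; pose blank m (x : ftape) := forall i, m <= i -> x.1 i = None.
have blank_rtape u w : blank (size u) (rtape u w).
  by move=> i ui; rewrite /= nth_default // size_map.
have blank_move m y dir x : blank m x -> blank m.+1 (fwrite_move y dir x).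
  move=> xm; case: dir => -[|i] mi //=; apply: xm; lia.
have blank_iter s : blank (size (nth ([::], [::]) l j).1 + s)
    ((iter s (@pnext K P) (Some (pstart P), tapes_of l)).2 (inord j)).
  elim: s => [|s IH] /=; first by rewrite addn0 tapes_ofE //; exact: blank_rtape.
  rewrite /pnext; case: (iter s _ _) IH => -[q|] T /= IH; last first.
    by move=> i ti; apply: IH; lia.
  by rewrite addnS; exact: blank_move.
have := blank_iter t; rewrite E /= tapes_ofE //; move: (nth _ l' j) => -[u v] /=.
case/lastP: u => // u b H; rewrite leqNgt; apply/negP; rewrite size_rcons ltnS => le.
by have := H _ le; rewrite /= map_rcons nth_rcons size_map ltnn eqxx.
Qed.

(** * Total running time and output of the machine *)

Lemma size_digits_code d : size (digits_code d) = 2 * size d.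
Proof. by elim: d => //= b d IH; rewrite [size (digits_code _)]IH; lia. Qed.

Lemma size_nat_code d : size (nat_code d) = 2 * size d + 1.
Proof. by rewrite size_cat size_digits_code. Qed.

Lemma size_terms_code (ds : seq (bits * bits)) :
  size ds <= size (terms_code ds) /\
  {in ds, forall d : bits * bits, size d.1 + size d.2 <= size (terms_code ds)}.
Proof.
elim: ds => [//|d ds [IH1 IH2]]; rewrite (_ : terms_code _ = term_code d ++ terms_code ds) //.
rewrite size_cat /term_code /= size_cat !size_nat_code; split; first by lia.
by move=> x; rewrite inE => /orP[/eqP ->|/IH2]; lia.
Qed.

Lemma until_blank_nth (s : seq (option bool)) (w : bits) :
  nth None s = nth None (map Some w) -> until_blank s = w.
Proof.
elim: w s => [|b w IH] [|x s] // E; have := congr1 (@^~ 0) E => //=.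
- by move=> ->.
- by move=> ->; rewrite (IH s) //; apply/funext => i; have := congr1 (@^~ i.+1) E.
Qed.

Lemma runs_machine K (P : prog K) (w out : bits) l t :
  runs P (tapes_of [:: at_pos [::] w]) (tapes_of l) t ->
  nth ([::], [::]) l K = at_pos [::] out ->
  let c := iter t (@machine_step (machine_of P)) (initial_configuration (machine_of P) w) in
  halting (conf_state c) /\ machine_output c = out.
Proof.
move=> [H] lK c.
have initE : conf_ftapes (initial_configuration (machine_of P) w) =
    (Some (pstart P), tapes_of [:: at_pos [::] w]).
  congr pair; apply/funext => j; rewrite /= ffunE.
  have tE v : ftape_of (input_tape v) = rtape [::] (map Some v).
    by case: v => [|x v] //; rewrite rtape_nil.
  case: eqP => [->|j0]; rewrite tE // /tapes_of; case: j j0 => [[|[|j]] jlt] //= j0.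
  by case: j0; apply: val_inj.
have := conf_ftapes_iter (initial_configuration (machine_of P) w) t.
rewrite initE H -/c => cE; split.
  by have := congr1 fst cE => /= ->.
apply: until_blank_nth; have := congr1 (fun x => (x.2 ord_max).2) cE.
by rewrite /= /tapes_of /= lK.
Qed.

Lemma reduction_computes : exists a k : nat,
  forall (ds : seq (bits * bits)) (ya yb : bits),
  let w := input_code ds ya yb in
  exists2 t, t <= a * size w ^ k + a &
    let c := iter t (@machine_step (machine_of reduction))
      (initial_configuration (machine_of reduction) w) in
    halting (conf_state c) /\ machine_output c = output_code ds ya yb.
Proof.
(* The time is quadratic: at most [S] terms, each handled in a number of steps linear in [D]. The
   coefficient is a generous round number. *)
exists (200 * 200), 2 => ds ya yb w; set S := size w.
have [n_le ds_le] := size_terms_code ds.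
have SE : S = size (terms_code ds) + 2 * size ya + 2 * size yb + 3.
  rewrite /S /w /input_code size_cat /= size_cat !size_nat_code.
  by clear; move: (size (terms_code ds)) (size ya) (size yb) => p q r; lia.
pose D := 3 * S + 2.
have sD : {in ds, forall d : bits * bits, size d.1 <= D /\ size d.2 <= D}.
  by move=> d /ds_le; rewrite /D; lia.
have [] := @runs_phases ds ya yb D sD; rewrite /D; try lia.
  by rewrite -/w -/S; lia.
rewrite -/D => i [a [b [z [c H]]]].
have oK : 9 <= 9 by [].
have size_out := runs_size_left oK H.
rewrite /= size_rev add0n in size_out.
have {}H := runs_seq H (runs_rewind oK (erefl : nth ([::], [::]) [:: i; at_pos [::] [::];
  at_pos [::] [::]; at_pos ya [::]; at_pos yb [::]; at_pos a [::]; at_pos b [::];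
  at_pos z [::]; c; at_pos (output_code ds ya yb) [::]] 9 = at_pos (output_code ds ya yb) [::])).
rewrite cats0 in H; move: H; set T := _ + _ => H.
exists T.
  have nS : size ds <= S by lia.
  (* The rewind costs twice the length of the output plus 5, and that length is at most the time of
     the phases; hence the factor 3. *)
  apply: (@leq_trans (3 * (S * (240 * D + 784) + 108 * D + 390) + 5)).
    have : size ds * (240 * D + 784) <= S * (240 * D + 784) by rewrite leq_mul2r nS orbT.
    by rewrite /T; lia.
  have S1 : S <= S ^ 2 by rewrite -mulnn leq_pmulr; lia.
  have -> : S * (240 * D + 784) = 720 * S ^ 2 + 1264 * S.
    by rewrite /D -mulnn; ring.
  by rewrite /D; lia.
rewrite [X in runs _ (X) _](_ : _ = tapes [:: at_pos [::] w]) in H; last first.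
  by apply: eq_tapes_of; do 10!case=> //; case.
exact: runs_machine H erefl.
Qed.

(** * Codes *)

Lemma code_natP d : last true d -> code_nat (bits_value d) (nat_code d).
Proof. by move=> dt; exists d. Qed.

Lemma code_ratP d d' : last true d -> last true d' -> 0 < bits_value d' ->
  code_rat ((bits_value d)%:R / (bits_value d')%:R)%R (nat_code d ++ nat_code d').
Proof.
move=> dt d't d'0; exists (bits_value d), (bits_value d'); split=> //.
by exists (nat_code d), (nat_code d'); split=> //; apply: code_natP.
Qed.

Lemma code_rat0 : code_rat 0%R zero_code.
Proof. by have := @code_ratP [::] [:: true] isT isT isT; rewrite mul0r. Qed.

Lemma code_rat1 : code_rat 1%R one_code.
Proof. by have := @code_ratP [:: true] [:: true] isT isT isT; rewrite divr1. Qed.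

Lemma code_rat_nat d : last true d ->
  code_rat (bits_value d)%:R%R (nat_code d ++ [:: true; true; false]).
Proof.
by move=> dt; have := @code_ratP d [:: true] dt isT isT; rewrite divr1.
Qed.

Lemma code_catP (L L' : set bits) u v : L u -> L' v -> (L +++ L') (u ++ v).
Proof. by move=> Lu Lv; exists u, v. Qed.

Lemma code_seqP (I T : Type) (C : T -> set bits) (f : I -> T) (g : I -> bits) (r : seq I) :
  (forall i, C (f i) (g i)) ->
  code_seq C [seq f i | i <- r] (flatten [seq true :: g i | i <- r] ++ [:: false]).
Proof.
move=> fg; elim: r => [//|i r IH] /=; rewrite -catA -cat1s.
by apply: code_catP => //; apply: code_catP.
Qed.

Definition fun_code (n : nat) (g : nat -> bits) : bits :=
  flatten [seq true :: g i | i <- iota 0 n] ++ [:: false].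

Lemma code_funP n (T : Type) (C : T -> set bits) (f : 'I_n -> T) (g : nat -> bits) :
  (forall i, C (f i) (g i)) -> code_fun C f (fun_code n g).
Proof.
move=> fg; rewrite /fun_code -val_enum_ord -map_comp.
exact: (@code_seqP _ _ C f (fun i => g i)).
Qed.

(** A table over the states falls into state 0, the blocks of three and the final state, as the
    machine writes it. *)
Lemma fun_code_blocks n (g : nat -> bits) : fun_code (3 * n + 1).+1 g =
  (true :: g 0) ++
  flatten [seq (true :: g (3 * i + 1)) ++ (true :: g (3 * i + 2)) ++
               (true :: g (3 * i + 3)) | i <- iota 0 n] ++
  (true :: g (3 * n + 1)) ++ [:: false].
Proof.
rewrite /fun_code; set h := fun i => true :: g i; rewrite !catA; congr (_ ++ _).
elim: n => [|n IH]; first by rewrite /= !cats0.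
rewrite (_ : (3 * n.+1 + 1).+1 = (3 * n + 1).+1 + 3); last by lia.
rewrite iotaD map_cat flatten_cat IH.
rewrite (_ : iota 0 n.+1 = iota 0 n ++ [:: n]); last by rewrite -addn1 iotaD.
rewrite map_cat flatten_cat /=.
rewrite (_ : 0 + (3 * n + 1).+1 = 3 * n + 2) ?add0n; last by lia.
rewrite (_ : (3 * n + 2).+1 = 3 * n + 3); last by lia.
rewrite (_ : (3 * n + 3).+1 = 3 * n.+1 + 1); last by lia.
by rewrite !cats0 -!catA /= -!catA /= -!catA.
Qed.

Lemma row_code_mark t r : row_code (mark t r) =
  fun_code (t + r).+1 (fun i => if i == t then one_code else zero_code).
Proof.
rewrite /row_code /fun_code; congr (_ ++ _); congr flatten.
rewrite -addnS iotaD add0n /mark !map_cat /= eqxx; congr (_ ++ _ :: _).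
  rewrite -[LHS]cats0 map_nseq; apply: (@eq_from_nth _ [::]).
    by rewrite cats0 size_nseq size_map size_iota.
  move=> i; rewrite cats0 size_nseq => it; rewrite nth_nseq it (nth_map 0) ?size_iota //.
  by rewrite nth_iota // add0n ltn_eqF.
apply: (@eq_from_nth _ [::]); first by rewrite !size_map size_nseq size_iota.
move=> i; rewrite size_map size_nseq => ir.
rewrite map_nseq nth_nseq ir (nth_map 0) ?size_iota // nth_iota //.
by rewrite addSn gtn_eqF // ltnS leq_addr.
Qed.

Lemma pair_codeE u v : pair_code u v = true :: fun_code 2 (fun x => if x == 0 then u else v).
Proof. by rewrite /fun_code /pair_code /= cats0 -!catA. Qed.

Lemma rows_codeE c c' :
  rows_code c c' = pair_code (true :: row_code c) (true :: row_code c').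
Proof. by []. Qed.

Lemma bits_value_iter_inc m :
  bits_value (iter m inc [::]) = m /\ last true (iter m inc [::]).
Proof.
elim: m => //= m [IH1 IH2]; split; last exact: last_inc.
by rewrite bits_value_inc IH1.
Qed.

Lemma bits_value_cat u v : bits_value (u ++ v) = bits_value u + 2 ^ size u * bits_value v.
Proof.
elim: u => [|b u IH]; first by rewrite mul1n.
by rewrite /= -/(bits_value _) IH expnS -!muln2; lia.
Qed.

Lemma digits_code_cat u v : digits_code (u ++ v) = digits_code u ++ digits_code v.
Proof. by rewrite /digits_code map_cat flatten_cat. Qed.

Lemma nat_code_cons_cat b u v :
  nat_code (b :: u ++ v) = [:: true; b] ++ digits_code u ++ nat_code v.
Proof. by rewrite /nat_code -cat1s catA digits_code_cat digits_code_cat -!catA. Qed.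

Lemma last_cat_pos (b : bool) u v : last true v -> 0 < bits_value v -> last b (u ++ v).
Proof. by case: v => // c v; rewrite last_cat. Qed.

(** * The written word is a code of the constructed instance *)

Section Output.
Variables (R : realType) (ds : seq (bits * bits)) (ya yb : bits).

Definition term_ok (d : bits * bits) : bool :=
  [&& last true d.1, last true d.2, 0 < bits_value d.1 & 0 < bits_value d.2].

Hypothesis ds_ok : all term_ok ds.
Hypothesis y_ok : term_ok (ya, yb).

Let n := size ds.
(** The default is the fraction 1 / 1, so that [term_ok] holds at every index. *)
Let term i := nth ([:: true], [:: true]) ds i.
Let a i := bits_value (term i).1.
Let b i := bits_value (term i).2.
(* The digit prepended makes the codes of [k i] and [(k i).+1] equally easy to *)
(* write.                                                                     *)
Let k i := bits_value (false :: (term i).1 ++ (term i).2).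
Let y : rat := ((bits_value ya)%:R / (bits_value yb)%:R)%R.

Let term_okP i : term_ok (term i).
Proof.
case: (ltnP i n) => i_n; first by have /allP := ds_ok; apply; exact: mem_nth.
by rewrite /term nth_default.
Qed.

Let a_gt0 i : i < n -> 0 < a i. Proof. by have /and4P[] := term_okP i. Qed.
Let b_gt0 i : i < n -> 0 < b i. Proof. by have /and4P[] := term_okP i. Qed.

(** In [k i] the digits of [b i] stand behind those of [a i] and a further digit, so [k i] is at
    least twice [a i + b i]. *)
Let ab_le i : i < n -> a i * b i <= (k i).+1 ^ 2.
Proof.
move=> _; rewrite /k /= -/(bits_value _) bits_value_cat -/(a i) -/(b i) add0n.
have : b i <= 2 ^ size (term i).1 * b i by rewrite leq_pmull // expn_gt0.
by move: (2 ^ _ * _) => B bB; rewrite -mulnn -muln2; nia.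
Qed.

Let y_gt0 : (0 < y)%R.
Proof. by have /and4P[_ _ ? ?] := y_ok; rewrite divr_gt0 // ltr0n. Qed.

Definition output_instance : pcs_instance R :=
  sqrt_pcs n a b k y_gt0 R.

Let M_code : bits := [:: true; false; true; false] ++ nat_code ya ++ nat_code yb.

(** This word and the next two choose a code for each table entry. The lemmas ending in [wordP] show
    that the entries are coded correctly, those ending in [wordE] that the tables are what the
    machine writes. *)
Let delta_word s :=
  fun_code 2 (fun x => true :: row_code (mark (sqrt_next n s x) (3 * n + 1 - sqrt_next n s x))).

Let reward_word s x : bits :=
  if s == 3 * n + 1 then one_code
  else if sqrt_ctrl s && (s %% 3 == 0) && (x == 0) then
    nat_code (false :: (term (s %/ 3).-1).1 ++ (term (s %/ 3).-1).2) ++ [:: true; true; false]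
  else zero_code.

Let psi_word s x : bits :=
  if ~~ sqrt_ctrl s then zero_code
  else if x == 0 then M_code
  else if s %% 3 == 2 then nat_code (term (s %/ 3)).1 ++ [:: true; true; false]
  else nat_code (true :: (term (s %/ 3).-1).1 ++ (term (s %/ 3).-1).2) ++
       nat_code (term (s %/ 3).-1).2.

Let reward_wordP s x : code_rat (sqrt_reward n k s x) (reward_word s x).
Proof.
rewrite /sqrt_reward /reward_word; case: ifP => _; first exact: code_rat1.
case: ifP => _; last exact: code_rat0.
have /and4P[_ bt _ b0] := term_okP (s %/ 3).-1.
by apply: code_rat_nat; apply: last_cat_pos.
Qed.

Let psi_wordP s x : code_rat (sqrt_psi a b k y s x) (psi_word s x).
Proof.
rewrite /sqrt_psi /psi_word; case: ifP => _; first exact: code_rat0.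
case: ifP => _.
  have /and4P[/= at_ bt a0 b0] := y_ok.
  have -> : (4 * y = (bits_value [:: false, false & ya])%:R / (bits_value yb)%:R)%R.
    rewrite /y mulrA -natrM; congr (_%:R / _)%R; rewrite /= -/(bits_value _). lia.
  by apply: (@code_ratP [:: false, false & ya]) => //; exact: (@last_cat_pos false [::] ya).
case: ifP => _.
  by have /and4P[at_ _ _ _] := term_okP (s %/ 3); exact: code_rat_nat.
have /and4P[_ bt _ b0] := term_okP (s %/ 3).-1.
apply: (@code_ratP (true :: (term (s %/ 3).-1).1 ++ (term (s %/ 3).-1).2)) => //.
exact: last_cat_pos.
Qed.

Let sqrt_next_le s x : s <= 3 * n + 1 -> sqrt_next n s x <= 3 * n + 1.
Proof.
rewrite /sqrt_next; case: ifPn => // s0 sn.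
by case: ifP => [_|_]; [|case: ifPn => //]; lia.
Qed.

Let delta_wordP (s : state (sqrt_game n)) :
  code_fun (code_option (fun d : dist rat _ => code_fun code_rat d))
    (@delta (sqrt_game n) s) (delta_word s).
Proof.
apply: code_funP => x; rewrite -cat1s; apply: code_catP => //.
have sn : s <= 3 * n + 1 by exact: ltn_ord s.
have next_le := sqrt_next_le x sn.
rewrite row_code_mark subnKC //; apply: code_funP => i /=.
rewrite -val_eqE /= inordK //.
by case: eqP => _; [exact: code_rat1|exact: code_rat0].
Qed.

Let flatten_const (T : Type) (w : bits) (r : seq T) :
  flatten [seq w | _ <- r] = flatten (nseq (size r) w).
Proof. by elim: r => //= i r ->. Qed.

Let ctrl_wordE : fun_code (3 * n + 1).+1 (fun s => [:: sqrt_ctrl s]) =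
  [:: true; false] ++ flatten (nseq n ctrl_block) ++ [:: true; false; false].
Proof.
rewrite fun_code_blocks -[in RHS](size_iota 0 n) -(flatten_const ctrl_block (iota 0 n)).
rewrite sqrt_ctrl1; congr (_ ++ (flatten _ ++ _)).
by apply: eq_map => i; rewrite sqrt_ctrl1 sqrt_ctrl2 sqrt_ctrl3.
Qed.

Let delta_wordE : fun_code (3 * n + 1).+1 delta_word =
  rows_code (mark 0 (3 * n + 1)) (mark 0 (3 * n + 1)) ++
  flatten [seq delta_block n i | i <- iota 0 n] ++
  rows_code (mark 0 (3 * n + 1)) (mark 0 (3 * n + 1)) ++ [:: false].
Proof.
have wordE s t0 t1 : sqrt_next n s 0 = t0 -> sqrt_next n s 1 = t1 ->
    true :: delta_word s = rows_code (mark t0 (3 * n + 1 - t0)) (mark t1 (3 * n + 1 - t1)).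
  by move=> <- <-; rewrite rows_codeE pair_codeE.
rewrite fun_code_blocks !(wordE _ 0 0) ?subn0 //; last first.
- by rewrite /sqrt_next eqxx orbT.
- by rewrite /sqrt_next eqxx orbT.
congr (_ ++ (flatten _ ++ _)); apply/eq_in_map => i; rewrite mem_iota add0n => /andP[_ i_n].
have nextE j (x : nat) : 0 < j < 4 -> sqrt_next n (3 * i + j) x =
    if x == 0 then (3 * i + j).+1
    else if (3 * i + j) %% 3 == 1 then 3 * i + j + 3 else 0.
  by move=> j4; rewrite /sqrt_next ifN // negb_or; apply/andP; lia.
rewrite (wordE (3 * i + 1) (3 * i + 2) (3 * i + 4)) ; try by rewrite nextE ?modn_mul3D //=; lia.
rewrite (wordE (3 * i + 2) (3 * i + 3) 0) ; try by rewrite nextE ?modn_mul3D //=; lia.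
rewrite (wordE (3 * i + 3) (3 * i + 4) 0) ; try by rewrite nextE ?modn_mul3D //=; lia.
by rewrite /delta_block.
Qed.

Let map_term (f : bits * bits -> bits) :
  [seq f d | d <- ds] = [seq f (term i) | i <- iota 0 n].
Proof.
rewrite -{1}(mkseq_nth ([:: true], [:: true]) ds) /mkseq -map_comp.
by apply: eq_map.
Qed.

Let pair_wordE (g : nat -> nat -> bits) s u v : g s 0 = u -> g s 1 = v ->
  true :: fun_code 2 (g s) = pair_code u v.
Proof. by move=> <- <-; rewrite pair_codeE. Qed.

Let reward_wordE : fun_code (3 * n + 1).+1 (fun s => fun_code 2 (reward_word s)) =
  pair_code zero_code zero_code ++ flatten [seq reward_block d | d <- ds] ++
  pair_code one_code one_code ++ [:: false].
Proof.
rewrite fun_code_blocks map_term.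
rewrite (@pair_wordE reward_word 0 zero_code zero_code); last 2 first.
- by rewrite /reward_word addn1.
- by rewrite /reward_word addn1.
rewrite (@pair_wordE reward_word (3 * n + 1) one_code one_code); last 2 first.
- by rewrite /reward_word eqxx.
- by rewrite /reward_word eqxx.
congr (_ ++ (flatten _ ++ _)); apply/eq_in_map => i; rewrite mem_iota add0n => /andP[_ i_n].
have wordE j x : 0 < j < 4 -> reward_word (3 * i + j) x =
    if sqrt_ctrl (3 * i + j) && (j %% 3 == 0) && (x == 0) then
      nat_code (false :: (term ((3 * i + j) %/ 3).-1).1 ++
        (term ((3 * i + j) %/ 3).-1).2) ++ [:: true; true; false]
    else zero_code.
  by move=> j4; rewrite /reward_word ifN ?modn_mul3D //; lia.
have divE : (3 * i + 3) %/ 3 = i.+1 by lia.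
rewrite (@pair_wordE reward_word (3 * i + 1) zero_code zero_code) ?wordE ?sqrt_ctrl1 //.
rewrite (@pair_wordE reward_word (3 * i + 2) zero_code zero_code) ?wordE ?andbF //.
rewrite (@pair_wordE reward_word (3 * i + 3) (nat_code (false :: (term i).1 ++ (term i).2) ++
  [:: true; true; false]) zero_code) ?wordE ?sqrt_ctrl3 ?divE //.
by rewrite /reward_block nat_code_cons_cat -!catA.
Qed.

Let psi_wordE : fun_code (3 * n + 1).+1 (fun s => fun_code 2 (psi_word s)) =
  pair_code zero_code zero_code ++ flatten [seq psi_block ya yb d | d <- ds] ++
  pair_code zero_code zero_code ++ [:: false].
Proof.
rewrite fun_code_blocks map_term.
rewrite (@pair_wordE psi_word 0 zero_code zero_code) //.
rewrite (@pair_wordE psi_word (3 * n + 1) zero_code zero_code); last 2 first.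
- by rewrite /psi_word sqrt_ctrl1.
- by rewrite /psi_word sqrt_ctrl1.
congr (_ ++ (flatten _ ++ _)); apply/eq_map => i.
have divE2 : (3 * i + 2) %/ 3 = i by lia.
have divE3 : (3 * i + 3) %/ 3 = i.+1 by lia.
rewrite (@pair_wordE psi_word (3 * i + 1) zero_code zero_code); last 2 first.
- by rewrite /psi_word sqrt_ctrl1.
- by rewrite /psi_word sqrt_ctrl1.
rewrite (@pair_wordE psi_word (3 * i + 2) M_code
  (nat_code (term i).1 ++ [:: true; true; false])); last 2 first.
- by rewrite /psi_word sqrt_ctrl2.
- by rewrite /psi_word sqrt_ctrl2 modn_mul3D divE2.
rewrite (@pair_wordE psi_word (3 * i + 3) M_code
  (nat_code (true :: (term i).1 ++ (term i).2) ++ nat_code (term i).2)); last 2 first.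
- by rewrite /psi_word sqrt_ctrl3.
- by rewrite /psi_word sqrt_ctrl3 modn_mul3D divE3.
by rewrite /psi_block nat_code_cons_cat -!catA.
Qed.

Lemma output_codeP tau :
  pcode (p := pcs_problem R tau) output_instance (output_code ds ya yb).
Proof.
have [cnt_val cnt_last] := bits_value_iter_inc (3 * n + 1).
pose game_code := nat_code (iter (3 * n + 1) inc [::]) ++ [:: true; true; false] ++
  fun_code (3 * n + 1).+1 (fun s => [:: sqrt_ctrl s]) ++ [:: true; true; false] ++
  fun_code (3 * n + 1).+1 delta_word.
pose property_code := [:: true] ++ [:: false] ++
  fun_code (3 * n + 1).+1 (fun s => fun_code 2 (reward_word s)) ++ one_code.
have -> : output_code ds ya yb = game_code ++ property_code ++
    fun_code (3 * n + 1).+1 (fun s => fun_code 2 (psi_word s)) ++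
    ([:: true; false] ++ nat_code ya ++ nat_code yb).
  rewrite /game_code /property_code ctrl_wordE delta_wordE reward_wordE psi_wordE.
  rewrite /output_code -/n; move: (rows_code _ _) => z.
  move: (pair_code zero_code _) (pair_code one_code _) => u1 u2.
  by rewrite -!catA.
have code1 : code_nat 1 [:: true; true; false] by exact: (@code_natP [:: true]).
apply: code_catP; last apply: code_catP; last apply: code_catP.
- apply: code_catP; first by have := code_natP cnt_last; rewrite cnt_val.
  apply: code_catP; first exact: code1.
  apply: code_catP; first by apply: code_funP => s.
  apply: code_catP; first by rewrite /= inordK ?addn1.
  by apply: code_funP => s; exact: delta_wordP.
- apply: code_catP => //; apply: code_catP => //.
  apply: code_catP; last exact: code_rat1.
  by apply: code_funP => s; apply: code_funP => x; exact: reward_wordP.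
- by apply: code_funP => s; apply: code_funP => x; exact: psi_wordP.
have /and4P[/= at_ bt a0 b0] := y_ok.
rewrite /= (_ : 2 * y = (bits_value (false :: ya))%:R / (bits_value yb)%:R)%R.
  by apply: (@code_ratP (false :: ya)) => //; exact: (@last_cat_pos false [::] ya).
by rewrite /y mulrA -natrM; congr (_%:R / _)%R; rewrite /= -/(bits_value _); lia.
Qed.

Lemma output_instance_yes tau :
  pyes (p := pcs_problem R tau) output_instance <->
  (\sum_(d <- ds) Num.sqrt ((bits_value d.1)%:R / (bits_value d.2)%:R) <= ratr y :> R)%R.
Proof.
rewrite (sqrt_pcs_yes a_gt0 b_gt0 ab_le y_gt0 R tau).
rewrite [X in _ <-> is_true (X <= _)%R](_ : _ = \sum_(0 <= i < n)
  Num.sqrt ((a i)%:R / (b i)%:R))%R //.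
exact: (big_nth ([:: true], [:: true])).
Qed.

End Output.

(** * Decoding of the input, and the reduction *)

Lemma code_rat_inv q w : code_rat q w -> exists d d', [/\ last true d, last true d',
  0 < bits_value d', q = ((bits_value d)%:R / (bits_value d')%:R)%R &
  w = nat_code d ++ nat_code d'].
Proof.
move=> [a [b [b0 -> [u [v [[d [aE dt ->]] [d' [bE d't ->]] ->]]]]]].
by exists d, d'; rewrite aE bE.
Qed.

Lemma bits_value_gt0 d d' : (0 < (bits_value d)%:R / (bits_value d')%:R :> rat)%R ->
  0 < bits_value d.
Proof. by case: (bits_value d) => //; rewrite mul0r ltxx. Qed.

Lemma code_terms_inv (xs : seq rat) w : (forall x, x \in xs -> (0 < x)%R) ->
  code_seq code_rat xs w -> exists ds : seq (bits * bits), [/\ all term_ok ds,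
    xs = [seq ((bits_value d.1)%:R / (bits_value d.2)%:R)%R | d <- ds] &
    w = terms_code ds ++ [:: false]].
Proof.
elim: xs w => [|x xs IH] w x0; first by move=> ->; exists [::].
have {}IH w' := IH w' (fun z zxs => x0 z (@mem_behead _ (x :: xs) z zxs)).
move=> [_ [_ [-> [_ [_ [/code_rat_inv [d [d' [dt d't d'0 xE ->]]] /IH [ds [ds_ok -> ->]] ->]]] ->]]].
exists ((d, d') :: ds); split=> /=.
- rewrite ds_ok andbT /term_ok dt d't d'0 /= andbT.
  by apply: (@bits_value_gt0 _ d'); rewrite -xE x0 ?mem_head.
- by rewrite xE.
by rewrite /terms_code /= /term_code /= -!catA.
Qed.

Lemma sqrt_sum_code_inv R (x : pinstance (sqrt_sum_problem R)) w : pcode x w ->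
  exists ds ya yb, [/\ all term_ok ds, term_ok (ya, yb),
    ss_terms x = [seq ((bits_value d.1)%:R / (bits_value d.2)%:R)%R | d <- ds],
    ss_bound x = ((bits_value ya)%:R / (bits_value yb)%:R)%R & w = input_code ds ya yb].
Proof.
case: x => xs y xs0 y0 /= [_ [_ [/(code_terms_inv xs0) [ds [ds_ok xsE ->]]
  /code_rat_inv [ya [yb [at_ bt b0 yE ->]]] ->]]].
exists ds, ya, yb; split=> //; last by rewrite /input_code -catA.
rewrite /term_ok at_ bt b0 /= andbT.
by apply: (@bits_value_gt0 _ yb); rewrite -yE.
Qed.

Lemma machine_step_halting (M : machine) (c : configuration M) t :
  halting (conf_state c) -> iter t (@machine_step M) c = c.
Proof. by move=> h; elim: t => //= t ->; rewrite /machine_step h. Qed.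

Lemma sqrt_sum_reducible (R : realType) (tau : penalty_type) :
  polytime_reducible (sqrt_sum_problem R) (pcs_problem R tau).
Proof.
have [a [k computes]] := reduction_computes.
pose run t w := iter t (@machine_step (machine_of reduction))
  (initial_configuration (machine_of reduction) w).
pose bound (w : bits) := a * size w ^ k + a.
have runE ds ya yb : let w := input_code ds ya yb in
    halting (conf_state (run (bound w) w)) /\
    machine_output (run (bound w) w) = output_code ds ya yb.
  move=> w; have [t tle [h o]] := computes ds ya yb.
  by rewrite /run /bound -(subnK tle) iterD (machine_step_halting _ h).
(* The map must be defined on all words, so it takes the output after [bound w] steps. On codes of
   instances the machine has halted by then, and a halted configuration no longer changes. *)
exists (fun w => machine_output (run (bound w) w)); split.
  exists (machine_of reduction), a, k => w [x /sqrt_sum_code_inv].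
  move=> [ds [ya [yb [_ _ _ _ ->]]]]; exists (bound (input_code ds ya yb)) => //.
  by have [h o] := runE ds ya yb.
move=> x w /sqrt_sum_code_inv [ds [ya [yb [ds_ok y_ok xE yE ->]]]].
exists (output_instance R ds y_ok).
  by have [_ ->] := runE ds ya yb; exact: output_codeP.
rewrite (output_instance_yes R ds_ok y_ok tau) /= xE yE big_map.
have ratrE (i j : nat) : ratr (i%:R / j%:R : rat)%R = (i%:R / j%:R)%R :> R.
  by rewrite fmorph_div /= !ratr_nat.
by under eq_bigr do rewrite ratrE.
Qed.

Theorem theorem3p13 (R : realType) :
  polytime_reducible (sqrt_sum_problem R) (pcs_problem R StaticPenalty) /\
  polytime_reducible (sqrt_sum_problem R) (pcs_problem R DynamicPenalty).
Proof. by split; exact: sqrt_sum_reducible. Qed.
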